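(* Let $N\ge2$, let $\mathcal{X}_1,\dots,\mathcal{X}_N\subset\mathbb{R}^d$ be compact convex sets and $\mathcal{X}=\prod_{i=1}^N\mathcal{X}_i$. Let $k,p\in\mathbb{N}^*$ with $p>d/2$, and assume that $c\in\mathcal{C}^{k+p}(\mathcal{X})$. Then the Schrödinger map $S:\prod_{i=1}^N\mathcal{P}(\mathcal{X}_i)\to\tilde{\mathcal{C}}^k$ is Lipschitz continuous in the negative Sobolev norm $H^{-p}$, i.e. there exists $C>0$ such that for all $\boldsymbol{\mu},\boldsymbol{\nu}\in\prod_{i=1}^N\mathcal{P}(\mathcal{X}_i)$, $$\Vert S(\boldsymbol{\mu})-S(\boldsymbol{\nu})\Vert_{\tilde{\mathcal{C}}^k}\leq C\,\Vert\boldsymbol{\mu}-\boldsymbol{\nu}\Vert_{H^{-p}}.$$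
   Context: $\mathbb{N}^*=\mathbb{N}\setminus\{0\}$; $\mathcal{P}(K)$ denotes Borel probability measures on $K$. For compact convex $K\subset\mathbb{R}^m$, $\mathcal{C}^k(K)$ is the Banach space of functions on $K$ admitting a $\mathcal{C}^k$ extension to $\mathbb{R}^m$, with norm $\Vert f\Vert_{\mathcal{C}^k}=\inf_{\tilde f}\sup_{|\alpha|\le k}\Vert\partial^\alpha\tilde f\Vert_\infty$ over such extensions. Quotient space: $\tilde{\mathcal{C}}^k=\big(\prod_{i=1}^N\mathcal{C}^k(\mathcal{X}_i)\big)/\sim$ where $\boldsymbol{\phi}\sim\boldsymbol{\psi}$ iff there is $\kappa\in\mathbb{R}^N$ with $\sum_i\kappa_i=0$ and $\phi_i=\psi_i+\kappa_i$ for all $i$; it is endowed with the quotient norm (infimum over representatives of $\sum_i\Vert\phi_i\Vert_{\mathcal{C}^k}$). Write $\mathcal{X}_{-i}=\prod_{j\ne i}\mathcal{X}_j$, $x=(x_i,x_{-i})$, $\mu_{-i}=\otimes_{j\ne i}\mu_j$. Schrödinger map: for $\boldsymbol{\mu}\in\prod_i\mathcal{P}(\mathcal{X}_i)$, $S(\boldsymbol{\mu})\in\tilde{\mathcal{C}}^k$ is the unique class of $\boldsymbol{\phi}$ such that for every $i\in\{1,\dots,N\}$ and every $x_i\in\mathcal{X}_i$, $$\log\Big(\int_{\mathcal{X}_{-i}}e^{\sum_{j=1}^N\phi_j(x_j)-c(x_i,x_{-i})}\,d\mu_{-i}(x_{-i})\Big)=0.$$ Sobolev norms: $H^p(\mathcal{X}_i)$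 is the Hilbert space of $f\in L^2(\mathcal{X}_i)$ whose partial derivatives up to order $p$ are in $L^2(\mathcal{X}_i)$, with $\Vert f\Vert_{H^p(\mathcal{X}_i)}^2=\sum_{|\alpha|\le p}\int_{\mathcal{X}_i}|\partial^\alpha f|^2$. For $p>d/2$ it embeds in continuous functions (Morrey), and one defines $$\Vert\mu_i-\nu_i\Vert_{H^{-p}}=\sup\Big\{\int_{\mathcal{X}_i}f\,d(\mu_i-\nu_i):\Vert f\Vert_{H^p(\mathcal{X}_i)}\le1\Big\},\qquad \Vert\boldsymbol{\mu}-\boldsymbol{\nu}\Vert_{H^{-p}}=\sum_{i=1}^N\Vert\mu_i-\nu_i\Vert_{H^{-p}}.$$ *)

(* Defs.v *)
From HB Require Import structures.
From mathcomp Require Import all_boot all_order all_algebra.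
From mathcomp Require Import all_classical all_reals all_analysis.

Set Implicit Arguments.
Unset Strict Implicit.
Unset Printing Implicit Defensive.

Import Order.TTheory GRing.Theory Num.Theory.
Import numFieldNormedType.Exports.

Local Open Scope classical_set_scope.
Local Open Scope ring_scope.

(* Functions on R^(m x n). The case m = 1 is R^n, and 'M[R]_(N, d), seen
   through its rows, is (R^d)^N. *)
Section Ck.
Context {R : realType} {m n : nat}.
Local Notation V := 'M[R]_(m, n).
Implicit Types (f g : V -> R) (K : set V) (k : nat).

Definition partial (e : 'I_m * 'I_n) f : V -> R :=
  fun x => 'D_(delta_mx e.1 e.2) f x.

Fixpoint Ck k f : Prop :=
  continuous f /\
  if k is k'.+1 then
    forall e, (forall x, derivable f x (delta_mx e.1 e.2)) /\
              Ck k' (partial e f)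
  else True.

(* The multi-indices with entries at most k: every multi-index of order at
   most k is one of them. *)
Definition multi_index k := {ffun 'I_m * 'I_n -> 'I_k.+1}.

Definition order k (a : multi_index k) : nat := (\sum_e a e)%N.

Definition mpartial k (a : multi_index k) f : V -> R :=
  foldr (fun e g => iter (a e) (partial e) g) f (enum {: 'I_m * 'I_n}).

Definition Ck_extension k K f : set (V -> R) :=
  [set g | Ck k g /\ {in K, g =1 f}].

(* A function on K is represented by a function on the whole space whose
   values outside K are irrelevant. *)
Definition Ck_on k K f : Prop := Ck_extension k K f !=set0.

Definition Ck_norm k K f : \bar R :=
  ereal_inf [set ereal_sup
      [set y | exists2 a : multi_index k, (order a <= k)%N &
               exists x, y = `|mpartial a g x|%:E]
    | g in Ck_extension k K f].

Lemma CkB k f g : Ck k f -> Ck k g -> Ck k (f - g).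
Proof.
elim: k f g => [|k IHk] f g /= [cf df] [cg dg]; split=> //.
- by move=> x; apply: (@continuousB _ _ _ f g x); [exact: cf|exact: cg].
- by move=> x; apply: (@continuousB _ _ _ f g x); [exact: cf|exact: cg].
- move=> e; have [df1 df2] := df e; have [dg1 dg2] := dg e.
  split=> [x|]; first exact: derivableB.
  rewrite (_ : partial e (f - g) = partial e f - partial e g).
    exact: IHk.
  by apply/funext => x; rewrite /partial deriveB.
Qed.

Lemma Ck0 k : Ck k (0 : V -> R).
Proof.
have c0 : continuous (0 : V -> R) := @cst_continuous _ _ 0.
elim: k => [|k IHk] /=; split=> // e.
split=> [x|]; first exact: (derivable_cst (0 : R)).
rewrite (_ : partial e 0 = 0) //.
by apply/funext => x; rewrite /partial (@derive_val _ _ _ _ _ _ _ (is_derive_cst (0 : R) _ _)).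
Qed.

Lemma Ck_on0 k K : Ck_on k K 0.
Proof. by exists 0; split=> //; exact: Ck0. Qed.

Lemma Ck_onB k K f g : Ck_on k K f -> Ck_on k K g -> Ck_on k K (f - g).
Proof.
move=> [f' [Cf' f'E]] [g' [Cg' g'E]]; exists (f' - g'); split; first exact: CkB.
by move=> x Kx; rewrite !fctE f'E// g'E.
Qed.

End Ck.
Arguments multi_index : clear implicits.

(* The space prod_i C^k(X_i) and its quotient by the zero-sum constants. *)
Section potentials.
Context {R : realType} {N d : nat}.
Variables (k : nat) (X : 'I_N -> set 'rV[R]_d).

Definition is_potential : {pred 'I_N -> 'rV[R]_d -> R} :=
  fun phi => `[< forall i, Ck_on k (X i) (phi i) >].

Lemma is_potential_zmod_closed : zmod_closed is_potential.
Proof.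
split=> [|phi psi /asboolP Hphi /asboolP Hpsi]; apply/asboolP => i.
- exact: Ck_on0.
- exact: (Ck_onB (Hphi i) (Hpsi i)).
Qed.

HB.instance Definition _ :=
  GRing.isZmodClosed.Build _ is_potential is_potential_zmod_closed.

Record potential := Potential {
  potential_fun :> 'I_N -> 'rV[R]_d -> R;
  _ : potential_fun \in is_potential }.

HB.instance Definition _ := [isSub for potential_fun].
HB.instance Definition _ := [Choice of potential by <:].
HB.instance Definition _ := [SubChoice_isSubZmodule of potential by <:].

Lemma potentialN (phi : potential) i x : (- phi) i x = - phi i x.
Proof. by []. Qed.

Lemma potentialD (phi psi : potential) i x :
  (phi + psi) i x = phi i x + psi i x.
Proof. by []. Qed.

Definition potential_sim (phi psi : potential) : Prop :=
  exists kappa : 'I_N -> R, \sum_i kappa i = 0 /\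
    forall i x, X i x -> phi i x = psi i x + kappa i.

Definition potential_equiv : rel potential :=
  fun phi psi => `[< potential_sim phi psi >].

Lemma potential_equiv_refl : reflexive potential_equiv.
Proof.
move=> phi; apply/asboolP; exists (fun=> 0); split; first exact: big1.
by move=> i x _; rewrite addr0.
Qed.

Lemma potential_equiv_sym : symmetric potential_equiv.
Proof.
suff H phi psi : potential_equiv phi psi -> potential_equiv psi phi.
  by move=> phi psi; apply/idP/idP; exact: H.
move=> /asboolP[kappa [k0 H]]; apply/asboolP; exists (fun i => - kappa i).
by split=> [|i x Xx]; [rewrite sumrN k0 oppr0|rewrite H// addrK].
Qed.

Lemma potential_equiv_trans : transitive potential_equiv.
Proof.
move=> psi phi xi /asboolP[a [a0 Ha]] /asboolP[b [b0 Hb]]; apply/asboolP.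
exists (fun i => b i + a i); split=> [|i x Xx].
- by rewrite big_split/= a0 b0 addr0.
- by rewrite Ha// Hb// addrA.
Qed.

Canonical potential_equiv_rel := EquivRel potential_equiv
  potential_equiv_refl potential_equiv_sym potential_equiv_trans.

Definition Ctilde := {eq_quot potential_equiv}%qT.

HB.instance Definition _ := Choice.on Ctilde.
HB.instance Definition _ := EqQuotient.on Ctilde.

Local Open Scope quotient_scope.

Lemma pi_eqP (phi psi : potential) :
  reflect (potential_sim phi psi) (\pi_Ctilde phi == \pi_Ctilde psi).
Proof. by apply: (iffP idP); rewrite eqmodE => /asboolP. Qed.

Lemma Ctilde_surj (A : Ctilde) : exists phi, A = \pi_Ctilde phi.
Proof. by exists (repr A); rewrite reprK. Qed.

Definition Ctilde_zero : Ctilde := \pi_Ctilde 0.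
Definition Ctilde_opp (A : Ctilde) : Ctilde := \pi_Ctilde (- repr A).
Definition Ctilde_add (A B : Ctilde) : Ctilde := \pi_Ctilde (repr A + repr B).

Lemma Ctilde_oppE phi : Ctilde_opp (\pi_Ctilde phi) = \pi_Ctilde (- phi).
Proof.
apply/eqP/pi_eqP.
have /pi_eqP[a [a0 H]] : \pi_Ctilde (repr (\pi_Ctilde phi)) == \pi_Ctilde phi.
  by rewrite reprK.
exists (fun i => - a i); split; first by rewrite sumrN a0 oppr0.
by move=> i x Xx; rewrite !potentialN H// opprD.
Qed.

Lemma Ctilde_addE phi psi :
  Ctilde_add (\pi_Ctilde phi) (\pi_Ctilde psi) = \pi_Ctilde (phi + psi).
Proof.
apply/eqP/pi_eqP.
have /pi_eqP[a [a0 Ha]] : \pi_Ctilde (repr (\pi_Ctilde phi)) == \pi_Ctilde phi.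
  by rewrite reprK.
have /pi_eqP[b [b0 Hb]] : \pi_Ctilde (repr (\pi_Ctilde psi)) == \pi_Ctilde psi.
  by rewrite reprK.
exists (fun i => a i + b i); split; first by rewrite big_split/= a0 b0 addr0.
by move=> i x Xx; rewrite !potentialD Ha// Hb// addrACA.
Qed.

Lemma Ctilde_addA : associative Ctilde_add.
Proof.
move=> A B C; have [[a ->] [b ->] [c ->]] :=
  And3 (Ctilde_surj A) (Ctilde_surj B) (Ctilde_surj C).
by rewrite !Ctilde_addE addrA.
Qed.

Lemma Ctilde_addC : commutative Ctilde_add.
Proof. by move=> A B; rewrite /Ctilde_add addrC. Qed.

Lemma Ctilde_add0 : left_id Ctilde_zero Ctilde_add.
Proof. by move=> A; have [a ->] := Ctilde_surj A; rewrite Ctilde_addE add0r. Qed.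

Lemma Ctilde_addN : left_inverse Ctilde_zero Ctilde_opp Ctilde_add.
Proof. by move=> A; have [a ->] := Ctilde_surj A; rewrite Ctilde_oppE Ctilde_addE addNr. Qed.

HB.instance Definition _ := GRing.isZmodule.Build Ctilde
  Ctilde_addA Ctilde_addC Ctilde_add0 Ctilde_addN.

Definition Ctilde_norm (A : Ctilde) : \bar R :=
  ereal_inf [set (\sum_i Ck_norm k (X i) (phi i))%E
    | phi in [set phi : potential | \pi_Ctilde phi = A]].

End potentials.

(* The Borel sigma-algebra of R^d. *)
Definition borelRd (R : realType) (d : nat) :=
  g_sigma_algebraType (@open 'rV[R]_d).

Section sigma_finite_pack.
Context {disp : measure_display} {T : measurableType disp} {R : realType}.
Variables (mu : {measure set T -> \bar R}) (mufin : sigma_finite setT mu).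

Definition sigma_finite_of (_ : sigma_finite setT mu) : set T -> \bar R := mu.

HB.instance Definition _ := Measure.on (sigma_finite_of mufin).
HB.instance Definition _ :=
  Measure_isSigmaFinite.Build _ _ _ (sigma_finite_of mufin) mufin.

End sigma_finite_pack.

Lemma product_measure_sigma_finite d1 d2 (T1 : measurableType d1)
    (T2 : measurableType d2) (R : realType)
    (m1 : {sigma_finite_measure set T1 -> \bar R})
    (m2 : {sigma_finite_measure set T2 -> \bar R}) :
  sigma_finite setT (m1 \x m2)%E.
Proof.
have [F TF Foo] := sigma_finiteT m1; have [G TG Goo] := sigma_finiteT m2.
exists (fun n => if unpickle n is Some (i, j) then F i `*` G j else set0).
  apply/seteqP; split=> // -[x y] _.
  have [i _ Fx] : (\bigcup_i F i) x by rewrite -TF.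
  have [j _ Gy] : (\bigcup_i G i) y by rewrite -TG.
  by exists (pickle (i, j)) => //; rewrite pickleK.
move=> n; case: unpickle => [[i j]|]; last by rewrite measure0.
have [mF Ffin] := Foo i; have [mG Gfin] := Goo j.
split; first exact: measurableX.
by rewrite product_measure1E// lte_mul_pinfty// ge0_fin_numE.
Qed.

Section product.
Context {disp : measure_display} {T : measurableType disp} {R : realType}.
Local Open Scope ereal_scope.

(* The product of finitely many sigma-finite measures, on the product
   sigma-algebra of T^n. *)
Fixpoint tprod (n : nat) :
    ('I_n -> {sigma_finite_measure set T -> \bar R}) ->
    set (n.-tuple T) -> \bar R :=
  match n with
  | 0%N => fun _ => \d_([tuple] : 0.-tuple T)
  | n'.+1 => fun m =>
      pushforward (m ord0 \x tprod (fun i => m (lift ord0 i)))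
                  (fun p : T * n'.-tuple T => [tuple of p.1 :: p.2])
  end.

Lemma tprod_sigma_finite (n : nat)
    (m : 'I_n -> {sigma_finite_measure set T -> \bar R}) :
  exists P : {sigma_finite_measure set (n.-tuple T) -> \bar R},
    tprod m = P :> (set (n.-tuple T) -> \bar R).
Proof.
elim: n m => [|n IHn] m.
  by exists (\d_([tuple] : 0.-tuple T)).
have [P PE] := IHn (fun i => m (lift ord0 i)).
pose cns := fun p : T * n.-tuple T => [tuple of p.1 :: p.2].
have mcns : measurable_fun setT cns by exact: measurable_cons.
pose Q : {measure set _ -> \bar R} :=
  measure_function_pushforward__canonical__measure_function_Measure
    (m ord0 \x P) mcns.
have QE : tprod m = Q :> (set _ -> \bar R) by rewrite /= PE.
suff sQ : sigma_finite setT Q.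
  by exists (sigma_finite_of sQ); rewrite QE.
have [F FT Foo] := product_measure_sigma_finite (m ord0) P.
pose uncns (t : n.+1.-tuple T) := (thead t, [tuple of behead t]).
have uncnsK : cancel cns uncns.
  by case=> x t; congr (_, _); apply/val_inj.
have muncns : measurable_fun setT uncns.
  apply/measurable_fun_pairP; split; last exact: measurable_behead.
  exact: measurable_tnth.
exists (fun k => uncns @^-1` (F k)).
  by rewrite -preimage_bigcup -FT preimage_setT.
move=> k; split.
  by rewrite -[X in measurable X]setTI; apply: muncns => //; exact: (Foo k).1.
rewrite /Q/= /pushforward -comp_preimage.
rewrite (_ : uncns \o cns = id) ?preimage_id; first exact: (Foo k).2.
by apply/funext => x /=; rewrite uncnsK.
Qed.

Section tprod_measure.
Context {n : nat} (m : 'I_n -> {sigma_finite_measure set T -> \bar R}).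

Let tprod0 : tprod m set0 = 0.
Proof. by have [P ->] := tprod_sigma_finite m; exact: measure0. Qed.

Let tprod_ge0 A : 0 <= tprod m A.
Proof. by have [P ->] := tprod_sigma_finite m; exact: measure_ge0. Qed.

Let tprod_sigma_additive : semi_sigma_additive (tprod m).
Proof.
by have [P ->] := tprod_sigma_finite m; exact: measure_semi_sigma_additive.
Qed.

HB.instance Definition _ := isMeasure.Build _ _ _ (tprod m)
  tprod0 tprod_ge0 tprod_sigma_additive.

Let tprod_sigma_finiteT : sigma_finite setT (tprod m).
Proof. by have [P ->] := tprod_sigma_finite m; exact: sigma_finiteT. Qed.

HB.instance Definition _ :=
  Measure_isSigmaFinite.Build _ _ _ (tprod m) tprod_sigma_finiteT.

End tprod_measure.

Lemma tprodE (n : nat) (m : 'I_n -> {sigma_finite_measure set T -> \bar R})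
    (A : 'I_n -> set T) : (forall i, measurable (A i)) ->
  tprod m [set t | forall i, A i (tnth t i)] = \prod_i m i (A i).
Proof.
elim: n m A => [|n IHn] m A mA.
  rewrite big_ord0 /= diracE (_ : _ \in _)//.
  by rewrite inE/= => -[].
rewrite big_ord_recl /= /pushforward -IHn// -product_measure1E//; last first.
  rewrite (_ : mkset _ =
    \bigcap_(i in setT) (@tnth n T ^~ i @^-1` A (lift ord0 i))).
    apply: fin_bigcap_measurable => // i _.
    by rewrite -[X in measurable X]setTI; exact: measurable_tnth.
  by apply/seteqP; split=> [t At i _|t At i]; exact: At.
congr ((_ \x _) _); apply/seteqP; split=> -[x t] /=.
  move=> At; split=> [|i]; first exact: (At ord0).
  by have := At (lift ord0 i); rewrite tnthS.
by move=> [Ax At] i; case: (unliftP ord0 i) => [j|] ->//; rewrite tnthS.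
Qed.

End product.

Section lebesgue.
Context {R : realType} {d : nat}.

Definition row_of_tuple (t : d.-tuple (measurableTypeR R)) : borelRd R d :=
  \row_i (tnth t i : R).

Lemma measurable_row_of_tuple : measurable_fun setT row_of_tuple.
Proof.
apply: (@measurability _ _ _ (borelRd R d) setT row_of_tuple (@open 'rV[R]_d)).
  by [].
move=> _ [U oU <-]; rewrite setTI.
pose box (q : {ffun 'I_d -> rat * rat}) : set 'rV[R]_d :=
  [set x | forall i, x ord0 i \in `](ratr (q i).1), (ratr (q i).2)[].
pose F n := if unpickle n is Some q then
  if `[< box q `<=` U >] then box q else set0 else set0.
have -> : U = \bigcup_n F n.
  apply/seteqP; split=> [x Ux|x [n _]]; last first.
    by rewrite /F; case: unpickle => // q; case: asboolP => // H /H.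
  have /nbhs_ballP[e /= e0 eU] : nbhs x U by exact: open_nbhs_nbhs.
  have qP i : exists q : rat * rat,
      (ratr q.1 \in `](x ord0 i - e), (x ord0 i)[) /\
      (ratr q.2 \in `](x ord0 i), (x ord0 i + e)[).
    have [|q1 Hq1] := @rat_in_itvoo R (x ord0 i - e) (x ord0 i).
      by rewrite ltrBlDr ltrDl.
    have [|q2 Hq2] := @rat_in_itvoo R (x ord0 i) (x ord0 i + e).
      by rewrite ltrDl.
    by exists (q1, q2).
  have [q Hq] := choice qP.
  exists (pickle (finfun q)) => //; rewrite /F pickleK asboolT.
    move=> i; rewrite ffunE in_itv/=.
    have [] := Hq i; rewrite !in_itv/= => /andP[_ ->] /andP[->//].
  move=> y yq; apply: eU; split=> // j i; rewrite (ord1 j).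
  have := yq i; rewrite ffunE in_itv/= => /andP[qy yq'].
  have [] := Hq i; rewrite !in_itv/= => /andP[xq _] /andP[_ qx].
  rewrite /ball/= ltr_distlC (lt_trans xq qy)/=.
  exact: lt_trans yq' qx.
rewrite preimage_bigcup; apply: bigcup_measurable => n _; rewrite /F.
case: unpickle => [q|]; last by rewrite preimage_set0.
case: asboolP => _; last by rewrite preimage_set0.
rewrite (_ : _ @^-1` _ = \bigcap_(i in setT)
    (@tnth d (measurableTypeR R) ^~ i @^-1`
      `](ratr (q i).1), (ratr (q i).2)[%classic)).
  apply: fin_bigcap_measurable => // i _.
  have mI : (measurable : set (set (measurableTypeR R)))
    `](ratr (q i).1), (ratr (q i).2)[%classic by exact: measurable_itv.
  rewrite -[X in measurable X]setTI.
  exact: (@measurable_tnth _ (measurableTypeR R) d i measurableT _ mI).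
apply/seteqP; split=> [t qt i _|t qt i].
  by have := qt i; rewrite mxE.
by rewrite mxE; exact: qt.
Qed.

Definition lebesgueRd : set (borelRd R d) -> \bar R :=
  pushforward (tprod (fun _ : 'I_d => @lebesgue_measure R)) row_of_tuple.

HB.instance Definition _ := Measure.copy lebesgueRd
  (measure_function_pushforward__canonical__measure_function_Measure
     (tprod (fun _ : 'I_d => @lebesgue_measure R)) measurable_row_of_tuple).

End lebesgue.

Section sobolev.
Context {R : realType} {d : nat}.
Implicit Types (O K : set 'rV[R]_d) (f g u : 'rV[R]_d -> R) (p : nat).

Definition test_function O u : Prop :=
  [/\ forall k, Ck k u,
      compact (closure [set x | u x != 0]) &
      closure [set x | u x != 0] `<=` O].

Definition weak_partial p (a : multi_index 1 d p) O f g : Prop :=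
  forall u, test_function O u ->
    \int[@lebesgueRd R d]_(x in O) (f x * mpartial a u x) =
    (-1) ^+ order a * \int[@lebesgueRd R d]_(x in O) (g x * u x).

(* The H^p(K) norm, +oo when f is not in H^p(K). Weak derivatives being
   unique almost everywhere, the infimum is over a single value; the one of
   order 0 is f itself. *)
Definition Hp_norm p K f : \bar R :=
  (ereal_inf
    [set \sum_(a : multi_index 1 d p | (order a <= p)%N)
           \int[@lebesgueRd R d]_(x in K) (`|g a x| ^+ 2)%:E
    | g in [set g : multi_index 1 d p -> 'rV[R]_d -> R |
        forall a, (order a <= p)%N ->
          measurable_fun (K : set (borelRd R d)) (g a : borelRd R d -> R) /\
          weak_partial a K^° f (g a)]] `^ 2^-1)%E.

(* For p > d/2 an element of H^p(K) is identified with its continuous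
   representative. *)
Definition Hmp_dist p K (mu nu : set (borelRd R d) -> \bar R) : \bar R :=
  ereal_sup
    [set (\int[mu]_(x in K) (f x)%:E - \int[nu]_(x in K) (f x)%:E)%E
    | f in [set f | {within K, continuous f} /\ (Hp_norm p K f <= 1)%E]].

End sobolev.

Section schrodinger.
Context {R : realType} {N d : nat}.
Variable X : 'I_N -> set 'rV[R]_d.

(* The product of the X_i, a point of (R^d)^N being the matrix of its rows. *)
Definition prodX : set 'M[R]_(N, d) := [set x | forall i, X i (row i x)].

(* P(X_i): the Borel probability measures on R^d carried by X_i. *)
Definition carried (mu : 'I_N -> probability (borelRd R d) R) : Prop :=
  forall i, mu i (X i) = 1%E.

(* X_{-i}, whose coordinates are indexed by j |-> lift i j. *)
Definition prod_minus (i : 'I_N) : set (N.-1.-tuple (borelRd R d)) :=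
  [set y | forall j, X (lift i j) (tnth y j)].

Definition mu_minus (mu : 'I_N -> probability (borelRd R d) R) (i : 'I_N) :
    set (N.-1.-tuple (borelRd R d)) -> \bar R :=
  tprod (fun j => mu (lift i j)).

(* (x_i, x_{-i}) *)
Definition glue (i : 'I_N) (xi : 'rV[R]_d) (y : N.-1.-tuple (borelRd R d)) :
    'M[R]_(N, d) :=
  \matrix_(j < N) if unlift i j is Some j' then (tnth y j' : 'rV[R]_d) else xi.

(* lne is the logarithm on [0, +oo], so that the integral has to be 1 and not
   a value on which the real ln vanishes by convention. *)
Definition schrodinger_system (c : 'M[R]_(N, d) -> R)
    (mu : 'I_N -> probability (borelRd R d) R)
    (phi : 'I_N -> 'rV[R]_d -> R) : Prop :=
  forall i xi, X i xi ->
    lne (\int[mu_minus mu i]_(y in prod_minus i)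
          (expR (\sum_j phi j (row j (glue i xi y)) - c (glue i xi y)))%:E)%E
    = 0%E.

Local Open Scope quotient_scope.

(* The class of solutions, with 0 as the dummy value of xget. *)
Definition schrodinger_map (k : nat) (c : 'M[R]_(N, d) -> R)
    (mu : 'I_N -> probability (borelRd R d) R) : Ctilde k X :=
  xget 0 [set A : Ctilde k X | forall phi : potential k X,
            \pi_(Ctilde k X) phi = A -> schrodinger_system c mu phi].

Definition Hmp_distN (p : nat) (mu nu : 'I_N -> probability (borelRd R d) R) :
    \bar R :=
  (\sum_i Hmp_dist p (X i) (mu i) (nu i))%E.

End schrodinger.

(* Main.v *)
Require Import Defs.
From mathcomp Require Import all_boot all_order all_algebra.
From mathcomp Require Import all_classical all_reals all_analysis.
From mathcomp Require Import measurable_realfun.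
From mathcomp Require Import ring lra zify.
Import Order.TTheory GRing.Theory Num.Theory.
Import numFieldNormedType.Exports.

Set Implicit Arguments.
Unset Strict Implicit.
Unset Printing Implicit Defensive.

Local Open Scope classical_set_scope.
Local Open Scope ring_scope.

Local Notation glue := Defs.glue.
Local Notation order := Defs.order.

(** A solution of the Schrodinger system satisfies [phi i = - ln (avg i)], where
    [avg i x] integrates the kernel [exp (- c)] against the other potentials and
    measures. The regularity of the potentials therefore comes from the kernel
    alone, and every estimate is an estimate on averages.

    The cost is first extended to the whole space with bounded derivatives
    ([Ck_on_Cb]). The system then makes sense at every point, and a class of
    solutions on the supports is the class of a family that solves it everywhere
    ([schrodinger_map_solves]).

    The quantities [rho i = exp (phi i) * avg i], which the system requires to be
    1, are up to that constant the gradient of a convex functional, the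
    [energy]. Two values of an average differ by a bounded factor, whatever the
    potentials, so that solutions are bounded a priori once zero-sum constants
    have made the means of the potentials equal ([balance]). On bounded sets of
    such balanced potentials the functional is uniformly convex, hence
    ([stability]) the distance of two families in L^2 is controlled by the
    distance of their [rho] in L^2.

    Existence: near minimisers of the energy, improved by a sweep of the Sinkhorn
    algorithm, have small residuals, so they form a Cauchy sequence by stability,
    and their averages converge uniformly to those of a solution
    ([schrodinger_existence]).

    Lipschitz dependence: let [phi] solve the system of [mu] and [psi] that of
    [nu]. When the factors of the product measure are replaced one at a time, the
    integrand is a function of class C^p of the variable concerned, with bounds
    that do not depend on the measures. By integration by parts such a function
    lies in a fixed ball of H^p ([Hp_norm_le1]), so that [phi] solves the system
    of [nu] up to an error of the size of the dual distance ([avg_measure]).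
    Stability bounds [phi - psi] in L^1 by the same quantity, which is enough to
    compare the averages against any kernel with [p] bounded derivatives. Used
    with the [k] first derivatives of the kernel ([Cb_under_functional]), this
    compares the averages in C^k, and their logarithms are the potentials
    ([Cb_lnB], [solutions_lipschitz]). *)

(** * Bounds on the exponential and the logarithm *)

Section exponential_bounds.
Context {R : realType}.

Lemma expR_monotone (b s t : R) : - b <= s -> - b <= t ->
  expR (- b) * (s - t) ^+ 2 <= (s - t) * (expR s - expR t).
Proof.
wlog st : s t / t <= s => [H bs bt|_ bt].
  have [/H->//|/ltW ts] := leP t s.
  rewrite -[s - t]opprB sqrrN mulNr -mulrN opprB; exact: H.
have d0 : 0 <= s - t by rewrite subr_ge0.
rewrite expr2 mulrCA ler_wpM2l//.
have -> : expR s - expR t = expR t * (expR (s - t) - 1).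
  by rewrite mulrBr mulr1 -expRD [t + _]addrC subrK.
apply: ler_pM => //; rewrite ?expR_ge0 ?ler_expR//.
by rewrite lerBrDl expR_ge1Dx.
Qed.

Lemma expR_lipschitz (b s t : R) : s <= b -> t <= b ->
  `|expR s - expR t| <= expR b * `|s - t|.
Proof.
wlog st : s t / t <= s => [H sb tb|sb tb].
  have [/H->//|/ltW ts] := leP t s.
  by rewrite distrC [X in _ * X]distrC H.
rewrite !ger0_norm ?subr_ge0 ?ler_expR//.
have -> : expR s - expR t = expR s * (1 - expR (t - s)).
  by rewrite mulrBr mulr1 -expRD [s + _]addrC subrK.
apply: ler_pM; rewrite ?expR_ge0 ?ler_expR ?subr_ge0 ?expR_le1 ?subr_le0//.
by have := expR_ge1Dx (t - s); lra.
Qed.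

Lemma ln_bounds (b x : R) : expR (- b) <= x -> x <= expR b -> `|ln x| <= b.
Proof.
move=> bx xb; have x0 : 0 < x by rewrite (lt_le_trans _ bx)// expR_gt0.
by rewrite ler_norml -ler_expR -[X in _ && X]ler_expR lnK ?posrE// bx xb.
Qed.

Lemma ln_lipschitz (b u v : R) : 0 < b -> b <= u -> b <= v ->
  `|ln u - ln v| <= b^-1 * `|u - v|.
Proof.
move=> b0.
have H x y : b <= x -> b <= y -> ln x - ln y <= b^-1 * `|x - y|.
  move=> bx yb; have y0 := lt_le_trans b0 yb; have x0 := lt_le_trans b0 bx.
  rewrite -ln_div ?posrE//.
  have E : x / y = 1 + (x - y) / y by rewrite mulrBl divff ?gt_eqF// addrC subrK.
  apply: (@le_trans _ _ ((x - y) / y)).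
    by rewrite E le_ln1Dx// mulrBl divff ?gt_eqF// ltrBrDr addNr divr_gt0.
  apply: (@le_trans _ _ (`|x - y| / y)).
    by rewrite ler_pM2r ?invr_gt0// ler_norm.
  by rewrite mulrC ler_wpM2r// lef_pV2.
move=> bu bv; rewrite ler_norml; apply/andP; split; last exact: H.
by rewrite lerNl opprB distrC H.
Qed.

End exponential_bounds.

(** * Functions with bounded derivatives *)

Section Cb.
Context {R : realType} {m n : nat}.
Local Notation V := 'M[R]_(m, n).
Implicit Types (f g : V -> R) (q : nat) (M : R) (e : 'I_m * 'I_n).

Local Notation dl e := (delta_mx e.1 e.2 : V).

(** All the derivatives share one explicit bound [M]: the constants below may
    depend on a function through such a bound only. *)
Fixpoint Cb q M f : Prop :=
  [/\ continuous f, forall x, `|f x| <= M &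
  if q is q'.+1 then
    forall e, (forall x, derivable f x (dl e)) /\ Cb q' M (partial e f)
  else True].

Lemma Cb_continuous q M f : Cb q M f -> continuous f.
Proof. by case: q => [|q] []. Qed.

Lemma Cb_bound q M f : Cb q M f -> forall x, `|f x| <= M.
Proof. by case: q => [|q] []. Qed.

Lemma Cb_ge0 q M f : Cb q M f -> 0 <= M.
Proof. by move=> /Cb_bound/(_ 0); apply: le_trans. Qed.

Lemma Cb_derivable q M f e x : Cb q.+1 M f -> derivable f x (dl e).
Proof. by move=> [_ _ /(_ e)[]]. Qed.

Lemma Cb_partial q M f e : Cb q.+1 M f -> Cb q M (partial e f).
Proof. by move=> [_ _ /(_ e)[]]. Qed.

Lemma Cb_iter k q M e f : Cb (k + q) M f -> Cb q M (iter k (partial e) f).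
Proof.
elim: k q => [//|k IH] q Hf; apply: Cb_partial.
by apply: IH; rewrite addnS -addSn.
Qed.

Lemma CbS q M f : Cb q.+1 M f -> Cb q M f.
Proof.
elim: q f => [|q IH] f [cf bf df] //; split=> // e.
by have [dfe /IH] := df e.
Qed.

Lemma Cb_leq q q' M f : (q' <= q)%N -> Cb q M f -> Cb q' M f.
Proof.
move=> /subnK <-; elim: (q - q')%N => [//|r IH]; rewrite addSn => /CbS; exact: IH.
Qed.

Lemma Cb_le q M M' f : M <= M' -> Cb q M f -> Cb q M' f.
Proof.
move=> MM; elim: q f => [|q IH] f [cf bf df]; (split=> //; first by move=> x; exact: le_trans (bf x) MM).
by move=> e; have [dfe /IH] := df e.
Qed.

Lemma Cb_Ck q M f : Cb q M f -> Ck q f.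
Proof.
elim: q f => [|q IH] f [cf bf df]; split=> // e.
by have [dfe /IH] := df e.
Qed.

Lemma Cb_cst q (a : R) : Cb q `|a| (fun=> a).
Proof.
suff H (b : R) : `|b| <= `|a| -> Cb q `|a| (fun=> b) by exact: H.
have c0 (b' : R) : continuous ((fun=> b') : V -> R) by exact: cst_continuous.
elim: q b => [|q IH] b ab; split=> //.
move=> e; split; first by move=> x; exact: derivable_cst.
rewrite (_ : partial e _ = fun=> 0); first by apply: IH; rewrite normr0.
by apply/funext => x; rewrite /partial derive_cst.
Qed.

Lemma CbD q M1 M2 f g :
  Cb q M1 f -> Cb q M2 g -> Cb q (M1 + M2) (fun x => f x + g x).
Proof.
have H f' g' : (forall x, `|f' x| <= M1) -> (forall x, `|g' x| <= M2) ->
    forall x : V, `|f' x + g' x| <= M1 + M2.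
  by move=> bf bg x; rewrite (le_trans (ler_normD _ _))// lerD.
elim: q f g => [|q IH] f g [cf bf df] [cg bg dg].
  split=> //; last exact: H.
  by move=> x; apply: continuousD; [exact: cf|exact: cg].
split; [|exact: H|].
  by move=> x; apply: continuousD; [exact: cf|exact: cg].
move=> e; have [df1 df2] := df e; have [dg1 dg2] := dg e.
split=> [x|]; first exact: derivableD.
rewrite (_ : partial e _ = fun x => partial e f x + partial e g x).
  exact: IH.
by apply/funext => x; rewrite /partial deriveD.
Qed.

Lemma CbM q M1 M2 f g :
  Cb q M1 f -> Cb q M2 g -> Cb q (2 ^+ q * (M1 * M2)) (fun x => f x * g x).
Proof.
have H f' g' (C : R) : 1 <= C -> (forall x, `|f' x| <= M1) ->
    (forall x, `|g' x| <= M2) -> forall x : V, `|f' x * g' x| <= C * (M1 * M2).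
  move=> C1 bf bg x; rewrite normrM.
  apply: (@le_trans _ _ (M1 * M2)); first by rewrite ler_pM.
  rewrite ler_peMl// mulr_ge0//; first exact: le_trans (bf x).
  exact: le_trans (bg x).
elim: q f g => [|q IH] f g Hf Hg; have [cf bf df] := Hf; have [cg bg dg] := Hg.
  split=> //; last by apply: H => //; rewrite expr0.
  by move=> x; apply: continuousM; [exact: cf|exact: cg].
split; [|by apply: H => //; rewrite exprn_ege1// ler1n|].
  by move=> x; apply: continuousM; [exact: cf|exact: cg].
move=> e; have [df1 df2] := df e; have [dg1 dg2] := dg e.
split=> [x|]; first exact: derivableM.
rewrite (_ : partial e _ = fun x => f x * partial e g x + partial e f x * g x).
  rewrite exprS -mulrA mulr_natl mulr2n.
  by apply: CbD; apply: IH => //; exact: CbS.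
apply/funext => x; rewrite /partial deriveM//.
by rewrite /GRing.scale/= [X in _ + X = _]mulrC.
Qed.

Lemma CbZ q M f (a : R) : Cb q M f -> Cb q (`|a| * M) (fun x => a * f x).
Proof.
have H f' : (forall x, `|f' x| <= M) -> forall x : V, `|a * f' x| <= `|a| * M.
  by move=> bf x; rewrite normrM ler_wpM2l.
elim: q f => [|q IH] f [cf bf df].
  split=> //; last exact: H.
  by move=> x; apply: continuousM; [exact: cst_continuous|exact: cf].
split; [|exact: H|].
  by move=> x; apply: continuousM; [exact: cst_continuous|exact: cf].
move=> e; have [df1 df2] := df e.
split=> [x|]; first exact: derivableZ.
rewrite (_ : partial e _ = fun x => a * partial e f x).
  exact: IH.
by apply/funext => x; rewrite /partial deriveZ.
Qed.

Lemma CbN q M f : Cb q M f -> Cb q M (fun x => - f x).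
Proof.
move=> /(CbZ (-1)); rewrite normrN normr1 mul1r.
by under eq_fun do rewrite mulN1r.
Qed.

Lemma CbB q M1 M2 f g :
  Cb q M1 f -> Cb q M2 g -> Cb q (M1 + M2) (fun x => f x - g x).
Proof. by move=> Hf /CbN Hg; exact: CbD. Qed.

(** A directional derivative is the derivative of a function of one real
    variable, for which the chain rule is available. *)
Lemma is_derive_comp1 (g : R -> R) (dg : R) f (x v : V) :
  derivable f x v -> is_derive (f x) 1 g dg ->
  is_derive x v (g \o f) (dg * 'D_v f x).
Proof.
move=> dfx dgx.
pose F h := f (h *: v + x).
have F0 : F 0 = f x by rewrite /F scale0r add0r.
have FE (u : R -> R) : 'D_1 (u \o F) 0 = 'D_v (u \o f) x.
  rewrite /derive (_ : (fun h => _) =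
    fun h => h^-1 *: ((u \o f \o shift x) (h *: v) - (u \o f) x))//.
  by apply/funext => h /=; rewrite addr0 F0 /F [_%:A]mulr1.
have dF : derivable F 0 1 by move/derivable1P : dfx.
have DF : 'D_1 F 0 = 'D_v f x := FE id.
have H : is_derive (0 : R) (1 : R) (g \o F) (dg * 'D_1 F 0).
  rewrite -F0 in dgx; apply: is_derive1_comp.
  exact/derivableP.
split.
  by apply/derivable1P; have [] := H.
by rewrite -FE derive_val DF.
Qed.

Lemma partial_bound q (a : multi_index m n q) M f : Cb q M f -> (order a <= q)%N ->
  forall x, `|mpartial a f x| <= M.
Proof.
move=> Hf oa.
suff H r (s : seq ('I_m * 'I_n)) : Cb ((\sum_(e <- s) a e) + r) M f ->
    Cb r M (foldr (fun e g => iter (a e) (partial e) g) f s).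
  move=> x; apply: (@Cb_bound 0); apply: H; rewrite addn0.
  by apply: Cb_leq Hf; rewrite big_enum.
elim: s r => [|e s IH] r /=; first by rewrite big_nil.
rewrite big_cons => H; apply: Cb_iter; apply: IH.
by rewrite addnA [X in (X + r)%N]addnC.
Qed.

Lemma Cb_expR q M : exists C, forall f, Cb q M f -> Cb q C (fun x => expR (f x)).
Proof.
have cE f : continuous f -> continuous (fun x => expR (f x)).
  by move=> cf x; apply: (@continuous_comp _ _ _ f expR); [exact: cf|exact: continuous_expR].
elim: q => [|q [C IH]].
  exists (expR M) => f [cf bf _]; split=> // [|x]; first exact: cE.
  by rewrite ger0_norm ?expR_ge0// ler_expR (le_trans (ler_norm _)).
exists (Num.max (expR M) (2 ^+ q * (C * M))) => f Hf; have [cf bf df] := Hf.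
split; first exact: cE.
  move=> x; rewrite ger0_norm ?expR_ge0// le_max ler_expR (le_trans (ler_norm _))//.
move=> e; have [df1 df2] := df e.
have D x := is_derive_comp1 (df1 x) (is_derive_expR (f x)).
split=> [x|]; first by have [] := D x.
rewrite (_ : partial e _ = fun x => expR (f x) * partial e f x).
  apply: (@Cb_le _ (2 ^+ q * (C * M))); first by rewrite le_max lexx orbT.
  by apply: CbM => //; apply: IH; exact: CbS.
by apply/funext => x; exact: (@derive_val _ _ _ _ _ _ _ (D x)).
Qed.

Lemma Cb_inv q (mi M : R) : 0 < mi -> exists C, forall f,
  Cb q M f -> (forall x, mi <= f x) -> Cb q C (fun x => (f x)^-1).
Proof.
move=> mi0.
have cE f : continuous f -> (forall x, mi <= f x) -> continuous (fun x => (f x)^-1).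
  move=> cf mf x; apply: (@continuousV _ _ f x); last exact: cf.
  by rewrite gt_eqF// (lt_le_trans mi0).
have bE f : (forall x, mi <= f x) -> forall x, `|(f x)^-1| <= mi^-1.
  move=> mf x; have f0 := lt_le_trans mi0 (mf x).
  by rewrite ger0_norm ?invr_ge0 ?(ltW f0)// lef_pV2.
elim: q => [|q [C IH]].
  by exists mi^-1 => f [cf bf _] mf; split=> //; [exact: cE|exact: bE].
exists (Num.max mi^-1 (2 ^+ q * (M * (2 ^+ q * (C * C))))) => f Hf mf.
have [cf bf df] := Hf.
split; [exact: cE|by move=> x; rewrite le_max bE|].
have fn0 x : f x != 0 by rewrite gt_eqF// (lt_le_trans mi0).
move=> e; have [df1 df2] := df e.
split=> [x|]; first exact: derivableV.
rewrite (_ : partial e _ = fun x => - (partial e f x * ((f x)^-1 * (f x)^-1))).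
  apply: (@Cb_le _ (2 ^+ q * (M * (2 ^+ q * (C * C))))).
    by rewrite le_max lexx orbT.
  apply: CbN; apply: CbM => //; apply: CbM; apply: IH => //; exact: CbS.
apply/funext => x; rewrite /partial deriveV// /GRing.scale/= mulNr mulrC.
by rewrite expr2 invfM.
Qed.

(** The bound is proportional to the bound [D] on the difference of the
    arguments: this is how a Lipschitz estimate on averages becomes one on
    potentials. *)
Lemma Cb_lnB q (mi M : R) : 0 < mi -> exists2 C : R, 0 <= C & forall f g (D : R),
  Cb q M f -> (forall x, mi <= f x) -> Cb q M g -> (forall x, mi <= g x) ->
  Cb q D (fun x => f x - g x) ->
  Cb q (C * D) (fun x => ln (f x) - ln (g x)).
Proof.
move=> mi0.
have cL f : continuous f -> (forall x, mi <= f x) -> continuous (fun x => ln (f x)).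
  move=> cf mf x; apply: (@continuous_comp _ _ _ f (@ln R)); first exact: cf.
  by apply: continuous_ln; rewrite (lt_le_trans mi0).
have cE f g : continuous f -> (forall x, mi <= f x) -> continuous g ->
    (forall x, mi <= g x) -> continuous (fun x => ln (f x) - ln (g x)).
  move=> cf mf cg mg x.
  by apply: (@continuousB _ _ _ (fun x => ln (f x)) (fun x => ln (g x)) x); exact: cL.
have bE f g (D : R) : (forall x, mi <= f x) -> (forall x, mi <= g x) ->
    (forall x, `|f x - g x| <= D) -> forall x, `|ln (f x) - ln (g x)| <= mi^-1 * D.
  move=> mf mg bD x; apply: le_trans (ln_lipschitz mi0 (mf x) (mg x)) _.
  by rewrite ler_wpM2l ?invr_ge0// ltW.
elim: q => [|q [C C0 IH]].
  exists mi^-1; first by rewrite invr_ge0 ltW.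
  by move=> f g D [cf _ _] mf [cg _ _] mg [_ bD _]; split=> //; [exact: cE|exact: bE].
have [I HI] := Cb_inv q M mi0.
pose K := 2 ^+ q * ((2 ^+ q * (M + M)) * (2 ^+ q * (I * I))).
exists (Num.max mi^-1 K).
  by rewrite le_max invr_ge0 ltW.
move=> f g D Hf mf Hg mg Hfg.
have [cf bf df] := Hf; have [cg bg dg] := Hg; have [cfg bfg dfg] := Hfg.
have D0 : 0 <= D by exact: Cb_ge0 Hfg.
have leD k : k <= Num.max mi^-1 K -> k * D <= Num.max mi^-1 K * D.
  exact: ler_wpM2r.
split; [exact: cE| |].
  by move=> x; rewrite (le_trans (bE _ _ _ mf mg bfg x))// leD// le_max lexx.
have f0 x : 0 < f x by rewrite (lt_le_trans mi0).
have g0 x : 0 < g x by rewrite (lt_le_trans mi0).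
move=> e; have [df1 df2] := df e; have [dg1 dg2] := dg e; have [dfg1 dfg2] := dfg e.
have Df x := is_derive_comp1 (df1 x) (is_derive1_ln (f0 x)).
have Dg x := is_derive_comp1 (dg1 x) (is_derive1_ln (g0 x)).
have DD x := is_deriveB (Df x) (Dg x).
split=> [x|]; first by have [] := DD x.
(* The numerator of f' / f - g' / g is written in terms of f - g, so that each
   of its terms contains a factor bounded by D. *)
rewrite (_ : partial e _ = fun x => (partial e (fun x => f x - g x) x * g x
    - (f x - g x) * partial e g x) * ((f x)^-1 * (g x)^-1)).
  apply: (@Cb_le _ (2 ^+ q * ((2 ^+ q * (D * M) + 2 ^+ q * (D * M)) * (2 ^+ q * (I * I))))).
    rewrite (_ : 2 ^+ q * ((2 ^+ q * (D * M) + 2 ^+ q * (D * M)) * (2 ^+ q * (I * I))) = K * D).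
      by apply: leD; rewrite le_max lexx orbT.
    by rewrite /K; ring.
  apply: CbM; last by apply: CbM; apply: HI => //; exact: CbS.
  apply: CbB; apply: CbM => //; exact: CbS.
apply/funext => x; rewrite /partial (@derive_val _ _ _ _ _ _ _ (DD x)).
rewrite deriveB//; have := f0 x; have := g0 x => /lt0r_neq0 gx /lt0r_neq0 fx.
by field; rewrite gx fx.
Qed.

End Cb.

(** * Increments of functions with bounded derivatives *)

Section lipschitz.
Context {R : realType} {m n : nat}.
Local Notation V := 'M[R]_(m, n).
Implicit Types (f g : V -> R) (q : nat) (M : R) (e : 'I_m * 'I_n).

Local Notation dl e := (delta_mx e.1 e.2 : V).

(** The intermediate point is located by its distance to [a], so that [a] and
    [b] may be in any order. *)
Lemma mean_value (F : R -> R) (a b : R) : (forall x, derivable F x 1) ->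
  exists2 c : R, `|c - a| <= `|b - a| & F b - F a = 'D_1 F c * (b - a).
Proof.
move=> dF.
have H u v : u <= v -> exists2 c : R, u <= c <= v & F v - F u = 'D_1 F c * (v - u).
  move=> uv; case: (@MVT_segment R F (fun x => 'D_1 F x) u v uv).
  - by move=> x _; exact/derivableP.
  - apply: continuous_subspaceT => x.
    by apply/differentiable_continuous; exact/derivable1_diffP.
  by move=> c; rewrite in_itv/= => cuv ->; exists c.
have [ab|/ltW ba] := leP a b.
  have [c /andP[ac cb] E] := H _ _ ab; exists c => //.
  by rewrite !ger0_norm ?subr_ge0// lerD2r.
have [c /andP[bc ca] E] := H _ _ ba; exists c.
  by rewrite !ler0_norm ?subr_le0// lerN2 lerD2r.
by rewrite -[LHS]opprB E -mulrN opprB.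
Qed.

Lemma line_derivable f e x : (forall x, derivable f x (dl e)) ->
  forall h : R, derivable (fun h : R => f (h *: dl e + x)) h 1 /\
    'D_1 (fun h : R => f (h *: dl e + x)) h = partial e f (h *: dl e + x).
Proof.
move=> df h; set F := fun h : R => _.
have E : (fun k : R => k^-1 *: ((F \o shift h) (k *: 1) - F h)) =
   (fun k => k^-1 *: ((f \o shift (h *: dl e + x)) (k *: dl e) - f (h *: dl e + x))).
  by apply/funext => k /=; rewrite /F [_%:A]mulr1 scalerDl addrA.
split; last by rewrite /partial /derive E.
by rewrite /derivable E; exact: df.
Qed.

Lemma partial_increment M f e : (forall x, derivable f x (dl e)) ->
  (forall x, `|partial e f x| <= M) ->
  forall (h : R) x, `|f (h *: dl e + x) - f x| <= M * `|h|.
Proof.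
move=> df bf h x.
have [k|c _] := @mean_value (fun h : R => f (h *: dl e + x)) 0 h.
  exact: (line_derivable x df k).1.
rewrite scale0r add0r subr0 => ->; rewrite normrM ler_wpM2r//.
by rewrite (line_derivable x df c).2.
Qed.

(** The increment is split along the coordinates, hence the factor [m * n]. *)
Lemma Cb_lipschitz M f : Cb 1 M f -> forall x y,
  `|f y - f x| <= (m * n)%:R * M * `|y - x|.
Proof.
move=> Hf x y.
pose c e := (y - x) e.1 e.2.
have cle e : `|c e| <= `|y - x|.
  rewrite [leRHS]/Num.Def.normr/= mx_normrE.
  exact: (le_bigmax _ (fun e : 'I_m * 'I_n => `|(y - x) e.1 e.2|)).
have H (s : seq ('I_m * 'I_n)) :
    `|f (\sum_(e <- s) c e *: dl e + x) - f x| <= (size s)%:R * M * `|y - x|.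
  elim: s => [|e s IH]; first by rewrite big_nil add0r subrr normr0 mul0r mul0r.
  rewrite big_cons -addrA -(subrKA (f (\sum_(j <- s) c j *: dl j + x))).
  apply: le_trans (ler_normD _ _) _.
  rewrite /= mulrS mulrDl mulrDl mul1r lerD//.
  apply: (@le_trans _ _ (M * `|c e|)).
    by apply: partial_increment => z; [exact: Cb_derivable Hf|exact: (Cb_bound (Cb_partial _ Hf))].
  by rewrite ler_wpM2l// (Cb_ge0 Hf).
have := H (enum {: 'I_m * 'I_n}).
rewrite -cardE card_prod !card_ord big_enum/=.
rewrite (_ : \sum_e _ = y - x) ?subrK//.
by rewrite [RHS]matrix_sum_delta pair_big.
Qed.

(** The remainder is uniform in the base point, which makes the difference
    quotients of a family of functions converge uniformly. *)
Lemma Cb_taylor M f e : Cb 2 M f -> forall (h : R) x,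
  `|f (h *: dl e + x) - f x - h * partial e f x| <= M * h ^+ 2.
Proof.
move=> Hf h x.
have df y : derivable f y (dl e) by exact: Cb_derivable Hf.
have [k|c] := @mean_value (fun h : R => f (h *: dl e + x)) 0 h.
  exact: (line_derivable x df k).1.
rewrite scale0r add0r !subr0 => ch ->; rewrite (line_derivable x df c).2.
rewrite mulrC -mulrBr normrM -real_normK ?num_real// expr2 mulrCA ler_wpM2l//.
have Hp : Cb 1 M (partial e f) by exact: Cb_partial Hf.
apply: (@le_trans _ _ (M * `|c|)); last by rewrite ler_wpM2l// (Cb_ge0 Hf).
apply: partial_increment => z; first exact: Cb_derivable Hp.
exact: (Cb_bound (Cb_partial e Hp)).
Qed.

End lipschitz.

Section setrow.
Context {R : realType} {N d : nat}.
Implicit Types (f : 'M[R]_(N, d) -> R) (B : 'M[R]_(N, d)) (z : 'rV[R]_d) (r : 'I_N).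

Definition setrow r z B : 'M[R]_(N, d) :=
  \matrix_(i, j) if i == r then z ord0 j else B i j.

Lemma setrowD r h (e : 'I_1 * 'I_d) z B : setrow r (h *: delta_mx e.1 e.2 + z) B =
  h *: delta_mx r e.2 + setrow r z B.
Proof.
apply/matrixP => i j; rewrite !mxE (ord1 e.1) eqxx/=.
by case: (eqVneq i r) => //=; rewrite mulr0 add0r.
Qed.

Lemma continuous_setrow r B : continuous (fun z => setrow r z B).
Proof.
move=> z A /= /nbhs_ballP[e /= e0 eA].
apply/nbhs_ballP; exists e => //= z' [_ zz']; apply: eA; split=> // i j.
by rewrite !mxE; case: ifP => _; [exact: zz'|exact: ballxx].
Qed.

Lemma Cb_setrow q M f r B : Cb q M f -> Cb q M (fun z => f (setrow r z B)).
Proof.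
have cE f' : continuous f' -> continuous (fun z => f' (setrow r z B)).
  by move=> cf z; apply: (@continuous_comp _ _ _ (fun z => setrow r z B) f');
    [exact: continuous_setrow|exact: cf].
elim: q f => [|q IH] f [cf bf df]; split=> //; [exact: cE|exact: cE|].
move=> e; have [d1 d2] := df (r, e.2).
have E z : (fun h : R => h^-1 *: (((fun z => f (setrow r z B)) \o shift z) (h *: delta_mx e.1 e.2) - f (setrow r z B))) =
  (fun h => h^-1 *: ((f \o shift (setrow r z B)) (h *: delta_mx r e.2) - f (setrow r z B))).
  by apply/funext => h /=; rewrite setrowD.
split=> [z|]; first by rewrite /derivable E; exact: d1.
rewrite (_ : partial e _ = fun z => partial (r, e.2) f (setrow r z B)).
  exact: IH.
by apply/funext => z; rewrite /partial /derive E.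
Qed.

End setrow.

(** * Extension with bounded derivatives *)

Section cutoff.
Context {R : realType} {m n : nat}.
Local Notation V := 'M[R]_(m, n).
Implicit Types (f g : V -> R) (q : nat) (M : R) (e : 'I_m * 'I_n).

Local Notation dl e := (delta_mx e.1 e.2 : V).

Lemma Ck_continuous q f : Ck q f -> continuous f.
Proof. by case: q => [|q] []. Qed.

Lemma CkS q f : Ck q.+1 f -> Ck q f.
Proof.
elim: q f => [|q IH] f [cf df] //; split=> // e.
by have [dfe /IH] := df e.
Qed.

Lemma Ck_leq q q' f : (q' <= q)%N -> Ck q f -> Ck q' f.
Proof.
move=> /subnK <-; elim: (q - q')%N => [//|r IH]; rewrite addSn => /CkS; exact: IH.
Qed.

Lemma partial_eq0 (Q : set V) f e : closed Q -> (forall x, ~ Q x -> f x = 0) ->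
  forall x, ~ Q x -> partial e f x = 0.
Proof.
move=> cQ f0 x Qx; rewrite /partial (@near_eq_derive _ _ _ f (fun=> 0)).
  exact: derive_cst.
have : nbhs x (~` Q) by apply: open_nbhs_nbhs; split=> //; exact: closed_openC.
by apply: filterS => y /f0.
Qed.

Lemma Ck_cst q (a : R) : Ck q ((fun=> a) : V -> R).
Proof. exact: Cb_Ck (Cb_cst q a). Qed.

Lemma CkD q f g : Ck q f -> Ck q g -> Ck q (fun x => f x + g x).
Proof.
move=> Hf Hg; have H0 := CkB (@Ck0 R m n q) Hg.
have := CkB Hf H0; congr Ck; apply/funext => x.
by rewrite !fctE sub0r opprK.
Qed.

Lemma CkM q f g : Ck q f -> Ck q g -> Ck q (fun x => f x * g x).
Proof.
elim: q f g => [|q IH] f g Hf Hg; have [cf df] := Hf; have [cg dg] := Hg;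
  (split; first by move=> x; apply: continuousM; [exact: cf|exact: cg]) => //.
move=> e; have [df1 df2] := df e; have [dg1 dg2] := dg e.
split=> [x|]; first exact: derivableM.
rewrite (_ : partial e _ = fun x => f x * partial e g x + partial e f x * g x).
  by apply: CkD; apply: IH => //; exact: CkS.
apply/funext => x; rewrite /partial deriveM//.
by rewrite /GRing.scale/= [X in _ + X = _]mulrC.
Qed.

Lemma CkV q f : (forall x, f x != 0) -> Ck q f -> Ck q (fun x => (f x)^-1).
Proof.
move=> f0; elim: q => [|q IH] Hf; have [cf df] := Hf;
  (split; first by move=> x; apply: (@continuousV _ _ f x); [exact: f0|exact: cf]) => //.
move=> e; have [df1 df2] := df e.
split=> [x|]; first exact: derivableV.
rewrite (_ : partial e _ = fun x => -1 * (partial e f x * ((f x)^-1 * (f x)^-1))).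
  apply: CkM; first exact: Ck_cst.
  by apply: CkM => //; apply: CkM; apply: IH; exact: CkS.
apply/funext => x; rewrite /partial deriveV// /GRing.scale/= mulN1r mulNr mulrC.
by rewrite expr2 invfM.
Qed.

Lemma Ck_coord q i j : Ck q (fun x : V => x i j).
Proof.
have c : continuous (fun x : V => x i j) by exact: coord_continuous.
case: q => [|q]; split=> // e.
have D x : (fun h : R => h^-1 *: (((fun x : V => x i j) \o shift x) (h *: dl e) - x i j)) @ 0^'
   --> (dl e i j).
  apply: (cvg_trans _ (@cvg_cst _ (dl e i j) _ (0 : R)^' _)).
  apply: near_eq_cvg; near=> h => /=.
  have h0 : h != 0 by near: h; exact: nbhs_dnbhs_neq.
  by rewrite !mxE addrK /GRing.scale/= mulrA mulVf// mul1r.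
split=> [x|]; first by apply/cvg_ex; eexists; exact: D.
rewrite (_ : partial e _ = fun=> dl e i j); first exact: Ck_cst.
by apply/funext => x; apply/cvg_lim => //; exact: D.
Unshelve. all: by end_near. Qed.

Lemma Ck_sum q (I : Type) (s : seq I) (F : I -> V -> R) :
  (forall i, Ck q (F i)) -> Ck q (fun x => \sum_(i <- s) F i x).
Proof.
move=> HF; elim: s => [|i s IH].
  rewrite (_ : (fun x => _) = fun=> 0); first exact: Ck_cst.
  by apply/funext => x; rewrite big_nil.
rewrite (_ : (fun x => _) = fun x => F i x + \sum_(i <- s) F i x).
  exact: CkD.
by apply/funext => x; rewrite big_cons.
Qed.

Lemma is_derive_pospow j (t : R) :
  is_derive t (1 : R) (fun t : R => Num.max t 0 ^+ j.+2) (j.+2%:R * Num.max t 0 ^+ j.+1).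
Proof.
have [t0|t0|->] := ltgtP t 0.
- rewrite expr0n/= mulr0.
  apply: (@near_eq_is_derive _ _ _ (fun=> 0)).
  near=> u; have u0 : u < 0 by near: u; exact: lt_nbhsl.
  by rewrite max_r ?ltW// expr0n.
- have P : is_derive t (1 : R) (fun u : R => u ^+ j.+2) (j.+2%:R * t ^+ j.+1).
    by split; [exact: exprn_derivable|rewrite exp_derive /GRing.scale/= mulr1].
  apply: (near_eq_is_derive _ P).
  near=> u; have u0 : 0 < u by near: u; exact: lt_nbhsr.
  by rewrite max_l ?ltW.
- rewrite expr0n/= mulr0.
  have D : (fun h : R => h^-1 *: (((fun t : R => Num.max t 0 ^+ j.+2) \o shift 0) (h *: 1)
       - Num.max 0 0 ^+ j.+2)) @ (0:R)^' --> (0 : R).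
    apply/cvgrPdist_le => /= e e0; near=> h.
    have h0 : h != 0 by near: h; exact: nbhs_dnbhs_neq.
    have h1 : `|h| <= 1 by near: h; exact: dnbhs0_le.
    have he : `|h| <= e by near: h; exact: dnbhs0_le.
    rewrite maxxx expr0n/= subr0 addr0 sub0r normrN [_%:A]mulr1 normrM normfV.
    rewrite normrX ler_pdivrMl ?normr_gt0//.
    have hm : `|Num.max h 0| <= `|h|.
      by case: (lerP h 0) => // _; rewrite normr0.
    apply: (@le_trans _ _ (`|h| ^+ j.+2)); first by rewrite lerXn2r ?nnegrE.
    rewrite exprS ler_wpM2l// exprS (le_trans _ he)// ler_piMr// exprn_ile1//.
  split; first by apply/cvg_ex; eexists; exact: D.
  by apply/cvg_lim => //; exact: D.
Unshelve. all: by end_near. Qed.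

(** Powers of the positive part serve as a bump function: finitely many
    derivatives suffice, and these are explicit. *)
Lemma Ck_pospow j g : Ck j g -> Ck j (fun x => Num.max (g x) 0 ^+ j.+1).
Proof.
have cE k g' : continuous g' -> continuous (fun x : V => Num.max (g' x) 0 ^+ k.+1).
  move=> cg x; apply: (@continuous_comp _ _ _ (fun x => Num.max (g' x) 0) (fun t => t ^+ k.+1)).
    by apply: continuous_max; [exact: cg|exact: cst_continuous].
  exact: exprn_continuous.
elim: j => [|j IH] Hg; have [cg dg] := Hg; (split; first exact: cE) => //.
move=> e; have [dg1 dg2] := dg e.
have D x := is_derive_comp1 (dg1 x) (is_derive_pospow j (g x)).
split=> [x|]; first by have [] := D x.
rewrite (_ : partial e _ =
    fun x => j.+2%:R * (Num.max (g x) 0 ^+ j.+1 * partial e g x)).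
  apply: CkM; first exact: Ck_cst.
  by apply: CkM => //; apply: IH; exact: CkS.
by apply/funext => x; rewrite mulrA; exact: (@derive_val _ _ _ _ _ _ _ (D x)).
Qed.

Lemma continuous_box_bounded f (r : R) : continuous f ->
  exists M : R, forall x : V, (forall i j, `|x i j| <= r) -> `|f x| <= M.
Proof.
move=> cf.
pose A := [set v : 'rV[R]_(m * n) | forall i, `[- r, r]%classic (v ord0 i)].
have cA : compact A by apply: (@rV_compact _ _ (fun=> `[- r, r]%classic)) => i; exact: segment_compact.
have cV : continuous (fun v : 'rV[R]_(m * n) => f (vec_mx v)).
  move=> v; apply: (@continuous_comp _ _ _ vec_mx f); last exact: cf.
  move=> B /= /nbhs_ballP[e /= e0 eB].
  apply/nbhs_ballP; exists e => //= v' [_ vv']; apply: eB; split=> // i j.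
  by rewrite !mxE; exact: vv'.
have : bounded_set ((fun v => f (vec_mx v)) @` A).
  apply: compact_bounded; apply: continuous_compact => //.
  by apply: continuous_subspaceT.
move=> [M [_ HM]]; exists (M + 1) => x bx.
apply: (HM (M + 1)); first by rewrite ltrDl.
exists (mxvec x); last by rewrite mxvecK.
by move=> k; case/mxvec_indexP: k => i j; rewrite /= in_itv/= mxvecE -ler_norml.
Qed.

(** The derivatives also vanish outside [Q], so each of them is bounded. *)
Lemma Ck_Cb_support q f (Q : set V) (r : R) : closed Q ->
  (forall x : V, Q x -> forall i j, `|x i j| <= r) ->
  (forall x, ~ Q x -> f x = 0) -> Ck q f -> exists M, Cb q M f.
Proof.
move=> cQ bQ; have bE g : continuous g -> (forall x, ~ Q x -> g x = 0) ->
    exists2 M, 0 <= M & forall x, `|g x| <= M.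
  move=> cg g0; have [M HM] := continuous_box_bounded r cg.
  exists (Num.max M 0); first by rewrite le_max lexx orbT.
  move=> x; rewrite le_max; have [/bQ/HM->//|/g0->] := pselect (Q x).
  by rewrite normr0 lexx orbT.
elim: q f => [|q IH] f f0 [cf df]; have [M M0 HM] := bE _ cf f0.
  by exists M.
have HP e : exists M', Cb q M' (partial e f).
  by have [_] := df e; apply: IH; exact: partial_eq0.
have [F HF] := choice HP.
exists (M + \sum_e F e); split=> //.
- move=> x; rewrite (le_trans (HM x))// lerDl sumr_ge0// => e _.
  exact: (Cb_ge0 (HF e)).
- move=> e; split; first exact: (df e).1.
  apply: Cb_le (HF e); rewrite (bigD1 e)//= addrCA lerDl addr_ge0// sumr_ge0// => e' _.
  exact: (Cb_ge0 (HF e')).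
Qed.

(** An arbitrary extension is multiplied by a cut-off
    [s (g x) / (s (g x) + s (1 - g x))], where [s t = max t 0 ^+ (q + 1)] is C^q
    and [g] is a concave quadratic polynomial, at least 1 on the set and negative
    far away. *)
Lemma Ck_on_Cb q (K : set V) (r : R) f :
  (forall x : V, K x -> forall i j, `|x i j| <= r) -> Ck_on q K f ->
  exists M f', Cb q M f' /\ {in K, f' =1 f}.
Proof.
move=> bK [F [CF FE]].
pose nrm (x : V) := \sum_(e : 'I_m * 'I_n) x e.1 e.2 * x e.1 e.2.
pose rho := (m * n)%:R * (r * r).
pose g x := rho + 1 - nrm x.
pose s (t : R) := Num.max t 0 ^+ q.+1.
have Cn : Ck q nrm by apply: Ck_sum => e; apply: CkM; exact: Ck_coord.
have Cg : Ck q g by apply: (CkB (Ck_cst q (rho + 1)) Cn).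
have C1g : Ck q (fun x => 1 - g x) by exact: (CkB (Ck_cst q 1) Cg).
pose D x := s (g x) + s (1 - g x).
have s0 t : 0 <= s t by rewrite exprn_ge0// le_max lexx orbT.
have sp t : 0 < t -> 0 < s t by move=> t0; rewrite exprn_gt0// lt_max t0.
have D0 x : D x != 0.
  rewrite gt_eqF// /D; have [g0|g0] := ltP 0 (g x).
    by rewrite ltr_pwDl// sp.
  by rewrite ltr_wpDl// sp// subr_gt0 (le_lt_trans g0).
pose chi x := s (g x) * (D x)^-1.
have Cchi : Ck q chi.
  apply: CkM; first exact: Ck_pospow.
  by apply: CkV => //; apply: CkD; exact: Ck_pospow.
have nrm_ge (x : V) i j : x i j * x i j <= nrm x.
  rewrite /nrm (bigD1 (i, j))//= lerDl sumr_ge0// => e _.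
  by rewrite -expr2 sqr_ge0.
have H : exists M, Cb q M (fun x => chi x * F x).
  apply: (@Ck_Cb_support q _ [set x | nrm x <= rho + 1] (rho + 2)).
  - apply: (@closed_comp _ _ nrm [set t | t <= rho + 1]).
      by move=> x _; exact: (Ck_continuous Cn).
    exact: closed_le.
  - move=> x /= nx i j; have := le_trans (nrm_ge x i j) nx.
    move=> H; rewrite leNgt; apply/negP => H2.
    have : `|x i j| * `|x i j| <= rho + 1 by rewrite -normrM ger0_norm// -expr2 sqr_ge0.
    have r0 : 0 <= rho by rewrite mulr_ge0// -expr2 sqr_ge0.
    by nra.
  - move=> x /= /negP; rewrite -ltNge => nx.
    rewrite /chi /s max_r ?expr0n ?mul0r//=.
    by rewrite /g subr_le0 ltW.
  - exact: CkM.
have [M HM] := H; exists M, (fun x => chi x * F x); split=> // x xK.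
have Kx : K x by exact/set_mem.
have -> : chi x = 1.
  have g1 : 1 <= g x.
    suff : nrm x <= rho by rewrite /g; lra.
    apply: (@le_trans _ _ (\sum_(e : 'I_m * 'I_n) r * r)).
      apply: ler_sum => e _; rewrite -expr2 -real_normK ?num_real// expr2.
      by apply: ler_pM => //; exact: bK.
    by rewrite sumr_const card_prod !card_ord /rho mulr_natl.
  rewrite /chi /D [X in _ / (_ + X)](_ : _ = 0) ?addr0.
    by rewrite divff// gt_eqF// sp// (lt_le_trans _ g1).
  by rewrite /s max_r ?expr0n// subr_le0.
by rewrite mul1r FE.
Qed.

End cutoff.

(** * Product measures and bounded measurable functions *)

Section insert.
Context {disp : measure_display} {T : measurableType disp} {R : realType}.
Implicit Types (n : nat).

Definition ins n (i : 'I_n.+1) (x : T) (y : n.-tuple T) : n.+1.-tuple T :=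
  [tuple if unlift i j is Some j' then tnth y j' else x | j < n.+1].

Lemma tnth_ins_eq n (i : 'I_n.+1) x (y : n.-tuple T) : tnth (ins i x y) i = x.
Proof. by rewrite tnth_mktuple unlift_none. Qed.

Lemma tnth_ins_lift n (i : 'I_n.+1) x (y : n.-tuple T) j :
  tnth (ins i x y) (lift i j) = tnth y j.
Proof. by rewrite tnth_mktuple liftK. Qed.

Lemma ins0E n x (y : n.-tuple T) : ins ord0 x y = [tuple of x :: y].
Proof.
apply: eq_from_tnth => j; case: (unliftP ord0 j) => [j'|] ->.
  by rewrite tnth_ins_lift tnthS.
by rewrite tnth_ins_eq.
Qed.

Lemma measurable_ins d' (S : measurableType d') n (i : 'I_n.+1)
    (f : S -> T) (g : S -> n.-tuple T) :
  measurable_fun [set: S] f -> measurable_fun [set: S] g ->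
  measurable_fun [set: S] (fun z => ins i (f z) (g z)).
Proof.
move=> mf mg; apply/measurable_fun_tnthP => j; rewrite /comp.
case: (unliftP i j) => [j'|] ->.
  under eq_fun do rewrite tnth_ins_lift.
  exact: (measurableT_comp (measurable_tnth j') mg).
by under eq_fun do rewrite tnth_ins_eq.
Qed.

Lemma ins_lift_cons n (i : 'I_n.+1) x0 x (y : n.-tuple T) :
  [tuple of x0 :: ins i x y] = ins (lift ord0 i) x [tuple of x0 :: y].
Proof.
apply: eq_from_tnth => j; rewrite [RHS]tnth_mktuple.
case: (unliftP ord0 j) => [j'|] ->.
  rewrite tnthS; case: (unliftP i j') => [j''|] ->.
    rewrite tnth_ins_lift.
    rewrite (_ : lift ord0 (lift i j'') = lift (lift ord0 i) (lift ord0 j'')).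
      by rewrite liftK tnthS.
    by apply: val_inj; rewrite /= !/bump/=; lia.
  by rewrite tnth_ins_eq unlift_none.
rewrite (_ : ord0 = lift (lift ord0 i) ord0); last exact: val_inj.
by rewrite liftK.
Qed.

Local Open Scope ereal_scope.

Lemma lift_lift0 n (i : 'I_n.+1) (S : Type) (m : 'I_n.+2 -> S) :
  (fun j => m (lift ord0 (lift i j))) =
  (fun j => m (lift (lift ord0 i) (lift ord0 j))).
Proof.
by apply/funext => j; congr m; apply: val_inj; rewrite /= !/bump/=; lia.
Qed.

(** The product measure splits off its first factor by definition; another one
    is reached by induction, Tonelli's theorem exchanging it with the first. *)
Lemma tonelli_ins n (m : 'I_n.+1 -> {sigma_finite_measure set T -> \bar R})
    (i : 'I_n.+1) (F : n.+1.-tuple T -> \bar R) :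
  measurable_fun [set: n.+1.-tuple T] F -> (forall t, 0 <= F t) ->
  \int[tprod m]_t F t =
  \int[m i]_x \int[tprod (fun j => m (lift i j))]_y F (ins i x y).
Proof.
have base k (m' : 'I_k.+1 -> {sigma_finite_measure set T -> \bar R})
    (G : k.+1.-tuple T -> \bar R) : measurable_fun [set: k.+1.-tuple T] G -> (forall t, 0 <= G t) ->
  \int[tprod m']_t G t =
  \int[m' ord0]_x \int[tprod (fun j => m' (lift ord0 j))]_y G [tuple of x :: y].
  move=> mG G0.
  rewrite /= ge0_integral_pushforward//=; last exact: measurable_cons.
  rewrite preimage_setT (fubini_tonelli1 _) //=.
  by apply: measurableT_comp => //; exact: measurable_cons.
elim: n => [|n IH] in m i F *; move=> mF F0.
  rewrite (ord1 i) (base _ _ _ mF F0).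
  by apply: eq_integral => x _; apply: eq_integral => y _; rewrite ins0E.
case: (unliftP ord0 i) => [i'|] ->; last first.
  rewrite (base _ _ _ mF F0).
  by apply: eq_integral => x _; apply: eq_integral => y _; rewrite ins0E.
rewrite (base _ _ _ mF F0).
under eq_integral => x0 _.
  rewrite (IH _ i'); [|apply: measurableT_comp => //; exact: measurable_cons|by []].
  under eq_integral => x _ do under eq_integral => y _ do rewrite ins_lift_cons.
  rewrite (lift_lift0 i' m).
  over.
have mH : measurable_fun setT (fun p : (T * T) * n.-tuple T =>
    F (ins (lift ord0 i') p.1.2 [tuple of p.1.1 :: p.2])).
  apply: (measurableT_comp mF); apply: measurable_ins.
    exact: (measurableT_comp measurable_snd measurable_fst).
  apply: measurable_cons; last exact: measurable_snd.
  exact: (measurableT_comp measurable_fst measurable_fst).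
pose G (p : T * T) := \int[tprod (fun j =>
   m (lift (lift ord0 i') (lift ord0 j)))]_y F (ins (lift ord0 i') p.2 [tuple of p.1 :: y]).
have mG : measurable_fun setT G.
  by apply: (measurable_fun_fubini_tonelli_F (fun p : (T * T) * n.-tuple T =>
    F (ins (lift ord0 i') p.1.2 [tuple of p.1.1 :: p.2]))).
have G0 p : 0 <= G p by apply: integral_ge0.
transitivity (\int[m (lift ord0 i')]_x \int[m ord0]_x0 G (x0, x)).
  exact: fubini_tonelli.
apply: eq_integral => x _.
have mFx : measurable_fun [set: n.+1.-tuple T] (fun y => F (ins (lift ord0 i') x y)).
  by apply: (measurableT_comp mF); exact: measurable_ins.
rewrite (base _ _ _ mFx (fun y => F0 _)) /G.
by rewrite (_ : lift (lift ord0 i') ord0 = ord0)//; exact: val_inj.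
Qed.

Lemma tprod_ins n (m : 'I_n.+1 -> {sigma_finite_measure set T -> \bar R})
    (i : 'I_n.+1) (A : set (n.+1.-tuple T)) : measurable A ->
  tprod m A = pushforward (m i \x tprod (fun j => m (lift i j)))
                (fun p : T * n.-tuple T => ins i p.1 p.2) A.
Proof.
move=> mA.
have mins : measurable_fun setT (fun p : T * n.-tuple T => ins i p.1 p.2).
  exact: measurable_ins.
have mB : measurable ((fun p : T * n.-tuple T => ins i p.1 p.2) @^-1` A).
  by rewrite -[X in measurable X]setTI; exact: mins.
have mI : measurable_fun [set: n.+1.-tuple T] (fun t => (\1_A t : R)%:E).
  by apply/measurable_EFinP; exact: measurable_indic.
transitivity (\int[tprod m]_t (\1_A t : R)%:E).
  by rewrite integral_indic// setIT.
rewrite (tonelli_ins m i mI); last by move=> t; rewrite lee_fin.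
transitivity (\int[m i \x tprod (fun j => m (lift i j))]_p
    (\1_((fun p : T * n.-tuple T => ins i p.1 p.2) @^-1` A) p : R)%:E).
  by rewrite fubini_tonelli1//; exact/measurable_EFinP/measurable_indic.
by rewrite integral_indic// setIT.
Qed.

Lemma integral_tprod_ins n (m : 'I_n.+1 -> {sigma_finite_measure set T -> \bar R})
    (i : 'I_n.+1) (F : n.+1.-tuple T -> \bar R) :
  measurable_fun [set: n.+1.-tuple T] F ->
  (m i \x tprod (fun j => m (lift i j))).-integrable setT
     (fun p => F (ins i p.1 p.2)) ->
  \int[tprod m]_t F t =
  \int[m i \x tprod (fun j => m (lift i j))]_p F (ins i p.1 p.2).
Proof.
move=> mF iF.
have mins : measurable_fun setT (fun p : T * n.-tuple T => ins i p.1 p.2).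
  exact: measurable_ins.
rewrite (eq_measure_integral (pushforward
   (m i \x tprod (fun j => m (lift i j))) (fun p : T * n.-tuple T => ins i p.1 p.2))).
  by rewrite integral_pushforward.
by move=> A mA _; exact: tprod_ins.
Qed.

End insert.

Section bounded_measurable.
Context {R : realType}.

(** The integrands of the Schrodinger system are bounded and its measures are
    probabilities, so this class makes integrability automatic. *)
Definition bmf d (T : measurableType d) (f : T -> R) : Prop :=
  measurable_fun [set: T] f /\ exists M : R, forall x, `|f x| <= M.

Section closure.
Context d (T : measurableType d).
Implicit Types f g : T -> R.

Lemma bmf_cst a : @bmf d T (fun=> a).
Proof. by split; [exact: measurable_cst|exists `|a|]. Qed.

Lemma bmfD f g : bmf f -> bmf g -> bmf (fun x => f x + g x).
Proof.
move=> [mf [A bf]] [mg [B bg]]; split; first exact: measurable_funD.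
by exists (A + B) => x; rewrite (le_trans (ler_normD _ _))// lerD.
Qed.

Lemma bmfM f g : bmf f -> bmf g -> bmf (fun x => f x * g x).
Proof.
move=> [mf [A bf]] [mg [B bg]]; split; first exact: measurable_funM.
by exists (A * B) => x; rewrite normrM ler_pM.
Qed.

Lemma bmfN f : bmf f -> bmf (fun x => - f x).
Proof.
move=> /(bmfM (bmf_cst (-1))); congr bmf.
by apply/funext => x; rewrite mulN1r.
Qed.

Lemma bmfB f g : bmf f -> bmf g -> bmf (fun x => f x - g x).
Proof. by move=> bf /bmfN; exact: bmfD. Qed.

Lemma bmf_norm f : bmf f -> bmf (fun x => `|f x|).
Proof.
move=> [mf [A bf]]; split; first exact: measurableT_comp.
by exists A => x; rewrite normr_id.
Qed.

Lemma bmf_expR f : bmf f -> bmf (fun x => expR (f x)).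
Proof.
move=> [mf [A bf]]; split; first exact: measurableT_comp.
exists (expR A) => x; rewrite ger0_norm ?expR_ge0// ler_expR.
exact: le_trans (ler_norm _) _.
Qed.

Lemma bmf_ln f (a : R) : 0 < a -> (forall x, a <= f x) -> bmf f -> bmf (fun x => ln (f x)).
Proof.
move=> a0 af [mf [A bf]]; split; first exact: measurableT_comp.
have f0 x : 0 < f x by rewrite (lt_le_trans a0).
have fA x : f x <= A by rewrite (le_trans (ler_norm _)).
exists (`|ln A| + `|ln a|) => x.
have : ln (f x) <= ln A by rewrite ler_ln ?posrE// (lt_le_trans (f0 x)).
have : ln a <= ln (f x) by rewrite ler_ln ?posrE.
have := ler_norm (ln A); have : - ln a <= `|ln a| by rewrite -normrN ler_norm.
have := normr_ge0 (ln A); have := normr_ge0 (ln a).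
by rewrite ler_norml; lra.
Qed.

Lemma bmf_sum (I : Type) (s : seq I) (F : I -> T -> R) :
  (forall i, bmf (F i)) -> bmf (fun x => \sum_(i <- s) F i x).
Proof.
move=> bF; elim: s => [|i s IH].
  by rewrite (_ : (fun x => _) = fun=> 0); [exact: bmf_cst|apply/funext => x; rewrite big_nil].
rewrite (_ : (fun x => _) = fun x => F i x + \sum_(i <- s) F i x); first exact: bmfD.
by apply/funext => x; rewrite big_cons.
Qed.

Lemma bmf_comp d' (S : measurableType d') f (h : S -> T) :
  measurable_fun [set: S] h -> bmf f -> bmf (fun x => f (h x)).
Proof.
move=> mh [mf [A bf]]; split; first exact: measurableT_comp mf mh.
by exists A.
Qed.

End closure.

Section integral.
Context d (T : measurableType d) (mu : {measure set T -> \bar R}).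
Hypothesis mu1 : mu setT = 1%E.
Implicit Types f g : T -> R.

Lemma bmf_integrable f : bmf f -> mu.-integrable setT (EFin \o f).
Proof.
move=> [mf [A bf]]; apply: measurable_bounded_integrable => //.
  by rewrite mu1 ltry.
exists A; split; first exact: num_real.
by move=> B AB x _ /=; rewrite (le_trans (bf x))// ltW.
Qed.

Lemma RintD f g : bmf f -> bmf g ->
  \int[mu]_x (f x + g x) = \int[mu]_x f x + \int[mu]_x g x.
Proof. by move=> /bmf_integrable bf /bmf_integrable bg; exact: RintegralD. Qed.

Lemma RintB f g : bmf f -> bmf g ->
  \int[mu]_x (f x - g x) = \int[mu]_x f x - \int[mu]_x g x.
Proof. by move=> /bmf_integrable bf /bmf_integrable bg; exact: RintegralB. Qed.

Lemma RintZ f (a : R) : bmf f -> \int[mu]_x (a * f x) = a * \int[mu]_x f x.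
Proof. by move=> /bmf_integrable bf; exact: RintegralZl. Qed.

Lemma RintC (a : R) : \int[mu]_x a = a.
Proof. by rewrite Rintegral_cst// mu1 mulr1. Qed.

Lemma Rint_le f g : bmf f -> bmf g -> (forall x, f x <= g x) ->
  \int[mu]_x f x <= \int[mu]_x g x.
Proof.
by move=> /bmf_integrable bf /bmf_integrable bg fg; exact: le_Rintegral.
Qed.

Lemma Rint_bounds f (a b : R) : bmf f -> (forall x, a <= f x <= b) ->
  a <= \int[mu]_x f x <= b.
Proof.
move=> bf ab; rewrite -[leLHS]RintC -[X in _ && (_ <= X)]RintC.
by rewrite !Rint_le//; try (exact: bmf_cst); move=> x; have /andP[] := ab x.
Qed.

Lemma Rint_norm f : bmf f -> `|\int[mu]_x f x| <= \int[mu]_x `|f x|.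
Proof. by move=> /bmf_integrable bf; exact: le_normr_Rintegral. Qed.

Lemma Rint_norm_le f (M : R) : bmf f -> (forall x, `|f x| <= M) ->
  `|\int[mu]_x f x| <= M.
Proof.
move=> bf fM; rewrite ler_norml; apply: Rint_bounds => // x.
by rewrite -ler_norml.
Qed.

Lemma Rint_sum (I : Type) (s : seq I) (F : I -> T -> R) :
  (forall i, bmf (F i)) ->
  \int[mu]_x (\sum_(i <- s) F i x) = \sum_(i <- s) \int[mu]_x F i x.
Proof.
move=> bF; elim: s => [|i s IH].
  by under eq_Rintegral do rewrite big_nil; rewrite RintC big_nil.
under eq_Rintegral do rewrite big_cons.
by rewrite RintD ?big_cons ?IH//; exact: bmf_sum.
Qed.

(** Jensen's inequality for the square: a variance is nonnegative. *)
Lemma Rint_sqr f : bmf f -> (\int[mu]_x f x) ^+ 2 <= \int[mu]_x (f x ^+ 2).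
Proof.
move=> bf; set a := \int[mu]_x f x.
have bff : bmf (fun x => f x * f x) by exact: bmfM.
have E : \int[mu]_x ((f x - a) ^+ 2) = \int[mu]_x (f x ^+ 2) - a ^+ 2.
  rewrite (@eq_Rintegral _ _ _ mu setT (fun x => f x ^+ 2 + ((- (2 * a)) * f x + a ^+ 2))); last first.
    by move=> x _; ring.
  rewrite RintD//; last by apply: bmfD; [apply: bmfM => //; exact: bmf_cst|exact: bmf_cst].
  rewrite RintD; [|by apply: bmfM => //; exact: bmf_cst|exact: bmf_cst].
  by rewrite RintZ// RintC -/a; ring.
by rewrite -subr_ge0 -E; apply: Rintegral_ge0 => x _; rewrite sqr_ge0.
Qed.

Section carried.
Variable K : set T.
Hypotheses (mK : measurable K) (K1 : mu K = 1%E).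

Lemma integral_carried f : bmf f ->
  (\int[mu]_(x in K) (f x)%:E = (\int[mu]_x f x)%:E)%E.
Proof.
move=> bf.
have int_f := bmf_integrable bf.
rewrite fineK; last exact: (integrable_fin_num measurableT int_f).
have mu0 : mu (~` K) = 0%E.
  rewrite -setTD measureD//; last by rewrite [ltLHS]mu1 ltry.
  rewrite setTI; transitivity (1 - 1 : \bar R)%E; last exact: subee.
  exact: (congr2 (fun a b : \bar R => (a - b)%E) mu1 K1).
rewrite [RHS](negligible_integral (measurableC mK) measurableT int_f mu0).
by rewrite setTD setCK.
Qed.

Lemma eq_Rint_carried f g : bmf f -> bmf g -> (forall x, K x -> f x = g x) ->
  \int[mu]_x f x = \int[mu]_x g x.
Proof.
move=> bf bg fg; apply: EFin_inj; rewrite -!integral_carried//.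
by apply: eq_integral => x; rewrite inE => /fg ->.
Qed.

End carried.

End integral.

Section fubini.
Context d1 d2 (T1 : measurableType d1) (T2 : measurableType d2).
Variables (m1 : {sigma_finite_measure set T1 -> \bar R}).
Variables (m2 : {sigma_finite_measure set T2 -> \bar R}).
Hypotheses (m11 : m1 setT = 1%E) (m21 : m2 setT = 1%E).

Lemma prod_mass : (m1 \x m2)%E setT = 1%E.
Proof.
transitivity (m1 setT * m2 setT)%E; last by rewrite m11 m21 mule1.
by rewrite -product_measure1E// setXTT.
Qed.

Variable F : T1 * T2 -> R.
Hypothesis bF : bmf F.

Let iF : (m1 \x m2)%E.-integrable setT (EFin \o F).
Proof. exact: (bmf_integrable prod_mass). Qed.

Let EF1 x : (\int[m2]_y F (x, y))%:E = (\int[m2]_y (F (x, y))%:E)%E.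
Proof.
rewrite fineK//; apply: (integrable_fin_num measurableT).
apply: (bmf_integrable m21); apply: bmf_comp bF.
exact: measurable_fun_pair.
Qed.

Let EF2 y : (\int[m1]_x F (x, y))%:E = (\int[m1]_x (F (x, y))%:E)%E.
Proof.
rewrite fineK//; apply: (integrable_fin_num measurableT).
apply: (bmf_integrable m11); apply: bmf_comp bF.
exact: measurable_fun_pair.
Qed.

Lemma bmf_Rint1 : bmf (fun x => \int[m2]_y F (x, y)).
Proof.
split.
  apply/measurable_EFinP; under [X in measurable_fun _ X]eq_fun do rewrite /= EF1.
  exact: (measurable_fubini_F iF).
have [_ [M HM]] := bF; exists M => x; apply: Rint_norm_le => //.
by apply: bmf_comp bF; exact: measurable_fun_pair.
Qed.

Lemma bmf_Rint2 : bmf (fun y => \int[m1]_x F (x, y)).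
Proof.
split.
  apply/measurable_EFinP; under [X in measurable_fun _ X]eq_fun do rewrite /= EF2.
  exact: (measurable_fubini_G iF).
have [_ [M HM]] := bF; exists M => y; apply: Rint_norm_le => //.
by apply: bmf_comp bF; exact: measurable_fun_pair.
Qed.

Lemma Rfubini1 : \int[m1]_x \int[m2]_y F (x, y) = \int[(m1 \x m2)%E]_p F p.
Proof.
rewrite /Rintegral -(integral12_prod_meas1 iF); congr fine.
by apply: eq_integral => x _; rewrite EF1.
Qed.

Lemma Rfubini2 : \int[m2]_y \int[m1]_x F (x, y) = \int[(m1 \x m2)%E]_p F p.
Proof.
rewrite /Rintegral -(integral21_prod_meas1 iF); congr fine.
by apply: eq_integral => x _; rewrite EF2.
Qed.

End fubini.

Section tuples.
Context d (T : measurableType d).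

Lemma tprod_mass n (m : 'I_n -> probability T R) :
  tprod (fun i => m i) setT = 1%E.
Proof.
have := @tprodE d T R n (fun i => m i) (fun=> setT) (fun i => measurableT).
rewrite (_ : mkset _ = setT); last by apply/seteqP; split.
by move=> ->; rewrite big1// => i _; exact: probability_setT.
Qed.

Variables (n : nat) (m : 'I_n.+1 -> probability T R) (i : 'I_n.+1).
Variable F : n.+1.-tuple T -> R.
Hypothesis bF : bmf F.

Let bG : bmf (fun p : T * n.-tuple T => F (ins i p.1 p.2)).
Proof. by apply: bmf_comp bF; exact: measurable_ins. Qed.

Let RprodE : \int[tprod (fun j => m j)]_t F t =
  \int[(m i \x tprod (fun j => m (lift i j)))%E]_p F (ins i p.1 p.2).
Proof.
rewrite /Rintegral (@integral_tprod_ins _ _ _ _ (fun j => m j) i (EFin \o F))//.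
  by apply/measurable_EFinP; case: bF.
apply: (bmf_integrable (prod_mass _ _)) => //; first exact: probability_setT.
exact: tprod_mass.
Qed.

Lemma Rint_ins1 : \int[tprod (fun j => m j)]_t F t =
  \int[m i]_x \int[tprod (fun j => m (lift i j))]_y F (ins i x y).
Proof.
rewrite RprodE -Rfubini1//; first exact: probability_setT.
exact: tprod_mass.
Qed.

Lemma bmf_Rint_ins1 : bmf (fun x => \int[tprod (fun j => m (lift i j))]_y F (ins i x y)).
Proof. by apply: (@bmf_Rint1 _ _ _ _ (m i) _ _ _ _ bG); [exact: probability_setT|exact: tprod_mass]. Qed.

End tuples.

End bounded_measurable.

(** * Integrals depending on the measures and on a parameter *)

Section borel.
Context {R : realType}.

Lemma measurable_fun_open_ray d (T : measurableType d) (f : T -> R) :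
  (forall a : R, measurable (f @^-1` `]a, +oo[%classic)) ->
  measurable_fun [set: T] f.
Proof.
move=> H mT; apply: (measurability _ (RGenOInfty.measurableE R)) => //.
by move=> _ [_ [a ->] <-]; rewrite setTI; exact: H.
Qed.

Lemma continuous_borelRd d (g : 'rV[R]_d -> R) : continuous g ->
  measurable_fun [set: borelRd R d] (g : borelRd R d -> R).
Proof.
move=> cg; apply: measurable_fun_open_ray => a; apply: sub_sigma_algebra.
by apply: open_comp; [move=> x _; exact: cg|exact: interval_open].
Qed.

Definition mat N d (t : N.-tuple (borelRd R d)) : 'M[R]_(N, d) :=
  \matrix_(i, j) (tnth t i : 'rV[R]_d) ord0 j.

(** An open set of matrices is a countable union of boxes with rational
    corners, so it is measurable for the product sigma-algebra. *)
Lemma measurable_mat_open N d (U : set 'M[R]_(N, d)) : open U ->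
  measurable (@mat N d @^-1` U).
Proof.
move=> oU.
pose box (q : {ffun 'I_N * 'I_d -> rat * rat}) : set 'M[R]_(N, d) :=
  [set x | forall e, x e.1 e.2 \in `](ratr (q e).1), (ratr (q e).2)[].
pose F k := if unpickle k is Some q then
  if `[< box q `<=` U >] then box q else set0 else set0.
have -> : U = \bigcup_k F k.
  apply/seteqP; split=> [x Ux|x [k _]]; last first.
    by rewrite /F; case: unpickle => // q; case: asboolP => // H /H.
  have /nbhs_ballP[e /= e0 eU] : nbhs x U by exact: open_nbhs_nbhs.
  have qP (l : 'I_N * 'I_d) : exists q : rat * rat,
      (ratr q.1 \in `](x l.1 l.2 - e), (x l.1 l.2)[) /\
      (ratr q.2 \in `](x l.1 l.2), (x l.1 l.2 + e)[).
    have [|q1 Hq1] := @rat_in_itvoo R (x l.1 l.2 - e) (x l.1 l.2).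
      by rewrite ltrBlDr ltrDl.
    have [|q2 Hq2] := @rat_in_itvoo R (x l.1 l.2) (x l.1 l.2 + e).
      by rewrite ltrDl.
    by exists (q1, q2).
  have [q Hq] := choice qP.
  exists (pickle (finfun q)) => //; rewrite /F pickleK asboolT.
    move=> l; rewrite ffunE in_itv/=.
    have [] := Hq l; rewrite !in_itv/= => /andP[_ ->] /andP[->//].
  move=> y yq; apply: eU; split=> // j l.
  have := yq (j, l); rewrite ffunE in_itv/= => /andP[qy yq'].
  have [] := Hq (j, l); rewrite !in_itv/= => /andP[xq _] /andP[_ qx].
  rewrite /ball/= ltr_distlC (lt_trans xq qy)/=.
  exact: lt_trans yq' qx.
rewrite preimage_bigcup; apply: bigcup_measurable => k _; rewrite /F.
case: unpickle => [q|]; last by rewrite preimage_set0.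
case: asboolP => _; last by rewrite preimage_set0.
rewrite (_ : _ @^-1` _ = \bigcap_(e in setT)
    ((fun t : N.-tuple (borelRd R d) => (tnth t e.1 : 'rV[R]_d) ord0 e.2) @^-1`
      `](ratr (q e).1), (ratr (q e).2)[%classic)).
  apply: fin_bigcap_measurable => // e _.
  have mc : measurable_fun [set: borelRd R d] (fun x : borelRd R d => (x : 'rV[R]_d) ord0 e.2 : R).
    by apply: continuous_borelRd; exact: coord_continuous.
  have mt := measurableT_comp mc (@measurable_tnth _ (borelRd R d) N e.1).
  by rewrite -[X in measurable X]setTI; apply: mt => //; exact: measurable_itv.
apply/seteqP; split=> [t qt e _|t qt e].
  by have := qt e; rewrite mxE.
by rewrite mxE; exact: qt.
Qed.

Lemma measurable_continuous_mat N d (f : 'M[R]_(N, d) -> R) : continuous f ->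
  measurable_fun [set: N.-tuple (borelRd R d)] (fun t => f (mat t)).
Proof.
move=> cf; apply: measurable_fun_open_ray => a.
rewrite -[X in measurable X]/(@mat N d @^-1` (f @^-1` _)).
apply: measurable_mat_open.
by apply: open_comp; [move=> x _; exact: cf|exact: interval_open].
Qed.

Lemma glueE n d (i : 'I_n.+1) (x : 'rV[R]_d) (y : n.-tuple (borelRd R d)) :
  glue i x y = mat (ins i (x : borelRd R d) y).
Proof.
apply/matrixP => j l; rewrite /glue !mxE tnth_mktuple.
by case: unlift.
Qed.

Lemma glue_setrow n d (i : 'I_n.+1) (x : 'rV[R]_d) (y : n.-tuple (borelRd R d)) :
  glue i x y = setrow i x (glue i 0 y).
Proof.
apply/matrixP => j l; rewrite /glue !mxE.
by case: (unliftP i j) => [j'|] ->; rewrite ?eqxx// eq_sym (negbTE (neq_lift _ _)).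
Qed.

Lemma bmf_glue n d (i : 'I_n.+1) (x : 'rV[R]_d) q (M : R) (E : 'M[R]_(n.+1, d) -> R) :
  Cb q M E -> bmf (fun y : n.-tuple (borelRd R d) => E (glue i x y)).
Proof.
move=> CE; split; last by exists M => y; exact: (Cb_bound CE).
under eq_fun do rewrite glueE.
apply: (measurableT_comp (measurable_continuous_mat (Cb_continuous CE))).
by apply: measurable_ins; [exact: measurable_cst|exact: measurable_id].
Qed.

Lemma bmf_mat N d q (M : R) (E : 'M[R]_(N, d) -> R) :
  Cb q M E -> bmf (fun t : N.-tuple (borelRd R d) => E (mat t)).
Proof.
move=> CE; split; last by exists M => y; exact: (Cb_bound CE).
exact: measurable_continuous_mat (Cb_continuous CE).
Qed.

Lemma bmf_Cb d q (M : R) (f : 'rV[R]_d -> R) : Cb q M f -> @bmf R _ (borelRd R d) f.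
Proof.
move=> Cf; split; last by exists M; exact: (Cb_bound Cf).
exact: continuous_borelRd (Cb_continuous Cf).
Qed.

End borel.

Section telescope.
Context {disp : measure_display} {T : measurableType disp} {R : realType}.

Definition upd n (t : n.-tuple T) (j : 'I_n) (z : T) : n.-tuple T :=
  [tuple if l == j then z else tnth t l | l < n].

(** The factors are replaced one at a time, so that a single measure varies in
    each error term. The point [x0] is a placeholder for the coordinate that
    [upd] overwrites. *)
Lemma tprod_telescope (x0 : T) n (m m' : 'I_n -> probability T R)
    (F : n.-tuple T -> R) (D : 'I_n -> R) : bmf F ->
  (forall j t, `|\int[m j]_z F (upd t j z) - \int[m' j]_z F (upd t j z)| <= D j) ->
  `|\int[tprod (fun j => m j)]_t F t - \int[tprod (fun j => m' j)]_t F t|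
    <= \sum_j D j.
Proof.
elim: n => [|n IH] in m m' F D *; move=> bF HD.
  by rewrite big_ord0 subrr normr0.
have bF1 x : bmf (fun y => F (ins ord0 x y)).
  by apply: bmf_comp bF; apply: measurable_ins; [exact: measurable_cst|exact: measurable_id].
have bFG : bmf (fun p : T * n.-tuple T => F (ins ord0 p.1 p.2)).
  by apply: bmf_comp bF; exact: measurable_ins.
have mP := probability_setT.
rewrite (Rint_ins1 m ord0 bF) (Rint_ins1 m' ord0 bF).
set A := fun x => \int[tprod (fun j => m (lift ord0 j))]_y F (ins ord0 x y).
set A' := fun x => \int[tprod (fun j => m' (lift ord0 j))]_y F (ins ord0 x y).
have bA : bmf A by exact: bmf_Rint_ins1.
have bA' : bmf A' by exact: bmf_Rint_ins1.
rewrite -(subrKA (\int[m ord0]_x A' x)) big_ord_recl addrC.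
apply: le_trans (ler_normD _ _) _; apply: lerD.
  have E (mu : probability T R) : \int[mu]_x A' x =
      \int[tprod (fun j => m' (lift ord0 j))]_y \int[mu]_x F (ins ord0 x y).
    have H := @Rfubini1 R _ _ _ _ mu _ (mP _ _ _ mu) (tprod_mass (fun j => m' (lift ord0 j))) _ bFG.
    by rewrite -(Rfubini2 (mP _ _ _ mu) (tprod_mass (fun j => m' (lift ord0 j))) bFG) in H.
  have bE (mu : probability T R) : bmf (fun y => \int[mu]_x F (ins ord0 x y)).
    exact: (bmf_Rint2 (mP _ _ _ mu) (tprod_mass (fun j => m' (lift ord0 j))) bFG).
  rewrite !E -RintB//; last exact: tprod_mass.
  apply: Rint_norm_le; [exact: tprod_mass|exact: bmfB|].
  move=> y; have := HD ord0 (ins ord0 x0 y).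
  suff U z : upd (ins ord0 x0 y) ord0 z = ins ord0 z y.
    by under eq_Rintegral do rewrite U; under [in X in _ - X]eq_Rintegral do rewrite U.
  apply: eq_from_tnth => j; rewrite tnth_mktuple.
  by case: (unliftP ord0 j) => [j'|] ->; rewrite ?tnth_ins_lift ?tnth_ins_eq.
rewrite -RintB//; last exact: mP.
apply: Rint_norm_le; [exact: mP|exact: bmfB|].
move=> x; apply: IH => // j t.
have := HD (lift ord0 j) (ins ord0 x t).
suff U z : upd (ins ord0 x t) (lift ord0 j) z = ins ord0 x (upd t j z).
  by under eq_Rintegral do rewrite U; under [in X in _ - X]eq_Rintegral do rewrite U.
apply: eq_from_tnth => l; rewrite tnth_mktuple.
case: (unliftP ord0 l) => [l'|] ->; rewrite ?tnth_ins_lift ?tnth_ins_eq//.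
by rewrite tnth_mktuple (inj_eq lift_inj).
Qed.

End telescope.

Section under_integral.
Context {R : realType} {n d : nat} (i : 'I_n.+1).
Local Notation TT := (n.-tuple (borelRd R d)).
Implicit Types E : 'M[R]_(n.+1, d) -> R.

Lemma lipschitz_continuous (V : normedModType R) (f : V -> R) (C : R) :
  (forall x y, `|f y - f x| <= C * `|y - x|) -> continuous f.
Proof.
move=> H x; apply/cvgrPdist_lt => e e0.
have C1 : 0 < `|C| + 1 by rewrite ltr_wpDl.
near=> y.
have xy : `|y - x| < e / (`|C| + 1).
  rewrite distrC; near: y; apply: cvgr_dist_lt; last by rewrite divr_gt0.
  exact: cvg_id.
rewrite distrC; apply: le_lt_trans (H x y) _.
apply: (@le_lt_trans _ _ ((`|C| + 1) * `|y - x|)).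
  by rewrite ler_wpM2r// (le_trans (ler_norm C))// lerDl.
by rewrite mulrC -ltr_pdivlMr.
Unshelve. all: by end_near. Qed.

Lemma norm_glueB (x x' : 'rV[R]_d) (y : TT) :
  `|glue i x' y - glue i x y| <= `|x' - x|.
Proof.
rewrite [leLHS]/Num.Def.normr/= mx_normrE; apply: bigmax_le => // -[j l] _ /=.
rewrite !mxE; case: unlift => [j'|]; first by rewrite subrr normr0.
rewrite [leRHS]/Num.Def.normr/= mx_normrE.
have := le_bigmax 0 (fun e : 'I_1 * 'I_d => `|(x' - x) e.1 e.2|) (ord0, l).
by rewrite /= !mxE.
Qed.

(** Differentiation under a bounded linear functional. One derivative more than
    needed makes the kernel Lipschitz, so that difference quotients converge
    uniformly in the other variables. The functional will be a
    difference of two integrals, for which [D] is much smaller than the bound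
    [K0 * M] that holds for each of them. *)
Lemma Cb_under_functional (L : (TT -> R) -> R) (K0 : R) p (M D : R) :
  (forall f g, bmf f -> bmf g -> L (fun y => f y - g y) = L f - L g) ->
  (forall a f, bmf f -> L (fun y => a * f y) = a * L f) ->
  (forall f (C : R), bmf f -> (forall y, `|f y| <= C) -> `|L f| <= K0 * C) ->
  (forall E, Cb p.+1 M E -> forall x, `|L (fun y => E (glue i x y))| <= D) ->
  forall q E, Cb (q + p.+1) M E -> Cb q D (fun x => L (fun y => E (glue i x y))).
Proof.
move=> LB LZ Lb HD q E.
have K00 : 0 <= K0.
  by have := Lb _ 1 (bmf_cst _ 0) (fun=> _); rewrite normr0 mulr1 => /(_ (fun=> ler01)); apply: le_trans.
have cE q' E' : Cb (q' + p.+1) M E' -> continuous (fun x => L (fun y => E' (glue i x y))).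
  move=> CE; apply: (@lipschitz_continuous _ _ (K0 * ((n.+1 * d)%:R * M))) => x x'.
  rewrite -LB; [|exact: bmf_glue CE|exact: bmf_glue CE].
  rewrite -mulrA; apply: Lb; first by apply: bmfB; exact: bmf_glue CE.
  move=> y; have CE1 : Cb 1 M E' by apply: Cb_leq CE; rewrite addnS.
  apply: le_trans (Cb_lipschitz CE1 _ _) _.
  rewrite ler_wpM2l ?norm_glueB// mulr_ge0//; exact: Cb_ge0 CE.
elim: q E => [|q IH] E CE; (split; [exact: cE CE| |]) => //.
- exact: HD.
- by apply: HD; apply: Cb_leq CE; rewrite leq_addl.
move=> e; pose e' := (i, e.2).
have CP : Cb (q + p.+1) M (partial e' E) by apply: Cb_partial; rewrite -addSn.
have C2 : Cb 2 M E by apply: Cb_leq CE; rewrite addSn addnS.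
have gE (h : R) x y : glue i (h *: delta_mx e.1 e.2 + x) y =
    h *: delta_mx e'.1 e'.2 + glue i x y :> 'M[R]_(n.+1, d).
  by rewrite glue_setrow setrowD -glue_setrow.
have DE x : (fun h : R => h^-1 *: (((fun x => L (fun y => E (glue i x y))) \o shift x)
    (h *: delta_mx e.1 e.2) - L (fun y => E (glue i x y)))) @ (0 : R)^' -->
    L (fun y => partial e' E (glue i x y)).
  apply/cvgrPdist_le => /= eps eps0; near=> h.
  have h0 : h != 0 by near: h; exact: nbhs_dnbhs_neq.
  have hs : `|h| <= eps / (K0 * M + 1).
    near: h; apply: dnbhs0_le; rewrite divr_gt0// ltr_wpDl// mulr_ge0//.
    exact: Cb_ge0 CE.
  have KM : 0 <= K0 * M by rewrite mulr_ge0//; exact: Cb_ge0 CE.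
  rewrite distrC.
  rewrite -[X in _ *: _ - X](mulKf h0) /GRing.scale/= -mulrBr.
  have bE x' : bmf (fun y : TT => E (glue i x' y)) by exact: bmf_glue CE.
  have bP : bmf (fun y : TT => partial e' E (glue i x y)) by exact: bmf_glue CP.
  have bhP : bmf (fun y : TT => h * partial e' E (glue i x y)).
    by apply: bmfM => //; exact: bmf_cst.
  rewrite -LZ// -LB// -LB//; last exact: bmfB.
  rewrite normrM normfV ler_pdivrMl ?normr_gt0//.
  apply: (@le_trans _ _ (K0 * (M * h ^+ 2))).
    apply: Lb; first by apply: bmfB => //; exact: bmfB.
    by move=> y; rewrite gE; exact: Cb_taylor C2 h _.
  have hKM : `|h| * (K0 * M + 1) <= eps by rewrite -ler_pdivlMr// ltr_wpDl.
  rewrite (_ : K0 * _ = `|h| * (`|h| * (K0 * M))); last first.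
    by rewrite -[h ^+ 2]real_normK ?num_real//; ring.
  rewrite ler_wpM2l// (le_trans _ hKM)// ler_wpM2l// lerDl.
  exact: ler01.
split=> [x|]; first by apply/cvg_ex; eexists; exact: DE.
rewrite (_ : partial e _ = fun x => L (fun y => partial e' E (glue i x y))).
  exact: IH.
by apply/funext => x; apply/cvg_lim => //; exact: DE.
Unshelve. all: by end_near. Qed.

End under_integral.

(** * The divergence theorem for functions with bounded support *)

Lemma finite_support_integrable {R : realType} d (T : measurableType d)
    (mu : {measure set T -> \bar R}) (B : set T) (f : T -> R) (M : R) :
  measurable B -> (mu B < +oo)%E -> measurable_fun [set: T] f ->
  (forall x, `|f x| <= M) -> (forall x, ~ B x -> f x = 0) ->
  mu.-integrable setT (EFin \o f).
Proof.
move=> mB Boo mf fM f0.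
have : mu.-integrable B (EFin \o f).
  apply: measurable_bounded_integrable => //; first exact: measurable_funS mf.
  exists M; split; first exact: num_real.
  by move=> C MC x _ /=; rewrite (le_trans (fM x))// ltW.
move/(integrable_mkcond _ mB); rewrite restrict_EFin; congr (integrable _ _ (EFin \o _)).
apply/funext => x; rewrite patchE; case: ifPn => //.
by rewrite notin_setE => /f0.
Qed.

Section cubes.
Context {R : realType} {d : nat}.
Local Notation V := 'rV[R]_d.
Local Notation leb := (@lebesgue_measure R).
Local Notation lebd := (@lebesgueRd R d).
Implicit Types (f g u v : V -> R) (e : 'I_1 * 'I_d) (Q : set V).

Local Notation dl e := (delta_mx e.1 e.2 : V).

Definition cube (r : R) : set V := [set x | forall j, `|x ord0 j| <= r].

Definition cubeT n (r : R) : set (n.-tuple (measurableTypeR R)) :=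
  [set t | forall j, `|(tnth t j : R)| <= r].

Lemma cubeTE n (r : R) :
  @cubeT n r = [set t | forall j, [set x : R | - r <= x <= r] (tnth t j)].
Proof.
by apply/seteqP; split=> t H j; have := H j; rewrite /= ler_norml.
Qed.

Let interval_segment (r : R) : [set x : R | - r <= x <= r] = [set` `[- r, r]].
Proof. by apply/seteqP; split=> x; rewrite /= in_itv. Qed.

Lemma measurable_cubeT n (r : R) : measurable (@cubeT n r).
Proof.
rewrite (_ : @cubeT n r = \bigcap_(j in setT)
    ((fun t => tnth t j) @^-1` ([set` `[- r, r]] : set (measurableTypeR R)))).
  apply: fin_bigcap_measurable => // j _; rewrite -[X in measurable X]setTI.
  by apply: (@measurable_tnth _ (measurableTypeR R) n j) => //; exact: measurable_itv.
apply/seteqP; split=> t H j; have := H j; rewrite /= in_itv/= ler_norml//.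
by apply.
Qed.

Lemma lebesgue_segment_fin (r : R) : leb [set` `[- r, r]] \is a fin_num.
Proof.
have := @lebesgue_measure_itv R `[- r, r]%R => /= ->.
by case: ifPn => // _; rewrite -EFinB.
Qed.

Lemma lebesgue_cube_lty n (r : R) : (tprod (fun _ : 'I_n => leb) (cubeT r) < +oo)%E.
Proof.
rewrite cubeTE interval_segment.
rewrite (@tprodE _ _ _ n (fun=> leb) (fun=> [set` `[- r, r]])); last first.
  by move=> i; exact: measurable_itv.
rewrite ltey_eq; apply/orP; left.
apply: (@big_ind _ (fun x : \bar R => x \is a fin_num)) => //.
- by move=> x y; exact: fin_numM.
- by move=> i _; exact: lebesgue_segment_fin.
Qed.

Lemma cube_preimage (r : R) : @row_of_tuple R d @^-1` cube r = cubeT r.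
Proof. by apply/seteqP; split=> t H j; have := H j; rewrite mxE. Qed.

Lemma lebesgueRd_cube_lty (r : R) : (lebd (cube r) < +oo)%E.
Proof. by rewrite /lebesgueRd /pushforward cube_preimage lebesgue_cube_lty. Qed.

Lemma closed_cube (r : R) : closed (cube r).
Proof.
rewrite (_ : cube r = \bigcap_(j in setT) ((fun x : V => x ord0 j) @^-1` [set t | `|t| <= r])).
  apply: closed_bigI => j _; apply: closed_comp.
    by move=> x _; exact: coord_continuous.
  apply: (@closed_comp _ _ (@Num.norm _ R^o) [set t | t <= r]); last exact: closed_le.
  by move=> x _; exact: norm_continuous.
by apply/seteqP; split=> x H j; [move=> _; exact: H|exact: H].
Qed.

Lemma closed_borelRd Q : closed Q -> measurable (Q : set (borelRd R d)).
Proof.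
move=> cQ; rewrite -[Q]setCK; apply: measurableC; apply: sub_sigma_algebra.
exact: closed_openC.
Qed.

Lemma cube_bounded f r : continuous f -> exists M : R, forall x, cube r x -> `|f x| <= M.
Proof.
move=> cf; have [M HM] := continuous_box_bounded r cf; exists M => x xr.
by apply: HM => i j; rewrite (ord1 i).
Qed.

Lemma cube_support_bounded f r : continuous f -> (forall x, ~ cube r x -> f x = 0) ->
  exists M : R, forall x, `|f x| <= M.
Proof.
move=> cf f0; have [M HM] := cube_bounded r cf; exists `|M| => x.
have [/HM fM|/f0->] := pselect (cube r x); last by rewrite normr0.
exact: le_trans fM (ler_norm _).
Qed.

Lemma cube_support_integrable f r : continuous f -> (forall x, ~ cube r x -> f x = 0) ->
  lebd.-integrable setT (EFin \o f).
Proof.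
move=> cf f0; have [M HM] := cube_support_bounded cf f0.
apply: (@finite_support_integrable R _ (borelRd R d) _ (cube r) f M) => //.
- by apply: closed_borelRd; exact: closed_cube.
- exact: lebesgueRd_cube_lty.
- exact: continuous_borelRd.
Qed.

End cubes.

Section fundamental_theorem_Rd.
Context {R : realType} {n : nat}.
Local Notation V := 'rV[R]_n.+1.
Local Notation leb := (@lebesgue_measure R).
Local Notation lebd := (@lebesgueRd R n.+1).
Implicit Types (f g u v : V -> R).

(** By Fubini, the coordinate of differentiation may be integrated first, and
    along it the fundamental theorem of calculus applies. *)
Lemma integral_partial_eq0 v (e : 'I_1 * 'I_n.+1) r : Ck 1 v ->
  (forall x, ~ cube r x -> v x = 0) -> \int[lebd]_x partial e v x = 0.
Proof.
move=> [cv dv] v0; have [dve [cw _]] := dv e; set w := partial e v in cw *.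
have w0 x : ~ cube r x -> w x = 0 by apply: partial_eq0 => //; exact: closed_cube.
have [M HM] := cube_support_bounded cw w0.
set j := e.2.
have mrow := @measurable_row_of_tuple R n.+1.
have mw : measurable_fun [set: borelRd R n.+1] (w : borelRd R n.+1 -> R).
  exact: continuous_borelRd.
have mwr : measurable_fun setT (fun t => w (row_of_tuple t)).
  exact: (measurableT_comp mw mrow).
have mwri : measurable_fun setT (fun p : measurableTypeR R * n.-tuple (measurableTypeR R) =>
     w (row_of_tuple (ins j p.1 p.2))).
  by apply: (measurableT_comp mwr); exact: measurable_ins.
have not_cube (t : n.+1.-tuple (measurableTypeR R)) : ~ cubeT r t -> w (row_of_tuple t) = 0.
  by rewrite -cube_preimage => /w0.
have irow : (tprod (fun _ : 'I_n.+1 => leb)).-integrable setT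
     (EFin \o (fun t => w (row_of_tuple t))).
  apply: (@finite_support_integrable _ _ _ _ (cubeT r) _ M) => //.
  - exact: measurable_cubeT.
  - exact: lebesgue_cube_lty.
have iins : (leb \x tprod (fun _ : 'I_n => leb))%E.-integrable setT
    (EFin \o (fun p : measurableTypeR R * n.-tuple (measurableTypeR R) =>
       w (row_of_tuple (ins j p.1 p.2)))).
  apply: (@finite_support_integrable _ _ (measurableTypeR R * n.-tuple (measurableTypeR R))%type
     (leb \x tprod (fun _ : 'I_n => leb))%E ([set` `[- r, r]] `*` cubeT r)
     (fun p => w (row_of_tuple (ins j p.1 p.2))) M) => //.
  - by apply: measurableX; [exact: measurable_itv|exact: measurable_cubeT].
  - have E := @product_measure1E _ _ _ _ R leb (tprod (fun _ : 'I_n => leb))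
      [set` `[- r, r]] (cubeT r) (measurable_itv _) (@measurable_cubeT _ _ r).
    have : (leb [set` `[- r, r]%R] * tprod (fun _ : 'I_n => leb) (cubeT r) < +oo)%E.
      by rewrite lte_mul_pinfty ?lebesgue_cube_lty ?lebesgue_segment_fin.
    by rewrite -E.
  - move=> [x y] /= xy; apply: not_cube => H; apply: xy; split=> /=.
      by have := H j; rewrite tnth_ins_eq in_itv/= ler_norml.
    by move=> l; have := H (lift j l); rewrite tnth_ins_lift.
rewrite /Rintegral.
transitivity (fine (\int[tprod (fun _ : 'I_n.+1 => leb)]_t (w (row_of_tuple t))%:E)).
  congr fine; rewrite /lebesgueRd.
  rewrite (@integral_pushforward _ _ _ _ _ _ mrow _ setT (EFin \o w))//.
  exact/measurable_EFinP.
rewrite (@integral_tprod_ins _ _ _ _ (fun=> leb) j (fun t => (w (row_of_tuple t))%:E))//; last first.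
  exact/measurable_EFinP.
rewrite -(integral21_prod_meas1 iins) integral0_eq// => y _.
pose z : V := row_of_tuple (ins j (0 : measurableTypeR R) y).
have insE (x : R) : row_of_tuple (ins j (x : measurableTypeR R) y) = x *: delta_mx e.1 e.2 + z.
  apply/rowP => l; rewrite !mxE (ord1 e.1) eqxx/=.
  case: (unliftP j l) => [l'|] ->; rewrite ?tnth_ins_lift ?tnth_ins_eq.
    by rewrite eq_sym (negbTE (neq_lift _ _)) mulr0 add0r.
  by rewrite eqxx mulr1 addr0.
pose G (x : R) := v (x *: delta_mx e.1 e.2 + z).
have dG (x : R) : derivable G x 1 /\ 'D_1 G x = w (x *: delta_mx e.1 e.2 + z).
  exact: line_derivable.
have far (x : R) : ~ (- r <= x <= r) -> ~ cube r (x *: delta_mx e.1 e.2 + z).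
  move=> xr /(_ j); rewrite -insE mxE tnth_ins_eq => H; apply: xr.
  by rewrite -ler_norml.
(* A segment that contains the support in its interior: [v] vanishes at its
   ends. *)
pose a : R := `|r| + 1.
have ra : r < a by rewrite /a ltr_pwDr// ler_norm.
have aa : - a < a by rewrite gtrN// /a ltr_wpDl.
have H0 (x : R) : ~ ([set` `[- a, a]] x) -> w (x *: delta_mx e.1 e.2 + z) = 0.
  move=> xa; apply: w0; apply: far => xr; apply: xa; rewrite /= in_itv/=.
  by move: xr; rewrite -!ler_norml => /le_trans; apply; exact: ltW.
have cline : continuous (fun x : R => w (x *: delta_mx e.1 e.2 + z)).
  move=> x; apply: (@continuous_comp _ _ _ (fun x : R => x *: delta_mx e.1 e.2 + z) w); last exact: cw.
  by apply: continuousD; [exact: scalel_continuous|exact: cst_continuous].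
have cG : continuous G.
  by move=> x; apply/differentiable_continuous; apply/derivable1_diffP; exact: (dG x).1.
transitivity (\int[leb]_(x in [set` `[- a, a]%R]) (w (x *: delta_mx e.1 e.2 + z))%:E)%E.
  rewrite [RHS]integral_mkcond; apply: eq_integral => x _.
  rewrite /= insE patchE; case: ifPn => //.
  by rewrite notin_setE => /H0 ->.
rewrite (@continuous_FTC2 R _ G (- a) a aa).
- by rewrite /G !v0 ?subee//; apply: far => /andP[]; move: ra; lra.
- exact: continuous_subspaceT.
- split.
  + by move=> x _; exact: (dG x).1.
  + by apply: cvg_at_right_filter; exact: cG.
  + by apply: cvg_at_left_filter; exact: cG.
- by move=> x _; rewrite derive1E (dG x).2.
Qed.

End fundamental_theorem_Rd.

(** * Weak derivatives and the dual Sobolev norm *)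

Section weak_derivatives.
Context {R : realType} {d : nat}.
Local Notation V := 'rV[R]_d.
Local Notation lebd := (@lebesgueRd R d).
Implicit Types (f g u v : V -> R) (e : 'I_1 * 'I_d) (Q : set V).

(** The integral of the derivative of [f * u] vanishes. *)
Lemma integration_by_parts_step f u e r : Ck 1 f -> Ck 1 u ->
  (forall x, ~ cube r x -> u x = 0) ->
  \int[lebd]_x (f x * partial e u x) = - \int[lebd]_x (partial e f x * u x).
Proof.
case: d e f u => [[_ []//]|n] e f u Cf Cu u0.
have [cf dcf] := Cf; have [cu dcu] := Cu.
have [df [cpf _]] := dcf e; have [du [cpu _]] := dcu e.
have pu0 x : ~ cube r x -> partial e u x = 0.
  by apply: partial_eq0 => //; exact: closed_cube.
have i1 : (@lebesgueRd R n.+1).-integrable setT (EFin \o (fun x => f x * partial e u x)).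
  apply: (@cube_support_integrable _ _ _ r).
    by move=> x; apply: continuousM; [exact: cf|exact: cpu].
  by move=> x /pu0 ->; rewrite mulr0.
have i2 : (@lebesgueRd R n.+1).-integrable setT (EFin \o (fun x => partial e f x * u x)).
  apply: (@cube_support_integrable _ _ _ r).
    by move=> x; apply: continuousM; [exact: cpf|exact: cu].
  by move=> x /u0 ->; rewrite mulr0.
apply/eqP; rewrite -addr_eq0 -RintegralD//; apply/eqP.
rewrite -[RHS](@integral_partial_eq0 R n (fun x => f x * u x) e r).
- apply: eq_Rintegral => x _; rewrite /partial deriveM//.
  by rewrite /GRing.scale/= [X in _ + X = _]mulrC.
- exact: CkM.
- by move=> x /u0 ->; rewrite mulr0.
Qed.

Definition smooth_in Q u := (forall k, Ck k u) /\ forall x, ~ Q x -> u x = 0.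

Lemma smooth_in_partial Q u e : closed Q -> smooth_in Q u -> smooth_in Q (partial e u).
Proof.
move=> cQ [Cu u0]; split=> [k|]; first by have [_ /(_ e)[]] := Cu k.+1.
exact: partial_eq0.
Qed.

Lemma smooth_in_iter Q u e k : closed Q -> smooth_in Q u ->
  smooth_in Q (iter k (partial e) u).
Proof. by move=> cQ Hu; elim: k => //= k IH; exact: smooth_in_partial. Qed.

Lemma Ck_iter q k e f : Ck (k + q) f -> Ck q (iter k (partial e) f).
Proof.
elim: k q => [//|k IH] q Hf; rewrite iterS.
have : Ck q.+1 (iter k (partial e) f) by apply: IH; rewrite addnS -addSn.
by move=> [_ /(_ e)[]].
Qed.

Lemma integration_by_parts_iter Q r f u e k : closed Q -> Q `<=` cube r ->
  smooth_in Q u -> Ck k f ->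
  \int[lebd]_x (f x * iter k (partial e) u x) =
  (-1) ^+ k * \int[lebd]_x (iter k (partial e) f x * u x).
Proof.
move=> cQ Qr Hu; elim: k f => [|k IH] f Cf; first by rewrite expr0 mul1r.
have [Ci i0] := smooth_in_iter e k cQ Hu.
rewrite iterS (@integration_by_parts_step _ _ _ r)//.
- by rewrite IH ?iterSr ?exprS ?mulN1r ?mulNr//; have [_ /(_ e)[]] := Cf.
- exact: Ck_leq Cf.
- by move=> x xr; apply: i0 => /Qr.
Qed.

(** The partial derivatives are moved to the other factor one after the other,
    so they apply to it in the reverse order. *)
Lemma integration_by_parts_multi Q r (a : 'I_1 * 'I_d -> nat) f u (s : seq ('I_1 * 'I_d)) :
  closed Q -> Q `<=` cube r -> smooth_in Q u -> Ck (\sum_(e <- s) a e) f ->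
  \int[lebd]_x (f x * foldr (fun e g => iter (a e) (partial e) g) u s x) =
  (-1) ^+ (\sum_(e <- s) a e) *
  \int[lebd]_x (foldl (fun g e => iter (a e) (partial e) g) f s x * u x).
Proof.
move=> cQ Qr Hu; elim: s f => [|e s IH] f /=.
  by rewrite big_nil expr0 mul1r.
rewrite big_cons => Cf.
have Hs : smooth_in Q (foldr (fun e g => iter (a e) (partial e) g) u s).
  by elim: s {IH Cf} => //= e' s IH; exact: smooth_in_iter.
rewrite (integration_by_parts_iter e cQ Qr Hs); last by apply: Ck_leq Cf; rewrite leq_addr.
by rewrite IH ?exprD ?mulrA//; apply: Ck_iter.
Qed.

Lemma compact_cube (K : set V) : compact K -> exists r, K `<=` cube r.
Proof.
move=> cK; have [r0 [_ Hr]] := compact_bounded cK; exists (r0 + 1) => x Kx j.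
have H : `|x| <= r0 + 1 by apply: Hr => //; rewrite ltrDl.
apply: le_trans H; rewrite [leRHS]/Num.Def.normr/= mx_normrE.
exact: (le_bigmax 0 (fun e : 'I_1 * 'I_d => `|x e.1 e.2|) (ord0, j)).
Qed.

(** The order of differentiation that repeated integration by parts produces. It
    gives the same function as [mpartial] by Schwarz's theorem, but a weak
    derivative may be represented by either. *)
Definition reverse_mpartial p (a : multi_index 1 d p) f :=
  foldl (fun g e => iter (a e) (partial e) g) f (enum {: 'I_1 * 'I_d}).

Lemma weak_partial_Ck p (a : multi_index 1 d p) (O : set V) f :
  (order a <= p)%N -> Ck p f -> weak_partial a O f (reverse_mpartial a f).
Proof.
move=> ap Cf u [Cu cQ QO].
set Q := closure [set x | u x != 0] in cQ QO.
have clQ : closed Q by exact: closed_closure.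
have u0 x : ~ Q x -> u x = 0.
  move=> Qx; apply/eqP; apply: contrapT => ux; apply: Qx.
  by apply: subset_closure; apply/negP.
have [r Qr] := compact_cube cQ.
have Hu : smooth_in Q u by [].
have Hs : smooth_in Q (mpartial a u).
  rewrite /mpartial; elim: (enum _) => //= e' s IH; exact: smooth_in_iter.
have drop (h w : V -> R) : (forall x, ~ Q x -> w x = 0) ->
    \int[lebd]_(x in O) (h x * w x) = \int[lebd]_x (h x * w x).
  move=> w0; rewrite [LHS]Rintegral_mkcond; apply: eq_Rintegral => x _.
  rewrite patchE; case: ifPn => //; rewrite notin_setE => Ox.
  by rewrite w0 ?mulr0// => /QO.
rewrite drop ?(drop _ u) ?(proj2 Hs)//; last exact: Hs.2.
have sE : (\sum_(e <- enum {: 'I_1 * 'I_d}) a e)%N = order a by rewrite big_enum.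
rewrite /mpartial (integration_by_parts_multi clQ Qr Hu) sE//.
exact: Ck_leq Cf.
Qed.

Lemma Cb_reverse_mpartial p (a : multi_index 1 d p) M f :
  (order a <= p)%N -> Cb p M f -> Cb 0 M (reverse_mpartial a f).
Proof.
move=> ap Hf.
suff H (s : seq ('I_1 * 'I_d)) g : Cb (\sum_(e <- s) a e) M g ->
    Cb 0 M (foldl (fun g e => iter (a e) (partial e) g) g s).
  by apply: H; rewrite big_enum; exact: Cb_leq Hf.
elim: s g => [|e s IH] g /=; first by rewrite big_nil.
by rewrite big_cons => H; apply: IH; exact: Cb_iter.
Qed.

Lemma compact_closed_rV (K : set V) : compact K -> closed K.
Proof. by apply: compact_closed; exact: norm_hausdorff. Qed.

(** Bounded derivatives are square integrable on [K], which has finite volume,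
    and those of a function of class C^p are its weak derivatives. *)
Lemma Hp_norm_le1 p (K : set V) : compact K ->
  exists2 C : R, 0 < C & forall f, Cb p C^-1 f -> (Hp_norm p K f <= 1)%E.
Proof.
move=> cK.
have mK : measurable (K : set (borelRd R d)) by exact: closed_borelRd (compact_closed_rV cK).
have [r Kr] := compact_cube cK.
have mC : measurable (cube r : set (borelRd R d)).
  by apply: closed_borelRd; exact: closed_cube.
have volK : (lebd K <= lebd (cube r))%E by apply: le_measure => //; rewrite inE.
pose vol := fine (lebd (cube r)).
have volE : lebd (cube r) = vol%:E by rewrite fineK// ge0_fin_numE ?lebesgueRd_cube_lty.
have vol0 : 0 <= vol by rewrite fine_ge0.
pose c : R := #|{: multi_index 1 d p}|%:R.
(* Each of the at most [c] terms of the norm will be at most [C ^- 2 * vol]. *)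
pose C := 1 + c * vol.
have C1 : 1 <= C by rewrite lerDl mulr_ge0.
have C0 : 0 < C by exact: lt_le_trans C1.
exists C => // f Hf.
rewrite /Hp_norm -[leRHS](poweR1r (2^-1)%R).
have S0 (g : multi_index 1 d p -> V -> R) : (0 <= \sum_(a : multi_index 1 d p | (order a <= p)%N)
    \int[lebd]_(x in K) (`|g a x| ^+ 2)%:E)%E.
  by apply: sume_ge0 => a _; apply: integral_ge0 => x _; rewrite lee_fin sqr_ge0.
apply: gt0_ler_poweR; first by rewrite invr_ge0.
- rewrite in_itv/= leey andbT; apply: le_ereal_inf_tmp => _ [g _ <-]; exact: S0.
- by rewrite in_itv/= leey andbT.
apply: ereal_inf_le; exists (\sum_(a : multi_index 1 d p | (order a <= p)%N)
    \int[lebd]_(x in K) (`|reverse_mpartial a f x| ^+ 2)%:E)%E.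
  exists (fun a => reverse_mpartial a f) => // a ap; split.
    apply: (@measurable_funS _ _ _ _ setT) => //.
    exact: continuous_borelRd (Cb_continuous (Cb_reverse_mpartial ap Hf)).
  by apply: weak_partial_Ck => //; exact: Cb_Ck Hf.
apply: (@le_trans _ _ (\sum_(a : multi_index 1 d p) (C ^- 2 * vol)%:E)%E).
  rewrite [leLHS]big_mkcond/=; apply: lee_sum => a _; case: ifPn => ap; last first.
    by rewrite lee_fin mulr_ge0// invr_ge0 exprn_ge0// ltW.
  apply: (@le_trans _ _ (\int[lebd]_(x in K) (C ^- 2)%:E)%E).
    apply: ge0_le_integral => //.
    - apply/measurable_EFinP; apply: (@measurable_funS _ _ _ _ setT) => //.
      apply: measurable_funX; apply: measurableT_comp => //.
      exact: continuous_borelRd (Cb_continuous (Cb_reverse_mpartial ap Hf)).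
    - move=> x _; rewrite lee_fin -exprVn lerXn2r ?nnegrE ?invr_ge0 ?(ltW C0)//.
      exact: (Cb_bound (Cb_reverse_mpartial ap Hf)).
  rewrite integral_cst// EFinM -volE; apply: lee_wpmul2l => //.
  by rewrite lee_fin invr_ge0 exprn_ge0// ltW.
rewrite sumEFin lee_fin sumr_const -mulr_natl -/c.
rewrite mulrCA ler_pdivrMl ?exprn_gt0// mulr1.
apply: (@le_trans _ _ C); first by rewrite /C lerDr.
by rewrite expr2 ler_peMl// ltW.
Qed.

(** A multiple of [G] lies in the unit ball of H^p, so it competes in the
    supremum that defines the distance. *)
Lemma Hmp_dist_test p (K : set V) : compact K ->
  exists2 C : R, 0 < C & forall (mu nu : probability (borelRd R d) R) (D : R),
    mu K = 1%E -> nu K = 1%E -> Hmp_dist p K mu nu = D%:E ->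
    forall (G : V -> R) M, Cb p M G ->
      `|\int[mu]_x G x - \int[nu]_x G x| <= C * M * D.
Proof.
move=> cK.
have mK : measurable (K : set (borelRd R d)) by exact: closed_borelRd (compact_closed_rV cK).
have [C C0 HC] := Hp_norm_le1 p cK; exists C => // mu nu D muK nuK DE G M CG.
have test f : Cb p C^-1 f -> \int[mu]_x f x - \int[nu]_x f x <= D.
  move=> Cf; rewrite -lee_fin -DE EFinB.
  have bf : @bmf R _ (borelRd R d) f := bmf_Cb Cf.
  rewrite -(integral_carried (probability_setT mu) mK muK bf)
    -(integral_carried (probability_setT nu) mK nuK bf).
  apply: ereal_sup_ubound; exists f => //; split; last exact: HC.
  exact: continuous_subspaceT (Cb_continuous Cf).
have M0 := Cb_ge0 CG.
have [Mp|] := ltP 0 M; last first.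
  move=> Mn; have ME : M = 0 by apply/eqP; rewrite eq_le Mn M0.
  have G0 x : G x = 0 by apply/eqP; rewrite -normr_le0 -ME (Cb_bound CG).
  under eq_Rintegral do rewrite G0.
  under [in X in _ - X]eq_Rintegral do rewrite G0.
  by rewrite (RintC (probability_setT mu)) (RintC (probability_setT nu)) subrr normr0 ME mulr0 mul0r.
have bG := bmf_Cb CG.
have mu1 := probability_setT mu; have nu1 := probability_setT nu.
pose t := (C * M)^-1.
have t0 : 0 < t by rewrite invr_gt0 mulr_gt0.
have scal (s : R) : `|s| = t -> s * (\int[mu]_x G x - \int[nu]_x G x) <= D.
  move=> st; rewrite mulrBr -!RintZ//; apply: test.
  apply: Cb_le (CbZ s CG); rewrite st /t invfM -mulrA mulVf ?gt_eqF//.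
  by rewrite mulr1.
have H1 := scal t (gtr0_norm t0).
have H2 := scal (- t) (etrans (normrN t) (gtr0_norm t0)).
have CM : C * M * D = t^-1 * D by rewrite /t invrK.
rewrite CM ler_norml; apply/andP; split.
  by rewrite lerNl ler_pdivlMl// mulrN -mulNr.
by rewrite ler_pdivlMl.
Qed.

Lemma Hmp_dist_ge0 p (K : set V) (mu nu : probability (borelRd R d) R) :
  compact K -> (0 <= Hmp_dist p K mu nu)%E.
Proof.
move=> cK; apply: ereal_sup_ubound; exists (fun=> 0).
  split; first exact: cst_continuous.
  have [C C0 HC] := Hp_norm_le1 p cK; apply: HC.
  by apply: Cb_le (Cb_cst p 0); rewrite normr0 invr_ge0 ltW.
by rewrite !integral0 subee.
Qed.

End weak_derivatives.

(** * The Schrodinger system on the whole space *)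

(** [E] is the exponential of the opposite of a cost, bounded by [l] on the whole
    space: the system makes sense at every point and not only on the supports. *)
Section schrodinger_kernel.
Context {R : realType} {n d : nat}.
Local Notation T := (borelRd R d).
Local Notation I := 'I_n.+1.
Variables (E : 'M[R]_(n.+1, d) -> R) (l : R).
Hypothesis Ec : Cb 0 (expR l) E.
Hypothesis El : forall x, expR (- l) <= E x.
Implicit Types (mu nu : I -> probability T R) (phi psi : I -> T -> R) (B : R).

Definition tsum k (phi : 'I_k -> T -> R) (t : k.-tuple T) : R :=
  \sum_i phi i (tnth t i).

Definition family phi := forall i, bmf (phi i).
Definition bounded_by B phi := forall i x, `|phi i x| <= B.

Definition others (i : I) phi : 'I_n -> T -> R := fun j => phi (lift i j).

(** The integral of the Schrodinger system, with the factor [exp (phi_i x)]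
    taken out. *)
Definition avg mu phi (i : I) (x : T) : R :=
  \int[tprod (fun j => mu (lift i j))]_y
    (expR (tsum (others i phi) y) * E (glue i x y)).

(** The density with respect to [mu i] of the [i]-th marginal of the coupling
    with density [exp (tsum phi) * E]; the system requires it to be 1. *)
Definition rho mu phi (i : I) (x : T) : R := expR (phi i x) * avg mu phi i x.

Lemma l_ge0 : 0 <= l.
Proof.
have := le_trans (El 0) (le_trans (ler_norm _) (Cb_bound Ec 0)).
by rewrite ler_expR; lra.
Qed.

Lemma E_gt0 x : 0 < E x.
Proof. exact: lt_le_trans (expR_gt0 _) (El x). Qed.

Lemma E_le x : E x <= expR l.
Proof. exact: le_trans (ler_norm _) (Cb_bound Ec x). Qed.

Lemma tsum_ins phi i x y : tsum phi (ins i x y) = phi i x + tsum (others i phi) y.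
Proof.
rewrite /tsum (bigD1_ord i)//= tnth_ins_eq; congr (_ + _).
by apply: eq_bigr => j _; rewrite tnth_ins_lift.
Qed.

Lemma tsumB k (phi psi : 'I_k -> T -> R) t :
  tsum (fun i x => phi i x - psi i x) t = tsum phi t - tsum psi t.
Proof. by rewrite /tsum sumrB. Qed.

Lemma bmf_tsum k (phi : 'I_k -> T -> R) : (forall i, bmf (phi i)) -> bmf (tsum phi).
Proof.
move=> bphi; apply: bmf_sum => i; apply: bmf_comp (bphi i).
exact: measurable_tnth.
Qed.

Lemma tsum_bound k (phi : 'I_k -> T -> R) B t : (forall i x, `|phi i x| <= B) ->
  `|tsum phi t| <= k%:R * B.
Proof.
move=> bB; apply: le_trans (ler_norm_sum _ _ _) _.
apply: le_trans (ler_sum _ (fun i _ => bB i _)) _.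
by rewrite sumr_const card_ord mulr_natl.
Qed.

Lemma bmf_others i phi : family phi -> forall j, bmf (others i phi j).
Proof. by move=> bphi j; exact: bphi. Qed.

Lemma bmf_avg_integrand phi i x : family phi ->
  bmf (fun y => expR (tsum (others i phi) y) * E (glue i x y)).
Proof.
move=> bphi; apply: bmfM; first by apply: bmf_expR; apply: bmf_tsum; exact: bmf_others.
exact: bmf_glue Ec.
Qed.

Lemma bmf_avg mu phi i : family phi -> bmf (avg mu phi i).
Proof.
move=> bphi; rewrite /avg.
have bF : bmf (fun t => expR (tsum phi t - phi i (tnth t i)) * E (mat t)).
  apply: bmfM; last exact: bmf_mat Ec.
  apply: bmf_expR; apply: bmfB; first exact: bmf_tsum.
  by apply: bmf_comp (bphi i); exact: measurable_tnth.
have := bmf_Rint_ins1 mu i bF; congr bmf; apply/funext => x.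
apply: eq_Rintegral => y _.
by rewrite tsum_ins tnth_ins_eq addrAC subrr add0r glueE.
Qed.

Lemma bmf_rho mu phi i : family phi -> bmf (rho mu phi i).
Proof. by move=> bphi; apply: bmfM; [exact: bmf_expR|exact: bmf_avg]. Qed.

Lemma bmf_density phi : family phi -> bmf (fun t => expR (tsum phi t) * E (mat t)).
Proof.
move=> bphi; apply: bmfM; last exact: bmf_mat Ec.
by apply: bmf_expR; exact: bmf_tsum.
Qed.

Lemma Rint_marginal k (m : 'I_k -> probability T R) (f : T -> R) j : bmf f ->
  \int[tprod (fun i => m i)]_t f (tnth t j) = \int[m j]_x f x.
Proof.
case: k m j => [m []//|k] m j bf; rewrite (Rint_ins1 m j).
  apply: eq_Rintegral => x _.
  under eq_Rintegral do rewrite tnth_ins_eq.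
  by rewrite RintC//; exact: tprod_mass.
by apply: bmf_comp bf; exact: measurable_tnth.
Qed.

Lemma Rint_tsum k (m : 'I_k -> probability T R) (phi : 'I_k -> T -> R) :
  (forall i, bmf (phi i)) ->
  \int[tprod (fun i => m i)]_t tsum phi t = \sum_i \int[m i]_x phi i x.
Proof.
move=> bphi; rewrite /tsum Rint_sum; [|exact: tprod_mass|].
  by apply: eq_bigr => i _; exact: Rint_marginal.
by move=> i; apply: bmf_comp (bphi i); exact: measurable_tnth.
Qed.

(** Integrating out all the coordinates but the [i]-th turns the coupling into
    its marginal. *)
Lemma Rint_density mu phi i (h : T -> R) : family phi -> bmf h ->
  \int[tprod (fun j => mu j)]_t (h (tnth t i) * (expR (tsum phi t) * E (mat t))) =
  \int[mu i]_x (h x * rho mu phi i x).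
Proof.
move=> bphi bh; rewrite (Rint_ins1 mu i); last first.
  apply: bmfM; last exact: bmf_density.
  by apply: bmf_comp bh; exact: measurable_tnth.
apply: eq_Rintegral => x _; rewrite /rho mulrA /avg -RintZ.
- apply: eq_Rintegral => y _; rewrite tnth_ins_eq tsum_ins expRD glueE.
  by rewrite !mulrA.
- exact: tprod_mass.
- exact: bmf_avg_integrand.
Qed.

Lemma avg_bounds mu phi i x : family phi ->
  expR (- l) * \int[tprod (fun j => mu (lift i j))]_y expR (tsum (others i phi) y)
    <= avg mu phi i x <=
  expR l * \int[tprod (fun j => mu (lift i j))]_y expR (tsum (others i phi) y).
Proof.
move=> bphi; have m1 := tprod_mass (fun j => mu (lift i j)).
have bs : bmf (fun y => expR (tsum (others i phi) y)).
  by apply: bmf_expR; apply: bmf_tsum; exact: bmf_others.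
have bI := bmf_avg_integrand i x bphi.
have bc (u : R) : bmf (fun y => u * expR (tsum (others i phi) y)).
  by apply: bmfM bs; exact: bmf_cst.
rewrite -(RintZ m1 _ bs) -(RintZ m1 _ bs); apply/andP; split.
  by apply: (Rint_le m1 (bc _) bI) => y; rewrite mulrC ler_wpM2l ?expR_ge0.
by apply: (Rint_le m1 bI (bc _)) => y; rewrite [leRHS]mulrC ler_wpM2l ?expR_ge0 ?E_le.
Qed.

Lemma avg_bound B mu phi i x : family phi -> bounded_by B phi ->
  expR (- (n%:R * B + l)) <= avg mu phi i x <= expR (n%:R * B + l).
Proof.
move=> bphi bB; have /andP[H1 H2] := avg_bounds mu i x bphi.
have m1 := tprod_mass (fun j => mu (lift i j)).
have bs : bmf (fun y => expR (tsum (others i phi) y)).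
  by apply: bmf_expR; apply: bmf_tsum; exact: bmf_others.
have /andP[H3 H4] : expR (- (n%:R * B)) <=
    \int[tprod (fun j => mu (lift i j))]_y expR (tsum (others i phi) y) <= expR (n%:R * B).
  apply: Rint_bounds => // y; rewrite !ler_expR -ler_norml.
  by apply: tsum_bound => j z; exact: bB.
rewrite opprD addrC !expRD; apply/andP; split.
  by apply: le_trans H1; rewrite ler_wpM2l ?expR_ge0.
by apply: le_trans H2 _; rewrite mulrC ler_wpM2r ?expR_ge0.
Qed.

Lemma avg_gt0 mu phi i x : family phi -> 0 < avg mu phi i x.
Proof.
move=> bphi; have /andP[H1 _] := avg_bounds mu i x bphi; apply: lt_le_trans H1.
rewrite mulr_gt0 ?expR_gt0//.
have bs : bmf (tsum (others i phi)) by apply: bmf_tsum; exact: bmf_others.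
have m1 := tprod_mass (fun j => mu (lift i j)).
have [_ [M HM]] := bs; have /andP[H _] : expR (- M) <=
    \int[tprod (fun j => mu (lift i j))]_y expR (tsum (others i phi) y) <= expR M.
  by apply: Rint_bounds => //; [exact: bmf_expR|move=> y; rewrite !ler_expR -ler_norml].
by apply: lt_le_trans H; exact: expR_gt0.
Qed.

(** Both averages are within a factor [exp l] of one integral in which the point
    does not occur. The bound is independent of the potentials: this is where the
    a priori estimates come from. *)
Lemma ln_avg_osc mu phi i x x' : family phi ->
  `|ln (avg mu phi i x) - ln (avg mu phi i x')| <= 2 * l.
Proof.
move=> bphi; have /andP[H1 H2] := avg_bounds mu i x bphi.
have /andP[H3 H4] := avg_bounds mu i x' bphi.
have a0 := avg_gt0 mu i x bphi; have a0' := avg_gt0 mu i x' bphi.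
move: H1 H2 H3 H4; set z := Rintegral _ _ _ => H1 H2 H3 H4.
have z0 : 0 < z by rewrite -(pmulr_rgt0 _ (expR_gt0 l)) (lt_le_trans a0).
have K u : 0 < u -> expR (- l) * z <= u <= expR l * z -> - l + ln z <= ln u <= l + ln z.
  move=> u0 /andP[zu uz].
  rewrite -[X in X + _]expRK -[X in _ && (_ <= X + _)]expRK.
  by rewrite -!lnM ?posrE ?expR_gt0// !ler_ln ?posrE ?mulr_gt0 ?expR_gt0// zu uz.
have := K _ a0; rewrite H1 H2 => /(_ isT) /andP[K1 K2].
have := K _ a0'; rewrite H3 H4 => /(_ isT) /andP[K3 K4].
by rewrite ler_norml; lra.
Qed.

(** The exponential is Lipschitz on bounded sets and each potential depends on a
    single coordinate, so an L^1 bound on the potentials gives a uniform one on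
    the averages. *)
Lemma avg_increment B mu phi psi i x (M : R) (E' : 'M[R]_(n.+1, d) -> R) :
  family phi -> family psi -> bounded_by B phi -> bounded_by B psi -> Cb 0 M E' ->
  `|\int[tprod (fun j => mu (lift i j))]_y
      ((expR (tsum (others i phi) y) - expR (tsum (others i psi) y)) * E' (glue i x y))|
  <= M * expR (n%:R * B) * \sum_j \int[mu j]_z `|phi j z - psi j z|.
Proof.
move=> bphi bpsi Bphi Bpsi CE'.
have m1 := tprod_mass (fun j => mu (lift i j)).
have M0 := Cb_ge0 CE'.
have bo := bmf_others i bphi; have bo' := bmf_others i bpsi.
have bh j : bmf (fun z => `|phi j z - psi j z|) by apply: bmf_norm; exact: bmfB.
pose h := fun j z => `|phi j z - psi j z|.
have bd : bmf (fun y => expR (tsum (others i phi) y) - expR (tsum (others i psi) y)).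
  by apply: bmfB; apply: bmf_expR; exact: bmf_tsum.
have bs : bmf (tsum (others i h)) by apply: bmf_tsum; exact: bmf_others.
have bI := bmfM bd (bmf_glue i x CE').
apply: le_trans (Rint_norm m1 bI) _.
apply: (@le_trans _ _ (\int[tprod (fun j => mu (lift i j))]_y
    ((M * expR (n%:R * B)) * tsum (others i h) y))).
  apply: Rint_le => //; [exact: bmf_norm|by apply: bmfM => //; exact: bmf_cst|].
  move=> y; rewrite normrM mulrC -mulrA ler_pM//; first exact: (Cb_bound CE').
  have H1 : tsum (others i phi) y <= n%:R * B.
    by apply: le_trans (ler_norm _) _; apply: tsum_bound => j z; exact: Bphi.
  have H2 : tsum (others i psi) y <= n%:R * B.
    by apply: le_trans (ler_norm _) _; apply: tsum_bound => j z; exact: Bpsi.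
  apply: le_trans (expR_lipschitz H1 H2) _; rewrite ler_wpM2l ?expR_ge0//.
  rewrite /tsum -sumrB; exact: ler_norm_sum.
rewrite RintZ// ler_wpM2l//; first by rewrite mulr_ge0 ?expR_ge0.
rewrite (Rint_tsum (fun j => mu (lift i j)) (bmf_others i bh)).
by rewrite [leRHS](bigD1_ord i)//= lerDr Rintegral_ge0.
Qed.

(** The square is expanded around the [i]-th variable. The cross term integrates
    to [2 * n * a ^+ 2], where [a] is the common mean of the [h j]: this is why
    potentials are compared after their means have been made equal. *)
Lemma le_Rint_tsum_sqr nu (h : I -> T -> R) i : family h ->
  (forall j, \int[nu j]_x h j x = \int[nu i]_x h i x) ->
  \int[nu i]_x (h i x ^+ 2) <= \int[tprod (fun j => nu j)]_t (tsum h t ^+ 2).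
Proof.
move=> bh hE; set a := Rintegral (nu i) _ _ in hE.
have bsq : bmf (fun t => tsum h t ^+ 2).
  by have := bmfM (bmf_tsum bh) (bmf_tsum bh).
rewrite (Rint_ins1 nu i bsq).
have m1 := tprod_mass (fun j => nu (lift i j)).
have nu1 := probability_setT (nu i).
pose S := tsum (others i h).
have bS : bmf S by apply: bmf_tsum; exact: bmf_others.
have IS : \int[tprod (fun j => nu (lift i j))]_y S y = n%:R * a.
  rewrite (Rint_tsum (fun j => nu (lift i j)) (bmf_others i bh)).
  by under eq_bigr do rewrite /others hE; rewrite sumr_const card_ord mulr_natl.
have inner x : h i x ^+ 2 + (2 * (n%:R * a)) * h i x <=
    \int[tprod (fun j => nu (lift i j))]_y (tsum h (ins i x y) ^+ 2).
  rewrite (@eq_Rintegral _ _ _ _ setT (fun y => (h i x ^+ 2 + (2 * h i x) * S y) + S y * S y)); last first.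
    by move=> y _; rewrite tsum_ins -/(S y); ring.
  have b1 : bmf (fun y : n.-tuple T => (2 * h i x) * S y) by apply: bmfM => //; exact: bmf_cst.
  have b2 : bmf (fun y : n.-tuple T => h i x ^+ 2 + (2 * h i x) * S y).
    by apply: bmfD => //; exact: bmf_cst.
  rewrite RintD//; last exact: bmfM.
  rewrite RintD//; last exact: bmf_cst.
  rewrite RintC// RintZ// IS.
  have : 0 <= \int[tprod (fun j => nu (lift i j))]_y (S y * S y).
    by apply: Rintegral_ge0 => y _; rewrite -expr2 sqr_ge0.
  by lra.
have bhh : bmf (fun x => h i x ^+ 2) by have := bmfM (bh i) (bh i).
have b3 : bmf (fun x => (2 * (n%:R * a)) * h i x) by apply: bmfM => //; exact: bmf_cst.
apply: (@le_trans _ _ (\int[nu i]_x (h i x ^+ 2 + (2 * (n%:R * a)) * h i x))).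
  rewrite RintD// RintZ// -/a lerDl.
  by rewrite -mulrA -mulrA mulr_ge0// mulr_ge0// -expr2 sqr_ge0.
by apply: (Rint_le nu1 (bmfD bhh b3) (bmf_Rint_ins1 nu i bsq)).
Qed.

(** Strong monotonicity: up to the constant 1, [rho] is the gradient of a convex
    functional of the potentials, uniformly convex on bounded sets once the
    zero-sum constants have been fixed by balancing the means. *)
Lemma stability B : exists2 C : R, 0 < C & forall nu phi psi,
  family phi -> family psi -> bounded_by B phi -> bounded_by B psi ->
  (forall i j, \int[nu i]_x phi i x = \int[nu j]_x phi j x) ->
  (forall i j, \int[nu i]_x psi i x = \int[nu j]_x psi j x) ->
  \sum_i \int[nu i]_x ((phi i x - psi i x) ^+ 2) <=
  C * \sum_i \int[nu i]_x ((rho nu phi i x - rho nu psi i x) ^+ 2).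
Proof.
pose N : R := n.+1%:R.
pose kap : R := expR (- (N * B + l)).
have kap0 : 0 < kap by exact: expR_gt0.
have N0 : 0 < N by rewrite ltr0n.
exists ((N / kap) ^+ 2); first by rewrite exprn_gt0// divr_gt0.
move=> nu phi psi bphi bpsi Bphi Bpsi mphi mpsi.
have nu1 i := probability_setT (nu i).
have m1 := tprod_mass (fun j => nu j).
pose h := fun i x => phi i x - psi i x.
have bh : family h by move=> i; exact: bmfB.
have bhh i : bmf (fun x => h i x ^+ 2) by have := bmfM (bh i) (bh i).
pose g := fun i x => rho nu phi i x - rho nu psi i x.
have bg i : bmf (g i) by apply: bmfB; exact: bmf_rho.
have bgg i : bmf (fun x => g i x ^+ 2) by have := bmfM (bg i) (bg i).
have bsq : bmf (fun t => tsum h t ^+ 2) by have := bmfM (bmf_tsum bh) (bmf_tsum bh).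
set Q := \int[tprod (fun j => nu j)]_t (tsum h t ^+ 2).
have hmean i j : \int[nu j]_x h j x = \int[nu i]_x h i x.
  by rewrite /h (RintB (nu1 j) (bphi j) (bpsi j)) (RintB (nu1 i) (bphi i) (bpsi i)) (mphi j i) (mpsi j i).
have H1 : \sum_i \int[nu i]_x (h i x ^+ 2) <= N * Q.
  apply: (@le_trans _ _ (\sum_(i < n.+1) Q)).
    by apply: ler_sum => i _; exact: le_Rint_tsum_sqr.
  by rewrite sumr_const card_ord mulr_natl.
have H2 : kap * Q <= \sum_i \int[nu i]_x (h i x * g i x).
  have -> : \sum_i \int[nu i]_x (h i x * g i x) =
     \int[tprod (fun j => nu j)]_t (tsum h t *
       (expR (tsum phi t) * E (mat t) - expR (tsum psi t) * E (mat t))).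
    transitivity (\sum_i \int[tprod (fun j => nu j)]_t (h i (tnth t i) *
       (expR (tsum phi t) * E (mat t) - expR (tsum psi t) * E (mat t)))).
      apply: eq_bigr => i _.
      under eq_Rintegral do rewrite mulrBr.
      under [in RHS]eq_Rintegral do rewrite mulrBr.
      have bhi : bmf (fun t : n.+1.-tuple T => h i (tnth t i)).
        by apply: bmf_comp (bh i); exact: measurable_tnth.
      rewrite (RintB (nu1 i) (bmfM (bh i) (bmf_rho nu i bphi)) (bmfM (bh i) (bmf_rho nu i bpsi))).
      rewrite (RintB m1 (bmfM bhi (bmf_density bphi)) (bmfM bhi (bmf_density bpsi))).
      by rewrite !Rint_density.
    rewrite -(Rint_sum m1); first by apply: eq_Rintegral => t _; rewrite -mulr_suml.
    move=> i; apply: bmfM; first by apply: bmf_comp (bh i); exact: measurable_tnth.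
    by apply: bmfB; exact: bmf_density.
  rewrite -(RintZ m1 kap bsq); apply: (Rint_le m1 (bmfM (bmf_cst _ kap) bsq)
    (bmfM (bmf_tsum bh) (bmfB (bmf_density bphi) (bmf_density bpsi)))) => t.
  rewrite tsumB /kap opprD expRD.
  set D := tsum phi t - tsum psi t.
  have -> : expR (- (N * B)) * expR (- l) * D ^+ 2 = (expR (- (N * B)) * D ^+ 2) * expR (- l).
    by ring.
  rewrite -mulrBl [leRHS]mulrA ler_pM ?El ?expR_ge0//.
    by rewrite mulr_ge0 ?expR_ge0// sqr_ge0.
  apply: expR_monotone.
    by have := tsum_bound t Bphi; rewrite ler_norml => /andP[].
  by have := tsum_bound t Bpsi; rewrite ler_norml => /andP[].
pose c := N / kap.
have c0 : 0 < c by rewrite divr_gt0.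
(* Young's inequality, with the weight [c] for which the sum of the [h i x ^+ 2]
   can be absorbed. *)
have H3 : c * \sum_i \int[nu i]_x (h i x * g i x) <=
    2^-1 * \sum_i \int[nu i]_x (h i x ^+ 2) + 2^-1 * (c ^+ 2 * \sum_i \int[nu i]_x (g i x ^+ 2)).
  rewrite !mulr_sumr -big_split/=; apply: ler_sum => i _.
  have bhg : bmf (fun x => h i x * g i x) by exact: bmfM.
  have bc (f : T -> R) (u : R) : bmf f -> bmf (fun x => u * f x) by move=> bf; apply: bmfM => //; exact: bmf_cst.
  rewrite mulrA -(RintZ (nu1 i) c bhg) -(RintZ (nu1 i) _ (bhh i)) -(RintZ (nu1 i) _ (bgg i)).
  rewrite -(RintD (nu1 i) (bc _ _ (bhh i)) (bc _ _ (bgg i))).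
  apply: (Rint_le (nu1 i) (bc _ _ bhg) (bmfD (bc _ _ (bhh i)) (bc _ _ (bgg i)))).
  move=> x; have := sqr_ge0 (h i x - c * g i x); rewrite sqrrB exprMn.
  by move: (h i x) (g i x) => u v; nra.
have H4 : N * Q <= c * (kap * Q).
  by rewrite /c mulrA divfK ?gt_eqF.
have H5 : c * (kap * Q) <= c * \sum_i \int[nu i]_x (h i x * g i x).
  by rewrite ler_wpM2l// ltW.
rewrite -/c; have := le_trans H1 (le_trans H4 (le_trans H5 H3)).
rewrite -/(h) -/(g); set X := \sum_i _; set Y := \sum_i _.
by lra.
Qed.

Lemma family_bounded phi : family phi -> exists B, bounded_by B phi.
Proof.
move=> bphi; have H i : exists M : R, forall x, `|phi i x| <= M by have [] := bphi i.
have [F HF] := choice H; exists (\sum_i `|F i|) => i x.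
rewrite (bigD1 i)//=; apply: (le_trans (HF i x)); apply: (le_trans (ler_norm _)).
by rewrite lerDl sumr_ge0.
Qed.

Lemma bmf_ln_avg mu phi i : family phi -> bmf (fun x => ln (avg mu phi i x)).
Proof.
move=> bphi; have [B BB] := family_bounded bphi.
apply: (@bmf_ln _ _ _ _ (expR (- (n%:R * B + l)))); first exact: expR_gt0.
- by move=> x; have /andP[] := avg_bound mu i x bphi BB.
- exact: bmf_avg.
Qed.

Lemma ln_rho mu phi i x : family phi -> ln (rho mu phi i x) = phi i x + ln (avg mu phi i x).
Proof. by move=> bphi; rewrite /rho lnM ?posrE ?expR_gt0 ?avg_gt0// expRK. Qed.

Lemma rho_gt0 mu phi i x : family phi -> 0 < rho mu phi i x.
Proof. by move=> bphi; rewrite mulr_gt0 ?expR_gt0 ?avg_gt0. Qed.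

(** The dual functional of entropic transport, with the opposite sign. Its
    gradient in [phi i] is [rho i - 1], so its minimisers solve the system. *)
Definition energy mu phi : R :=
  \int[tprod (fun j => mu j)]_t (expR (tsum phi t) * E (mat t)) -
  \sum_i \int[mu i]_x phi i x.

(** One step of the Sinkhorn algorithm. *)
Definition sinkhorn mu phi i : I -> T -> R :=
  fun j => if j == i then (fun x => - ln (avg mu phi i x)) else phi j.

Lemma family_sinkhorn mu phi i : family phi -> family (sinkhorn mu phi i).
Proof.
move=> bphi j; rewrite /sinkhorn; case: eqP => _; last exact: bphi.
by apply: bmfN; exact: bmf_ln_avg.
Qed.

Lemma avg_sinkhorn mu phi i : avg mu (sinkhorn mu phi i) i = avg mu phi i.
Proof.
rewrite /avg (_ : others i (sinkhorn mu phi i) = others i phi)//.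
by apply/funext => j; rewrite /others /sinkhorn eq_sym (negbTE (neq_lift _ _)).
Qed.

Lemma rho_sinkhorn mu phi i x : family phi -> rho mu (sinkhorn mu phi i) i x = 1.
Proof.
move=> bphi; rewrite /rho avg_sinkhorn /sinkhorn eqxx expRN lnK ?posrE ?avg_gt0//.
by rewrite mulVf// gt_eqF// avg_gt0.
Qed.

Lemma mass_rho mu phi i : family phi ->
  \int[tprod (fun j => mu j)]_t (expR (tsum phi t) * E (mat t)) =
  \int[mu i]_x rho mu phi i x.
Proof.
move=> bphi; have := Rint_density mu i bphi (bmf_cst _ 1).
under eq_Rintegral do rewrite mul1r.
by under [in X in _ = X]eq_Rintegral do rewrite mul1r.
Qed.

Lemma mass_sinkhorn mu phi i : family phi ->
  \int[tprod (fun j => mu j)]_t (expR (tsum (sinkhorn mu phi i) t) * E (mat t)) = 1.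
Proof.
move=> bphi; rewrite (mass_rho mu i (family_sinkhorn mu i bphi)).
under eq_Rintegral do rewrite rho_sinkhorn//.
by rewrite RintC//; exact: probability_setT.
Qed.

(** The step subtracts [ln (rho i)] from the [i]-th potential and makes the total
    mass equal to 1. *)
Lemma energy_sinkhorn mu phi i : family phi ->
  energy mu phi - energy mu (sinkhorn mu phi i) =
  \int[mu i]_x (rho mu phi i x - 1 - ln (rho mu phi i x)).
Proof.
move=> bphi; rewrite /energy mass_sinkhorn// (mass_rho mu i bphi).
have mu1 := probability_setT (mu i).
have bl := bmf_ln_avg mu i bphi.
have br := bmf_rho mu i bphi.
rewrite (bigD1 i)//= [in X in _ - X](bigD1 i)//=.
rewrite [in X in _ - X](eq_bigr (fun j => \int[mu j]_x phi j x)); last first.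
  by move=> j ji; rewrite /sinkhorn (negbTE ji).
under [in RHS]eq_Rintegral do rewrite ln_rho//.
rewrite (RintB mu1 (bmfB br (bmf_cst _ 1)) (bmfD (bphi i) bl)) (RintB mu1 br (bmf_cst _ 1)).
rewrite (RintD mu1 (bphi i) bl) RintC//.
have -> : \int[mu i]_x sinkhorn mu phi i i x = - \int[mu i]_x ln (avg mu phi i x).
  rewrite /sinkhorn eqxx -mulN1r -(RintZ mu1 _ bl).
  by apply: eq_Rintegral => x _; rewrite mulN1r.
by ring.
Qed.

Lemma energy_sinkhorn_le mu phi i : family phi ->
  energy mu (sinkhorn mu phi i) <= energy mu phi.
Proof.
move=> bphi; rewrite -subr_ge0 energy_sinkhorn//; apply: Rintegral_ge0 => x _.
have r0 := rho_gt0 mu i x bphi.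
have := @le_ln1Dx R (rho mu phi i x - 1); rewrite [1 + _]addrC subrK => H.
by rewrite subr_ge0 H// ltrBrDl subrr.
Qed.

(** The gain of a step is the integral of [u - 1 - ln u] with [u = rho], which
    is comparable to [(u - 1) ^+ 2] as long as [u] is bounded: in terms of
    [r = sqrt u] it is at least [(r - 1) ^+ 2], because [ln r <= r - 1]. *)
Lemma residual_energy B : exists2 C : R, 0 < C & forall mu phi i,
  family phi -> bounded_by B phi ->
  \int[mu i]_x ((rho mu phi i x - 1) ^+ 2) <=
  C * (energy mu phi - energy mu (sinkhorn mu phi i)).
Proof.
pose U : R := n.+1%:R * B + l.
exists ((expR U + 2) ^+ 2); first by rewrite exprn_gt0// ltr_wpDl// expR_ge0.
move=> mu phi i bphi BB; rewrite energy_sinkhorn//.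
have mu1 := probability_setT (mu i).
have br := bmf_rho mu i bphi.
have bln : bmf (fun x => ln (rho mu phi i x)).
  have := bmfD (bphi i) (bmf_ln_avg mu i bphi); congr bmf; apply/funext => x.
  by rewrite ln_rho.
have bd := bmfB (bmfB br (bmf_cst _ 1)) bln.
rewrite -(RintZ mu1 _ bd); apply: (Rint_le mu1 _ (bmfM (bmf_cst _ _) bd)).
  by have := bmfM (bmfB br (bmf_cst _ 1)) (bmfB br (bmf_cst _ 1)).
move=> x; set u := ln (rho mu phi i x); pose r := expR (u / 2).
have r0 : 0 < r by exact: expR_gt0.
have rE : rho mu phi i x = r ^+ 2.
  by rewrite /r expr2 -expRD -splitr /u lnK// posrE rho_gt0.
have ru : u / 2 <= r - 1 by have := expR_ge1Dx (u / 2); rewrite -/r; lra.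
have rU : r <= expR U + 1.
  have [r1|r1] := leP r 1; first by rewrite (le_trans r1)// lerDr expR_ge0.
  have rr : r <= r ^+ 2 by rewrite expr2 ler_peMl// ltW.
  apply: le_trans rr _; rewrite -rE /rho.
  have /andP[_ a1] := avg_bound mu i x bphi BB.
  have p1 : expR (phi i x) <= expR B.
    by rewrite ler_expR (le_trans (ler_norm _))//; exact: BB.
  apply: (@le_trans _ _ (expR B * expR (n%:R * B + l))).
    by apply: ler_pM; rewrite ?expR_ge0// ltW// avg_gt0.
  rewrite -expRD /U -addn1 natrD mulrDl mul1r addrCA addrA.
  by rewrite lerDl.
rewrite rE; have -> : (r ^+ 2 - 1) ^+ 2 = (r + 1) ^+ 2 * (r - 1) ^+ 2 by ring.
clear mu1.
apply: ler_pM; rewrite ?sqr_ge0//.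
  by rewrite lerXn2r ?nnegrE; lra.
by rewrite sqrrB expr1n; lra.
Qed.

(** [exp s >= 1 + s] with [s = tsum phi + ln E]. *)
Lemma energy_lower_bound mu phi : family phi -> 1 - l <= energy mu phi.
Proof.
move=> bphi; rewrite /energy -(Rint_tsum mu bphi).
have m1 := tprod_mass mu.
have bd := bmf_density bphi; have bs := bmf_tsum bphi.
rewrite -(RintB m1 bd bs).
rewrite -(RintC m1 (1 - l)); apply: (Rint_le m1 (bmf_cst _ _) (bmfB bd bs)) => t.
clear m1; have E0 := E_gt0 (mat t).
have lE : - l <= ln (E (mat t)) by rewrite -ler_expR lnK ?posrE.
rewrite -{1}[E (mat t)](lnK (x := E (mat t))) ?posrE// -expRD.
by have := expR_ge1Dx (tsum phi t + ln (E (mat t))); lra.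
Qed.

(** An updated potential is the opposite of the logarithm of an average, whose
    oscillation is at most [2 * l], and it is not modified by the later steps on
    other coordinates. *)
Lemma sinkhorn_sweep mu (s : seq I) phi : family phi -> exists psi,
  [/\ family psi, energy mu psi <= energy mu phi,
   (forall i, i \in s -> forall x x', `|psi i x - psi i x'| <= 2 * l) &
   s != [::] -> \int[tprod (fun j => mu j)]_t (expR (tsum psi t) * E (mat t)) = 1].
Proof.
move=> bphi; elim: s => [|i s [psi [bpsi epsi opsi _]]]; first by exists phi.
exists (sinkhorn mu psi i); split.
- exact: family_sinkhorn.
- exact: le_trans (energy_sinkhorn_le mu i bpsi) epsi.
- move=> j; rewrite inE /sinkhorn => jis x x'; case: eqP jis => [_ _|_ /= /opsi//].
  by rewrite -opprD normrN ln_avg_osc.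
- by move=> _; exact: mass_sinkhorn.
Qed.

(** Each potential stays close to its mean by the bound on its oscillation.
    Zero-sum constants make these means equal, and their common value is bounded
    because the total mass is 1. *)
Lemma balance mu nu phi : family phi ->
  (forall i x x', `|phi i x - phi i x'| <= 2 * l) ->
  \int[tprod (fun j => mu j)]_t (expR (tsum phi t) * E (mat t)) = 1 ->
  exists kappa : I -> R, [/\ \sum_i kappa i = 0,
    bounded_by (5 * l) (fun i x => phi i x + kappa i) &
    forall i j, \int[nu i]_x (phi i x + kappa i) = \int[nu j]_x (phi j x + kappa j)].
Proof.
move=> bphi osc mass.
have nu1 i := probability_setT (nu i).
have m1 := tprod_mass mu.
pose m i := \int[nu i]_x phi i x.
pose N : R := n.+1%:R.
have N0 : 0 < N by rewrite ltr0n.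
have N1 : 1 <= N by rewrite ler1n.
pose a : R := (\sum_i m i) / N.
have mean i x : `|phi i x - m i| <= 2 * l.
  rewrite -(RintC (nu1 i) (phi i x)) -(RintB (nu1 i) (bmf_cst _ _) (bphi i)).
  by apply: (Rint_norm_le (nu1 i) (bmfB (bmf_cst _ _) (bphi i))) => y; exact: osc.
have sum0 : \sum_i (a - m i) = 0.
  by rewrite sumrB sumr_const card_ord -mulr_natr /a divfK ?gt_eqF// subrr.
have tsumE t : tsum (fun i x => phi i x + (a - m i)) t = tsum phi t.
  by rewrite /tsum big_split/= sum0 addr0.
have near_a i x : `|(phi i x + (a - m i)) - a| <= 2 * l.
  by rewrite (_ : _ - a = phi i x - m i)//; ring.
have tsumB' t : `|tsum phi t - N * a| <= N * (2 * l).
  have := tsum_bound t near_a; congr (_ <= _); congr `|_|.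
  by rewrite -tsumE /tsum sumrB sumr_const card_ord /N mulr_natl.
have l0 := l_ge0.
have bd := bmf_density bphi.
have a3 : `|a| <= 3 * l.
  have /andP[H1 H2] : expR (N * a - N * (2 * l) - l) <=
      \int[tprod (fun j => mu j)]_t (expR (tsum phi t) * E (mat t)) <=
      expR (N * a + N * (2 * l) + l).
    apply: (Rint_bounds m1 bd) => t.
    have := tsumB' t; rewrite ler_norml => /andP[t1 t2].
    rewrite [expR (_ - l)]expRD [expR (_ + l)]expRD.
    apply/andP; split; apply: ler_pM; rewrite ?expR_ge0 ?El ?E_le ?(ltW (E_gt0 _))//.
      by rewrite ler_expR; move: t1; clear; lra.
    by rewrite ler_expR; move: t2; clear; lra.
  have {}H1 : N * a - N * (2 * l) - l <= 0.
    by rewrite -ler_expR expR0 (le_trans H1)// mass.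
  have {}H2 : 0 <= N * a + N * (2 * l) + l.
    by rewrite -ler_expR expR0 (le_trans _ H2)// mass.
  have lN : l <= N * l by rewrite ler_peMl.
  clear -H1 H2 N0 lN; rewrite ler_norml; apply/andP; split; rewrite -(ler_pM2l N0); lra.
exists (fun i => a - m i); split=> //.
  move=> i x; have := near_a i x; move: a3; rewrite !ler_norml.
  by move: (phi i x + (a - m i)) => z /andP[? ?] /andP[? ?]; apply/andP; split; lra.
have meanE i : \int[nu i]_x (phi i x + (a - m i)) = a.
  by rewrite (RintD (nu1 i) (bphi i) (bmf_cst _ _)) (RintC (nu1 i)) -/(m i) addrC subrK.
by move=> i j; rewrite !meanE.
Qed.

Lemma family_shift phi (kappa : I -> R) : family phi -> family (fun i x => phi i x + kappa i).
Proof. by move=> bphi i; apply: bmfD => //; exact: bmf_cst. Qed.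

Lemma tsum_shift phi (kappa : I -> R) t : \sum_i kappa i = 0 ->
  tsum (fun i x => phi i x + kappa i) t = tsum phi t.
Proof. by move=> k0; rewrite /tsum big_split/= k0 addr0. Qed.

Lemma energy_shift mu phi (kappa : I -> R) : family phi -> \sum_i kappa i = 0 ->
  energy mu (fun i x => phi i x + kappa i) = energy mu phi.
Proof.
move=> bphi k0; rewrite /energy.
under eq_Rintegral do rewrite tsum_shift//.
have -> // : \sum_i \int[mu i]_x (phi i x + kappa i) = \sum_i \int[mu i]_x phi i x.
transitivity (\sum_i (\int[mu i]_x phi i x + kappa i)); last first.
  by rewrite big_split/= k0 addr0.
apply: eq_bigr => i _; have mu1 := probability_setT (mu i).
by rewrite (RintD mu1 (bphi i) (bmf_cst _ _)) RintC.
Qed.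

(** At a near minimiser a further step of the algorithm gains little, so the
    residuals are small. Near minimality does not bound the potentials: the sweep
    that precedes the step does. *)
Lemma near_solution mu (eps : R) : 0 < eps -> exists phi,
  [/\ family phi, bounded_by (5 * l) phi,
    (forall i j, \int[mu i]_x phi i x = \int[mu j]_x phi j x) &
    forall i, \int[mu i]_x ((rho mu phi i x - 1) ^+ 2) <= eps].
Proof.
move=> eps0; have [C C0 HC] := residual_energy (5 * l).
pose S := [set energy mu phi | phi in [set phi | family phi]].
have S0 : S !=set0.
  by exists (energy mu (fun _ _ => 0)); exists (fun _ _ => 0) => // i; exact: bmf_cst.
have hS : has_inf S.
  split=> //; exists (1 - l) => _ [phi bphi <-]; exact: energy_lower_bound.
have e0 : 0 < eps / C by rewrite divr_gt0.
have [_ [phi0 bphi0 <-] Hphi0] := inf_adherent e0 hS.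
have [phi1 [bphi1 ephi1 ophi1 mass1]] := sinkhorn_sweep mu (enum 'I_n.+1) bphi0.
have [||kappa [k0 bk mk]] := @balance mu mu phi1 bphi1.
- by move=> i x x'; apply: ophi1; rewrite mem_enum.
- by apply: mass1; rewrite -size_eq0 size_enum_ord.
pose phi := fun i x => phi1 i x + kappa i.
have bphi : family phi by exact: family_shift.
exists phi; split=> // i.
apply: (le_trans (HC mu phi i bphi bk)); rewrite -ler_pdivlMl// mulrC.
rewrite lerBlDl; apply: (@le_trans _ _ (inf S + eps / C)).
  by rewrite energy_shift// (le_trans ephi1)// ltW.
rewrite lerD2r; apply: ge_inf; last by exists (sinkhorn mu phi i) => //; exact: family_sinkhorn.
by case: hS.
Qed.

Lemma avgB B mu phi psi i x : family phi -> family psi ->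
  bounded_by B phi -> bounded_by B psi ->
  `|avg mu phi i x - avg mu psi i x| <=
  expR l * expR (n%:R * B) * \sum_j \int[mu j]_z `|phi j z - psi j z|.
Proof.
move=> bphi bpsi Bphi Bpsi.
have m1 := tprod_mass (fun j => mu (lift i j)).
have := avg_increment mu i x bphi bpsi Bphi Bpsi Ec; congr (`|_| <= _).
rewrite /avg -(RintB m1 (bmf_avg_integrand i x bphi) (bmf_avg_integrand i x bpsi)).
by apply: eq_Rintegral => y _; rewrite mulrBl.
Qed.

Lemma Rint_abs_le (m : probability T R) (h : T -> R) (c : R) : bmf h -> 0 <= c ->
  \int[m]_x (h x ^+ 2) <= c ^+ 2 -> \int[m]_x `|h x| <= c.
Proof.
move=> bh c0 hc; have m1 := probability_setT m.
rewrite -ler_sqr ?nnegrE//; last exact: Rintegral_ge0.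
apply: le_trans (Rint_sqr m1 (bmf_norm bh)) _.
by under eq_Rintegral do rewrite real_normK ?num_real//.
Qed.

Lemma le_harmonic (u v K : R) : (forall k : nat, u <= v + K * k.+1%:R^-1) -> u <= v.
Proof.
move=> H; rewrite leNgt; apply/negP => vu.
have K1 : 0 < `|K| + 1 by rewrite ltr_wpDl.
have [k] : exists k : nat, v / (`|K| + 1) + k.+1%:R^-1 < u / (`|K| + 1).
  by apply: ltr_add_invr; rewrite ltr_pM2r ?invr_gt0.
rewrite ltr_pdivlMr// mulrDl divfK ?gt_eqF// => Hk.
have := lt_le_trans Hk (H k); rewrite ltrD2l mulrC ltr_pM2r ?invr_gt0//.
by rewrite ltNge (le_trans (ler_norm K))// lerDl.
Qed.

Section limit_of_near_solutions.
Variables (mu : I -> probability T R) (phi : nat -> I -> T -> R).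
Let B : R := 5 * l.
Let eta (k : nat) : R := k.+1%:R^-1.
Hypothesis bphi : forall k, family (phi k).
Hypothesis Bphi : forall k, bounded_by B (phi k).
Hypothesis mphi : forall k i j, \int[mu i]_x phi k i x = \int[mu j]_x phi k j x.
Hypothesis rphi : forall k i,
  \int[mu i]_x ((rho mu (phi k) i x - 1) ^+ 2) <= eta k ^+ 2.

Let mu1 i : mu i setT = 1%E. Proof. exact: probability_setT. Qed.

Let eta0 k : 0 < eta k. Proof. by rewrite invr_gt0. Qed.

Let L1_cauchy : exists2 K : R, 0 <= K & forall k k' i,
  \int[mu i]_x `|phi k i x - phi k' i x| <= K * (eta k + eta k').
Proof.
have [C C0 stab] := stability B.
pose N : R := n.+1%:R; have N0 : 0 < N by rewrite ltr0n.
pose K : R := 1 + 2 * N * C.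
have NC : 0 < N * C by rewrite mulr_gt0.
have K1 : 1 <= K by rewrite /K; lra.
exists K; first exact: le_trans ler01 K1.
move=> k k' i; have bh := bmfB (bphi k i) (bphi k' i).
apply: Rint_abs_le => //.
  by rewrite mulr_ge0 ?(le_trans ler01 K1)// addr_ge0// ltW.
apply: (@le_trans _ _ (\sum_j \int[mu j]_x ((phi k j x - phi k' j x) ^+ 2))).
  rewrite (bigD1 i)//= lerDl sumr_ge0// => j _.
  by apply: Rintegral_ge0 => x _; rewrite sqr_ge0.
apply: le_trans (stab mu _ _ (bphi k) (bphi k') (Bphi k) (Bphi k') (mphi k) (mphi k')) _.
apply: (@le_trans _ _ (C * \sum_(j < n.+1) (2 * (eta k ^+ 2 + eta k' ^+ 2)))).
  apply: (ler_wpM2l (ltW C0)); apply: ler_sum => j _.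
  have br q := bmfB (bmf_rho mu j (bphi q)) (bmf_cst _ 1).
  have brr q : bmf (fun x => (rho mu (phi q) j x - 1) ^+ 2) by have := bmfM (br q) (br q).
  have bs := bmfD (brr k) (brr k').
  apply: (@le_trans _ _ (\int[mu j]_x (2 * ((rho mu (phi k) j x - 1) ^+ 2 +
      (rho mu (phi k') j x - 1) ^+ 2)))).
    apply: (Rint_le (mu1 j) _ (bmfM (bmf_cst _ 2) bs)).
      have bd := bmfB (bmf_rho mu j (bphi k)) (bmf_rho mu j (bphi k')).
      by have := bmfM bd bd.
    move=> x; have := sqr_ge0 (rho mu (phi k) j x - 1 + (rho mu (phi k') j x - 1)).
    by move: (rho mu (phi k) j x) (rho mu (phi k') j x) => u v; nra.
  rewrite (RintZ (mu1 j) _ bs) (RintD (mu1 j) (brr k) (brr k')).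
  by rewrite ler_wpM2l// lerD// rphi.
rewrite sumr_const card_ord -[_ *+ n.+1]mulr_natl -/N exprMn.
have ek := eta0 k; have ek' := eta0 k'.
have -> : C * (N * (2 * (eta k ^+ 2 + eta k' ^+ 2))) =
    (2 * N * C) * (eta k ^+ 2 + eta k' ^+ 2) by ring.
apply: ler_pM.
- by rewrite -mulrA mulr_ge0// ltW.
- by rewrite addr_ge0// sqr_ge0.
- apply: (@le_trans _ _ K); first by rewrite /K lerDr.
  by rewrite expr2 ler_peMl// (le_trans ler01).
- by rewrite sqrrD addrAC lerDl mulrn_wge0// mulr_ge0// ltW.
Qed.

(** The potentials form a Cauchy sequence in L^1 only, but their averages in the
    uniform norm; the solution is built from the limit of the averages, so that
    it satisfies the system at every point. *)
Lemma near_solutions_converge : exists psi, family psi /\ forall i x, rho mu psi i x = 1.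
Proof.
have [K1 K10 HK1] := L1_cauchy.
pose N : R := n.+1%:R.
pose a k i x := avg mu (phi k) i x.
pose K2 : R := expR l * expR (n%:R * B) * (N * K1).
have K20 : 0 <= K2 by rewrite mulr_ge0 ?mulr_ge0 ?expR_ge0// ler0n.
have Ha k k' i x : `|a k i x - a k' i x| <= K2 * (eta k + eta k').
  apply: le_trans (avgB mu i x (bphi k) (bphi k') (Bphi k) (Bphi k')) _.
  rewrite /K2 -[leRHS]mulrA ler_wpM2l ?mulr_ge0 ?expR_ge0//.
  apply: (@le_trans _ _ (\sum_(j < n.+1) K1 * (eta k + eta k'))).
    by apply: ler_sum => j _; exact: HK1.
  by rewrite sumr_const card_ord -mulr_natl -/N mulrA.
(* The uniform limit of the averages, as the supremum of its lower estimates. *)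
pose S i x := [set a k i x - K2 * eta k | k in [set: nat]].
pose ainf i x := sup (S i x).
have aub i x k' : ubound (S i x) (a k' i x + K2 * eta k').
  move=> _ [k _ <-]; have := Ha k k' i x; rewrite ler_norml => /andP[_].
  rewrite mulrDr; clear.
  by move: (a k i x) (a k' i x) (K2 * eta k) (K2 * eta k') => ? ? ? ?; lra.
have ainfP k i x : `|a k i x - ainf i x| <= K2 * eta k.
  have H1 : a k i x - K2 * eta k <= ainf i x.
    by apply: ub_le_sup; [exists (a 0 i x + K2 * eta 0); exact: aub|exists k].
  have H2 : ainf i x <= a k i x + K2 * eta k.
    by apply: ge_sup; [exists (a 0 i x - K2 * eta 0); exists 0%N|exact: aub].
  by rewrite ler_norml; lra.
pose U : R := n%:R * B + l.
have aU k i x : expR (- U) <= a k i x <= expR U by exact: avg_bound.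
have infU i x : expR (- U) <= ainf i x <= expR U.
  apply/andP; split; apply: (@le_harmonic _ _ K2) => k.
    have := ainfP k i x; have /andP[+ _] := aU k i x; rewrite ler_norml -/(eta k).
    by move=> ? /andP[? ?]; lra.
  have := ainfP k i x; have /andP[_] := aU k i x; rewrite ler_norml -/(eta k).
  by move=> ? /andP[? ?]; lra.
have minf i : bmf (ainf i).
  split; last first.
    exists (expR U) => x; have /andP[u1 u2] := infU i x.
    by rewrite ger0_norm// (le_trans _ u1)// expR_ge0.
  apply: (measurable_fun_cvg (h := fun k => a k i)).
    by move=> k; case: (bmf_avg mu i (bphi k)).
  have K2p : 0 < K2 + 1 by rewrite ltr_wpDl.
  move=> x _; apply/cvgrPdist_le => e e0; near=> k.
  rewrite distrC (le_trans (ainfP k i x))//.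
  have : eta k <= e / (K2 + 1).
    near: k; have := @cvg_harmonic R; move/cvgrPdist_le => /(_ _ (divr_gt0 e0 K2p)).
    apply: filterS => k.
    by rewrite sub0r normrN ger0_norm// ?ltW//; exact: eta0.
  rewrite ler_pdivlMr// => H; apply: le_trans H.
  by rewrite mulrDr mulr1 mulrC lerDl ltW.
pose psi i x := - ln (ainf i x).
have U0 : 0 < expR (- U) by exact: expR_gt0.
have bpsi : family psi.
  move=> i; apply: bmfN; apply: (bmf_ln U0) (minf i) => x.
  by have /andP[] := infU i x.
pose B' : R := `|B| + `|U|.
have Bpsi : bounded_by B' psi.
  move=> i x; rewrite normrN; have /andP[u1 u2] := infU i x.
  apply: (le_trans (ln_bounds u1 u2)); apply: (le_trans (ler_norm _)).
  by rewrite lerDr.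
have Bphi' k : bounded_by B' (phi k).
  move=> i x; apply: (le_trans (Bphi k i x)); apply: (le_trans (ler_norm _)).
  by rewrite lerDl.
pose b2 : R := expR (- (`|B| + `|U|)).
have b20 : 0 < b2 by exact: expR_gt0.
pose K3 : R := (expR (- U))^-1 * K2 + b2^-1.
have K30 : 0 <= K3 by rewrite addr_ge0 ?mulr_ge0 ?invr_ge0// ltW.
have psiphi k j : \int[mu j]_z `|psi j z - phi k j z| <= K3 * eta k.
  have br := bmf_norm (bmfB (bmf_rho mu j (bphi k)) (bmf_cst _ 1)).
  have bI := bmfD (bmf_cst T ((expR (- U))^-1 * K2 * eta k)) (bmfM (bmf_cst _ b2^-1) br).
  apply: (@le_trans _ _ (\int[mu j]_z ((expR (- U))^-1 * K2 * eta k +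
      b2^-1 * `|rho mu (phi k) j z - 1|))).
    apply: (Rint_le (mu1 j) (bmf_norm (bmfB (bpsi j) (bphi k j))) bI) => z.
    have /andP[i1 i2] := infU j z; have /andP[a1 a2] := aU k j z.
    have -> : psi j z - phi k j z =
        (ln (a k j z) - ln (ainf j z)) - (ln (rho mu (phi k) j z) - ln 1).
      by rewrite ln1 subr0 ln_rho// /psi -/(a k j z); ring.
    apply: (le_trans (ler_normB _ _)); apply: lerD.
      apply: (le_trans (ln_lipschitz U0 a1 i1)).
      by rewrite -mulrA; apply: ler_wpM2l; [rewrite invr_ge0 ltW|exact: ainfP].
    apply: (ln_lipschitz b20); last first.
      by rewrite /b2 -expR0 ler_expR oppr_le0 addr_ge0.
    rewrite /rho /b2 opprD expRD; apply: ler_pM; rewrite ?expR_ge0//.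
      rewrite ler_expR; have := Bphi k j z; rewrite ler_norml => /andP[+ _].
      by apply: le_trans; rewrite lerN2 ler_norm.
    by apply: le_trans a1; rewrite ler_expR lerN2 ler_norm.
  rewrite (RintD (mu1 j) (bmf_cst _ _) (bmfM (bmf_cst _ _) br)) (RintC (mu1 j)).
  rewrite (RintZ (mu1 j) _ br) /K3 mulrDl lerD2l ler_wpM2l ?invr_ge0 ?(ltW b20)//.
  apply: Rint_abs_le; last exact: rphi.
  - by apply: bmfB; [exact: bmf_rho|exact: bmf_cst].
  - exact: ltW.
exists psi; split=> // i x.
have avgE : avg mu psi i x = ainf i x.
  pose K4 : R := expR l * expR (n%:R * B') * (N * K3).
  have H k : `|avg mu psi i x - a k i x| <= K4 * eta k.
    apply: le_trans (avgB mu i x bpsi (bphi k) Bpsi (Bphi' k)) _.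
    rewrite /K4 -[leRHS]mulrA ler_wpM2l ?mulr_ge0 ?expR_ge0//.
    apply: (@le_trans _ _ (\sum_(j < n.+1) K3 * eta k)).
      by apply: ler_sum => j _; exact: psiphi.
    by rewrite sumr_const card_ord -mulr_natl -/N mulrA.
  apply/eqP; rewrite eq_le; apply/andP; split; apply: (@le_harmonic _ _ (K4 + K2)) => k;
    have := H k; have := ainfP k i x; rewrite !ler_norml -/(eta k) mulrDl;
    move=> /andP[? ?] /andP[? ?]; lra.
have /andP[i1 _] := infU i x; have i0 := lt_le_trans U0 i1.
by rewrite /rho avgE /psi expRN lnK ?posrE// mulVf// gt_eqF.
Unshelve. all: by end_near. Qed.

End limit_of_near_solutions.

Lemma schrodinger_existence mu : exists psi, family psi /\ forall i x, rho mu psi i x = 1.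
Proof.
have H (k : nat) : exists phi, [/\ family phi, bounded_by (5 * l) phi,
    (forall i j, \int[mu i]_x phi i x = \int[mu j]_x phi j x) &
    forall i, \int[mu i]_x ((rho mu phi i x - 1) ^+ 2) <= k.+1%:R^-1 ^+ 2].
  by apply: near_solution; rewrite exprn_gt0// invr_gt0.
have [phi Hphi] := choice H.
by apply: (@near_solutions_converge mu phi) => k; have [] := Hphi k.
Qed.

End schrodinger_kernel.

(** * Lipschitz dependence on the measures *)

Section lipschitz_dependence.
Context {R : realType} {n d : nat}.
Local Notation T := (borelRd R d).
Local Notation I := 'I_n.+1.
Variables (E : 'M[R]_(n.+1, d) -> R) (l M : R) (k p : nat).
Hypothesis EC : Cb (k.+1 + p.+1) M E.
Hypothesis Ec : Cb 0 (expR l) E.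
Hypothesis El : forall x, expR (- l) <= E x.
Implicit Types (mu nu : I -> probability T R) (phi psi : I -> T -> R) (B : R).

Local Notation avg := (avg E).
Local Notation rho := (rho E).

Definition solves mu phi := family phi /\ forall i x, rho mu phi i x = 1.

Lemma solves_exp mu phi i x : solves mu phi -> expR (phi i x) = (avg mu phi i x)^-1.
Proof.
move=> [bphi sol]; have a0 := avg_gt0 Ec El mu i x bphi.
by rewrite -[LHS](mulfK (lt0r_neq0 a0)) -/(rho mu phi i x) sol mul1r.
Qed.

Lemma solves_ln mu phi i x : solves mu phi -> phi i x = - ln (avg mu phi i x).
Proof.
move=> sol; rewrite -[LHS]expRK (solves_exp i x sol) lnV// posrE.
have [bphi _] := sol; exact: (avg_gt0 Ec El mu i x bphi).
Qed.

Lemma rho_shift mu phi (kappa : I -> R) i x : family phi -> \sum_i kappa i = 0 ->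
  rho mu (fun i x => phi i x + kappa i) i x = rho mu phi i x.
Proof.
move=> bphi k0; rewrite /rho expRD -mulrA; congr (_ * _).
rewrite /avg -(RintZ (tprod_mass (fun j => mu (lift i j)))); last first.
  exact: (bmf_avg_integrand Ec i x (family_shift kappa bphi)).
apply: eq_Rintegral => y _; rewrite mulrA -expRD; congr (expR _ * _).
rewrite /tsum big_split/= addrCA -[RHS]addr0; congr (_ + _).
by rewrite -[RHS]k0 [RHS](bigD1_ord i).
Qed.

(** The measures [nu] of the normalisation need not be those of the system: two
    solutions are compared after both have been balanced for the same ones. *)
Lemma solves_balance mu nu phi : solves mu phi -> exists kappa : I -> R,
  let phi' := fun i x => phi i x + kappa i in
  [/\ \sum_i kappa i = 0, solves mu phi', bounded_by (5 * l) phi' &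
    forall i j, \int[nu i]_x phi' i x = \int[nu j]_x phi' j x].
Proof.
move=> sol; have [bphi rphi] := sol.
have [| |kappa [k0 bk mk]] := @balance R n d E l Ec El mu nu phi bphi.
- move=> i x x'; rewrite (solves_ln i x sol) (solves_ln i x' sol).
  by rewrite -opprD normrN; exact: (ln_avg_osc Ec El).
- rewrite (mass_rho Ec mu ord0 bphi).
  under eq_Rintegral do rewrite rphi.
  by rewrite RintC//; exact: probability_setT.
exists kappa; split; [exact: k0| |exact: bk|exact: mk]; split; first exact: family_shift.
by move=> i x; rewrite rho_shift.
Qed.

(** All the derivatives fall on the kernel, so the bound depends on the
    potentials through [B] only. *)
Lemma avg_Cb B : exists M1 : R, forall mu phi i, family phi -> bounded_by B phi ->
  Cb (k.+1 + p) M1 (avg mu phi i).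
Proof.
exists (expR (n%:R * B) * M) => mu phi i bphi BB.
have m1 := tprod_mass (fun j => mu (lift i j)).
have bs : bmf (fun y => expR (tsum (others i phi) y)).
  by apply: bmf_expR; apply: bmf_tsum; exact: bmf_others.
have sB y : `|expR (tsum (others i phi) y)| <= expR (n%:R * B).
  rewrite ger0_norm ?expR_ge0// ler_expR; apply: le_trans (ler_norm _) _.
  by apply: tsum_bound => j z; exact: BB.
have bound f (C : R) : bmf f -> (forall y, `|f y| <= C) ->
  `|\int[tprod (fun j => mu (lift i j))]_y (expR (tsum (others i phi) y) * f y)| <=
  expR (n%:R * B) * C.
  move=> bf fC; apply: (Rint_norm_le m1 (bmfM bs bf)) => y.
  by rewrite normrM ler_pM.
apply: (@Cb_under_functional R n d i
  (fun f => \int[tprod (fun j => mu (lift i j))]_y (expR (tsum (others i phi) y) * f y))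
  (expR (n%:R * B)) 0 M).
- move=> f g bf bg; rewrite -(RintB m1 (bmfM bs bf) (bmfM bs bg)).
  by apply: eq_Rintegral => y _; rewrite mulrBr.
- move=> a f bf; rewrite -(RintZ m1 a (bmfM bs bf)).
  by apply: eq_Rintegral => y _; rewrite mulrCA.
- exact: bound.
- move=> E' CE' x; apply: bound; first exact: bmf_glue CE'.
  by move=> y; exact: (Cb_bound CE').
- by rewrite addn1 -addnS.
Qed.

Lemma solves_exp_Cb B : exists M2 : R, forall mu phi i, solves mu phi -> bounded_by B phi ->
  Cb p.+1 M2 (fun x => expR (phi i x)).
Proof.
have [M1 HM1] := avg_Cb B.
have [M2 HM2] := @Cb_inv R 1 d p.+1 (expR (- (n%:R * B + l))) M1 (expR_gt0 _).
exists M2 => mu phi i sol BB; have [bphi _] := sol.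
rewrite (_ : (fun x => _) = (fun x => (avg mu phi i x)^-1)); last first.
  by apply/funext => x; exact: solves_exp.
apply: HM2; first by apply: Cb_leq (HM1 mu phi i bphi BB); rewrite addSn -addnS leq_addl.
by move=> x; have /andP[] := avg_bound Ec El mu i x bphi BB.
Qed.

Lemma solves_Ck mu phi i : solves mu phi -> Ck k.+1 (phi i).
Proof.
move=> sol; have [bphi _] := sol; have [B BB] := family_bounded bphi.
have [M1 HM1] := avg_Cb B.
pose b := expR (- (n%:R * B + l)).
pose b1 := Num.min b 1; pose M1' := Num.max M1 1.
have b10 : 0 < b1 by rewrite lt_min expR_gt0 ltr01.
have [C _ HC] := @Cb_lnB R 1 d k.+1 b1 M1' b10.
have C1 : Cb k.+1 M1' (avg mu phi i).
  apply: (@Cb_le _ _ _ _ M1); first by rewrite le_max lexx.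
  by apply: Cb_leq (HM1 mu phi i bphi BB); rewrite leq_addr.
have C2 : Cb k.+1 M1' (fun _ : 'rV[R]_d => 1 : R).
  by apply: Cb_le (Cb_cst _ 1); rewrite normr1 le_max lexx orbT.
rewrite (_ : phi i = fun x => - (ln (avg mu phi i x) - ln 1)); last first.
  by apply/funext => x; rewrite ln1 subr0; exact: solves_ln.
apply: Cb_Ck; apply: CbN; apply: HC C1 _ C2 _ (CbB C1 C2).
  move=> x; have /andP[a1 _] := avg_bound Ec El mu i x bphi BB.
  by apply: le_trans a1; rewrite ge_min lexx.
by move=> _; rewrite ge_min lexx orbT.
Qed.

Lemma glue_upd (i : I) (x : T) (t : n.-tuple T) j z :
  glue i x (upd t j z) = setrow (lift i j) z (glue i x t).
Proof.
apply/matrixP => r c; rewrite /glue !mxE.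
case: (unliftP i r) => [r'|] ->; last by rewrite (negbTE (neq_lift _ _)).
by rewrite tnth_mktuple (inj_eq lift_inj); case: eqP.
Qed.

Lemma tsum_upd (f : 'I_n -> T -> R) (t : n.-tuple T) j z :
  tsum f (upd t j z) = f j z + \sum_(l | l != j) f l (tnth t l).
Proof.
rewrite /tsum (bigD1 j)//= tnth_mktuple eqxx; congr (_ + _).
by apply: eq_bigr => r rj; rewrite tnth_mktuple (negbTE rj).
Qed.

(** The integrand of an average is smooth in each variable, because the
    potentials of a solution are, so it is a test function for each measure. *)
Lemma avg_measure B : exists2 C : R, 0 <= C & forall mu nu phi (D : I -> R) i x
    (E' : 'M[R]_(n.+1, d) -> R),
  solves mu phi -> bounded_by B phi ->
  (forall j G M', Cb p.+1 M' G -> `|\int[mu j]_x G x - \int[nu j]_x G x| <= M' * D j) ->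
  (forall j, 0 <= D j) ->
  Cb p.+1 M E' ->
  `|\int[tprod (fun j => mu (lift i j))]_y
       (expR (tsum (others i phi) y) * E' (glue i x y)) -
    \int[tprod (fun j => nu (lift i j))]_y
       (expR (tsum (others i phi) y) * E' (glue i x y))| <= C * \sum_j D j.
Proof.
have [M2 HM2] := solves_exp_Cb B.
pose M2' := Num.max M2 0.
pose C := 2 ^+ p.+1 * (M2' * (expR (n%:R * B) * M)).
have M0 := Cb_ge0 EC.
have M20 : 0 <= M2' by rewrite le_max lexx orbT.
have C0 : 0 <= C by rewrite mulr_ge0 ?exprn_ge0 ?mulr_ge0 ?expR_ge0.
exists C => // mu nu phi D i x E' sol BB HD D0 CE'.
have [bphi _] := sol.
have bF : bmf (fun y => expR (tsum (others i phi) y) * E' (glue i x y)).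
  apply: bmfM; last exact: bmf_glue CE'.
  by apply: bmf_expR; apply: bmf_tsum; exact: bmf_others.
apply: (@le_trans _ _ (\sum_(j < n) C * D (lift i j))).
  apply: (@tprod_telescope _ T R (0 : 'rV[R]_d) n (fun j => mu (lift i j))
    (fun j => nu (lift i j)) (fun y => expR (tsum (others i phi) y) * E' (glue i x y))
    (fun j => C * D (lift i j)) bF) => j t.
  pose w := \sum_(r | r != j) others i phi r (tnth t r).
  have wB : expR w <= expR (n%:R * B).
    rewrite ler_expR; apply: le_trans (ler_norm _) _.
    apply: le_trans (ler_norm_sum _ _ _) _.
    have B0 : 0 <= B by apply: le_trans (BB ord0 (0 : 'rV[R]_d)).
    apply: (@le_trans _ _ (\sum_(r < n) B)); last by rewrite sumr_const card_ord mulr_natl.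
    rewrite big_mkcond/=; apply: ler_sum => r _; case: ifP => // _; exact: BB.
  have FE z : expR (tsum (others i phi) (upd t j z)) * E' (glue i x (upd t j z)) =
      expR (phi (lift i j) z) * (expR w * E' (setrow (lift i j) z (glue i x t))).
    by rewrite glue_upd tsum_upd expRD -mulrA.
  under eq_Rintegral do rewrite FE.
  under [in X in _ - X]eq_Rintegral do rewrite FE.
  apply: HD; apply: CbM.
    by apply: (@Cb_le _ _ _ _ M2); [rewrite le_max lexx|exact: HM2 sol BB].
  apply: (@Cb_le _ _ _ _ (`|expR w| * M)).
    by rewrite ger0_norm ?expR_ge0// ler_wpM2r.
  by apply: CbZ; exact: Cb_setrow.
rewrite -mulr_sumr ler_wpM2l// [leRHS](bigD1_ord i)//= lerDr.
exact: D0.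
Qed.

(** By [avg_measure], [phi] solves the system of [nu] up to a small residual.
    Stability then bounds its distance to [psi] in L^1, and [avg_increment] turns
    this into a bound against every kernel with [p + 1] bounded derivatives;
    differentiating the kernel gives the other derivatives of the averages. *)
Theorem solutions_lipschitz : exists2 C : R, 0 <= C &
  forall mu nu phi psi (D : I -> R),
  solves mu phi -> solves nu psi ->
  (forall j G M', Cb p.+1 M' G -> `|\int[mu j]_x G x - \int[nu j]_x G x| <= M' * D j) ->
  (forall j, 0 <= D j) ->
  exists kappa : I -> R, \sum_i kappa i = 0 /\
    forall i, Cb k.+1 (C * \sum_j D j) (fun x => phi i x - psi i x + kappa i).
Proof.
pose B := 5 * l; pose N : R := n.+1%:R.
have [C1 C10 HC1] := avg_measure B.
have [C2 C20 HC2] := stability Ec El B.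
(* The summand 1 is there to have [C3 <= C3 ^+ 2]. *)
pose C3 := N * C2 * (expR B * C1) ^+ 2 + 1.
have M0 := Cb_ge0 EC.
have N0 : 0 < N by rewrite ltr0n.
have C31 : 1 <= C3 by rewrite lerDr mulr_ge0 ?sqr_ge0// mulr_ge0 ?ltW.
have C30 := le_trans ler01 C31.
pose C4 := C1 + M * expR (n%:R * B) * (N * C3).
have C40 : 0 <= C4 by rewrite addr_ge0 ?mulr_ge0 ?expR_ge0// ltW.
have [M1 HM1] := avg_Cb B.
pose b := expR (- (n%:R * B + l)).
have [C5 C50 HC5] := @Cb_lnB R 1 d k.+1 b M1 (expR_gt0 _).
exists (C5 * C4); first exact: mulr_ge0.
move=> mu nu phi0 psi0 D sphi0 spsi0 HD D0.
have [kap [kap0 sphi Bphi mphi]] := solves_balance nu sphi0.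
have [kap' [kap'0 spsi Bpsi mpsi]] := solves_balance nu spsi0.
set phi := (fun i x => phi0 i x + kap i) in sphi Bphi mphi.
set psi := (fun i x => psi0 i x + kap' i) in spsi Bpsi mpsi.
set S := \sum_j D j.
have S0 : 0 <= S by exact: sumr_ge0.
have [bphi rphi] := sphi; have [bpsi rpsi] := spsi.
have nu1 i := probability_setT (nu i).
have CE : Cb p.+1 M E by apply: Cb_leq EC; rewrite leq_addl.
have res i x : `|rho nu phi i x - rho nu psi i x| <= expR B * C1 * S.
  rewrite rpsi -(rphi i x) -mulrBr normrM ger0_norm ?expR_ge0// -mulrA.
  apply: ler_pM; rewrite ?expR_ge0//.
    by rewrite ler_expR (le_trans (ler_norm _))//; exact: Bphi.
  rewrite distrC; exact: HC1 sphi Bphi HD D0 CE.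
have L1 j : \int[nu j]_x `|phi j x - psi j x| <= C3 * S.
  apply: Rint_abs_le; [exact: bmfB|exact: mulr_ge0|].
  apply: (@le_trans _ _ (\sum_i \int[nu i]_x ((phi i x - psi i x) ^+ 2))).
    rewrite (bigD1 j)//= lerDl sumr_ge0// => i _.
    by apply: Rintegral_ge0 => x _; rewrite sqr_ge0.
  apply: le_trans (HC2 nu phi psi bphi bpsi Bphi Bpsi mphi mpsi) _.
  apply: (@le_trans _ _ (C2 * \sum_(i < n.+1) (expR B * C1 * S) ^+ 2)).
    apply: (ler_wpM2l (ltW C20)); apply: ler_sum => i _.
    have bd := bmfB (bmf_rho Ec nu i bphi) (bmf_rho Ec nu i bpsi).
    rewrite -(RintC (nu1 i) ((expR B * C1 * S) ^+ 2)).
    have bdd : bmf (fun x => (rho nu phi i x - rho nu psi i x) ^+ 2) by have := bmfM bd bd.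
    apply: (Rint_le (nu1 i) bdd (bmf_cst _ _)) => x.
    rewrite -[leLHS]real_normK ?num_real// lerXn2r ?nnegrE//.
    by rewrite mulr_ge0// mulr_ge0// expR_ge0.
  rewrite sumr_const card_ord -[_ *+ n.+1]mulr_natl -/N.
  rewrite [(expR B * C1 * S) ^+ 2]exprMn [leRHS]exprMn.
  have -> : C2 * (N * ((expR B * C1) ^+ 2 * S ^+ 2)) =
     (N * C2 * (expR B * C1) ^+ 2) * S ^+ 2 by ring.
  rewrite ler_wpM2r ?sqr_ge0//.
  apply: (@le_trans _ _ C3); first by rewrite /C3 lerDl ler01.
  by rewrite expr2 ler_peMl.
exists (fun i => kap i - kap' i); split; first by rewrite sumrB kap0 kap'0 subrr.
move=> i.
have m1 := tprod_mass (fun j => mu (lift i j)).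
have n1 := tprod_mass (fun j => nu (lift i j)).
have bs : bmf (fun y => expR (tsum (others i phi) y)).
  by apply: bmf_expR; apply: bmf_tsum; exact: bmf_others.
have bs' : bmf (fun y => expR (tsum (others i psi) y)).
  by apply: bmf_expR; apply: bmf_tsum; exact: bmf_others.
pose L (f : n.-tuple T -> R) :=
  \int[tprod (fun j => mu (lift i j))]_y (expR (tsum (others i phi) y) * f y) -
  \int[tprod (fun j => nu (lift i j))]_y (expR (tsum (others i psi) y) * f y).
have sB (f : I -> T -> R) y : bounded_by B f -> `|expR (tsum (others i f) y)| <= expR (n%:R * B).
  move=> fB; rewrite ger0_norm ?expR_ge0// ler_expR; apply: le_trans (ler_norm _) _.
  by apply: tsum_bound => j z; exact: fB.
have CD : Cb k.+1 (C4 * S) (fun x => avg mu phi i x - avg nu psi i x).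
  apply: (@Cb_under_functional R n d i L (2 * expR (n%:R * B)) p M) EC.
  - move=> f g bf bg; rewrite /L.
    rewrite (@eq_Rintegral _ _ _ _ setT (fun y => expR (tsum (others i phi) y) * f y -
      expR (tsum (others i phi) y) * g y)); last by move=> y _; rewrite mulrBr.
    rewrite [X in _ - X](@eq_Rintegral _ _ _ _ setT (fun y => expR (tsum (others i psi) y) * f y -
      expR (tsum (others i psi) y) * g y)); last by move=> y _; rewrite mulrBr.
    rewrite (RintB m1 (bmfM bs bf) (bmfM bs bg)) (RintB n1 (bmfM bs' bf) (bmfM bs' bg)).
    by rewrite opprB addrACA [RHS]addrC opprB; ring.
  - move=> a f bf; rewrite /L mulrBr -(RintZ m1 a (bmfM bs bf)) -(RintZ n1 a (bmfM bs' bf)).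
    by congr (_ - _); apply: eq_Rintegral => y _; rewrite mulrCA.
  - move=> f C bf fC; rewrite -mulrA mulr_natl mulr2n.
    apply: le_trans (ler_normB _ _) _; apply: lerD.
      apply: (Rint_norm_le m1 (bmfM bs bf)) => y.
      by rewrite normrM ler_pM//; exact: sB.
    apply: (Rint_norm_le n1 (bmfM bs' bf)) => y.
    by rewrite normrM ler_pM//; exact: sB.
  move=> E' CE' x; rewrite /L.
  rewrite -(subrKA (\int[tprod (fun j => nu (lift i j))]_y
     (expR (tsum (others i phi) y) * E' (glue i x y)))).
  apply: le_trans (ler_normD _ _) _; rewrite mulrDl; apply: lerD.
    exact: HC1 sphi Bphi HD D0 CE'.
  have bg : bmf (fun y : n.-tuple T => E' (glue i x y)) by exact: bmf_glue CE'.
  rewrite -(RintB n1 (bmfM bs bg) (bmfM bs' bg)).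
  under eq_Rintegral do rewrite -mulrBl.
  have CE0 : Cb 0 M E' by apply: Cb_leq CE'.
  apply: le_trans (avg_increment nu i x bphi bpsi Bphi Bpsi CE0) _.
  rewrite -[leRHS]mulrA ler_wpM2l ?mulr_ge0 ?expR_ge0//.
  apply: (@le_trans _ _ (\sum_(j < n.+1) C3 * S)); first exact: ler_sum.
  by rewrite sumr_const card_ord -[_ *+ n.+1]mulr_natl mulrA.
rewrite (_ : (fun x => _) = fun x => - (ln (avg mu phi i x) - ln (avg nu psi i x))); last first.
  apply/funext => x; rewrite opprB -[ln (avg mu _ _ _)]opprK.
  rewrite -(solves_ln i x sphi) -[ln (avg nu _ _ _)]opprK -(solves_ln i x spsi).
  by rewrite /phi /psi; ring.
rewrite -mulrA; apply: CbN; apply: HC5 => //.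
- by apply: Cb_leq (HM1 mu phi i bphi Bphi); rewrite leq_addr.
- by move=> x; have /andP[] := avg_bound Ec El mu i x bphi Bphi.
- by apply: Cb_leq (HM1 nu psi i bpsi Bpsi); rewrite leq_addr.
- by move=> x; have /andP[] := avg_bound Ec El nu i x bpsi Bpsi.
Qed.

End lipschitz_dependence.

(** * The Schrodinger map *)

Section quotient_solutions.
Context {R : realType} {n d : nat}.
Local Notation T := (borelRd R d).
Local Notation I := 'I_n.+1.
Variables (X : I -> set 'rV[R]_d) (k p : nat) (c c' : 'M[R]_(n.+1, d) -> R) (l M : R).
Hypothesis cX : forall i, compact (X i).
Local Notation E := (fun x => expR (- c' x)).
Hypothesis EC : Cb (k.+1 + p.+1) M E.
Hypothesis Ec : Cb 0 (expR l) E.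
Hypothesis El : forall x, expR (- l) <= expR (- c' x).
Hypothesis c'E : {in prodX X, c' =1 c}.
Implicit Types (mu nu : I -> probability T R).

Let mX i : measurable (X i : set T).
Proof. exact: closed_borelRd (compact_closed_rV (@cX i)). Qed.

Lemma measurable_prod_minus i : measurable (prod_minus X i : set (n.-tuple T)).
Proof.
rewrite (_ : prod_minus X i =
  \bigcap_(j in [set: 'I_n]) ((fun t : n.-tuple T => tnth t j) @^-1` X (lift i j))).
  apply: fin_bigcap_measurable => // j _.
  rewrite -[X in measurable X]setTI.
  exact: (@measurable_tnth _ T n j measurableT _ (mX (lift i j))).
by apply/seteqP; split=> [t At j _|t At j]; exact: At.
Qed.

Lemma mass_prod_minus mu i : carried X mu ->
  tprod (fun j => mu (lift i j)) (prod_minus X i) = 1%E.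
Proof.
move=> muX; rewrite (tprodE _ (fun j => mX (lift i j))).
by rewrite big1// => j _; exact: muX.
Qed.

Lemma glue_prodX (i : I) (xi : 'rV[R]_d) (y : n.-tuple T) : X i xi -> prod_minus X i y -> prodX X (glue i xi y).
Proof.
move=> Xx Xy j; rewrite (_ : row j _ = if unlift i j is Some j' then tnth y j' else xi).
  by case: unliftP => [j'|] ->//; exact: Xy.
by apply/rowP => a; rewrite !mxE; case: unlift.
Qed.

Lemma sum_glue (phi : I -> T -> R) (i : I) (xi : 'rV[R]_d) (y : n.-tuple T) :
  \sum_j phi j (row j (glue i xi y)) = phi i xi + tsum (others i phi) y.
Proof.
rewrite (bigD1_ord i)//=; congr (phi i _ + _).
  by apply/rowP => a; rewrite !mxE unlift_none.
apply: eq_bigr => j _; rewrite /others; congr (phi _ _).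
by apply/rowP => a; rewrite !mxE liftK.
Qed.

(** A point glued from points of the supports lies in [prodX X], where the
    extended cost is the given one; there the representatives of a class differ
    by zero-sum constants, which cancel in the exponent. *)
Lemma schrodinger_systemP mu (phi phi' : I -> T -> R) (kappa : I -> R) :
  carried X mu -> family phi -> \sum_i kappa i = 0 ->
  (forall i x, X i x -> phi' i x = phi i x + kappa i) ->
  schrodinger_system X c mu phi' <-> forall i x, X i x -> rho E mu phi i x = 1.
Proof.
move=> muX bphi k0 phiE.
have m1 i := tprod_mass (fun j => mu (lift i j)).
suff H i xi : X i xi -> (\int[mu_minus mu i]_(y in prod_minus X i)
      (expR (\sum_j phi' j (row j (glue i xi y)) - c (glue i xi y)))%:E)%E =
    (rho E mu phi i xi)%:E.
  split=> H1 i xi Xi; have := H1 i xi Xi; rewrite H//.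
    by move/eqP; rewrite lne_eq0 => /eqP[].
  by move=> ->; rewrite lne1.
move=> Xi; have bI := bmf_avg_integrand Ec i xi bphi.
rewrite /rho /avg -(RintZ (m1 i) _ bI).
rewrite -(integral_carried (m1 i) (measurable_prod_minus i) (mass_prod_minus i muX)); last first.
  by apply: bmfM => //; exact: bmf_cst.
apply: eq_integral => y; rewrite inE => Xy.
have XG := glue_prodX Xi Xy.
have -> : \sum_j phi' j (row j (glue i xi y)) = \sum_j phi j (row j (glue i xi y)).
  transitivity (\sum_j (phi j (row j (glue i xi y)) + kappa j)).
    by apply: eq_bigr => j _; rewrite phiE//; exact: XG.
  by rewrite big_split/= k0 addr0.
by rewrite (sum_glue phi i xi y) -(c'E (mem_set XG)) mulrA -!expRD.
Qed.

Lemma Ck_on_bmf i f : Ck_on k.+1 (X i) f ->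
  exists2 g : T -> R, bmf g & forall x, X i x -> g x = f x.
Proof.
have [r Xr] := compact_cube (@cX i).
have br x : X i x -> forall a j, `|x a j| <= r by move=> Xx a j; rewrite (ord1 a); exact: Xr.
move=> /(Ck_on_Cb br)[M' [g [Cg gE]]]; exists g; first exact: bmf_Cb Cg.
by move=> x Xx; rewrite gE// inE.
Qed.

(** The expression [- ln avg] makes sense everywhere and depends only on the
    restriction of the potentials to the supports. *)
Lemma solution_extends mu phi : carried X mu -> family phi ->
  (forall i x, X i x -> rho E mu phi i x = 1) ->
  exists2 psi, solves E mu psi & forall i x, X i x -> psi i x = phi i x.
Proof.
move=> muX bphi sol.
pose psi i x := - ln (avg E mu phi i x).
have a0 i x := avg_gt0 Ec El mu i x bphi.
have psiE i x : X i x -> psi i x = phi i x.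
  move=> Xx; rewrite /psi -lnV ?posrE ?a0//.
  by rewrite -[RHS]expRK -[expR _](mulfK (lt0r_neq0 (a0 i x))) -/(rho E mu phi i x) sol// mul1r.
have bpsi : family psi by move=> i; apply: bmfN; exact: (bmf_ln_avg Ec El).
exists psi => //; split=> // i x.
rewrite /rho (_ : avg E mu psi i x = avg E mu phi i x).
  by rewrite expRN lnK ?posrE ?a0// mulVf// gt_eqF// a0.
apply: (eq_Rint_carried (tprod_mass _) (measurable_prod_minus i) (mass_prod_minus i muX)).
- exact: (bmf_avg_integrand Ec i x bpsi).
- exact: (bmf_avg_integrand Ec i x bphi).
move=> y Xy; congr (expR _ * _); apply: eq_bigr => j _; exact: psiE.
Qed.

Local Open Scope quotient_scope.

(** The class chosen by [xget] satisfies the system, since some class does. Its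
    representatives solve it on the supports only, and one of them is replaced by
    a global solution of the same class. *)
Lemma schrodinger_map_solves mu : carried X mu -> exists phi : potential k.+1 X,
  schrodinger_map X k.+1 c mu = \pi_(Ctilde k.+1 X) phi /\ solves E mu phi.
Proof.
move=> muX.
have pot psi : solves E mu psi -> psi \in @is_potential R n.+1 d k.+1 X.
  move=> sol; apply/asboolP => i; exists (psi i); split=> //.
  exact: (solves_Ck EC Ec El i sol).
have [psi0 sol0] := schrodinger_existence Ec El mu.
have /= := @xgetPex _ (0 : Ctilde k.+1 X) [set A : Ctilde k.+1 X | forall phi : potential k.+1 X,
  \pi_(Ctilde k.+1 X) phi = A -> schrodinger_system X c mu phi].
rewrite -/(schrodinger_map X k.+1 c mu) => Hget.
have [phi0 AE] := Ctilde_surj (schrodinger_map X k.+1 c mu).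
have sys0 : schrodinger_system X c mu phi0.
  apply: Hget => //.
  exists (\pi_(Ctilde k.+1 X) (Potential (pot _ sol0))) => phi /eqP/pi_eqP[kappa [k0 phiE]].
  apply/(schrodinger_systemP muX sol0.1 k0 phiE) => i x _; exact: sol0.2.
have Cphi0 i : Ck_on k.+1 (X i) (phi0 i).
  by case: (phi0) => f /= /asboolP.
have [g gP] := choice (fun i => (exists2P _ _).1 (Ck_on_bmf (Cphi0 i))).
have bg : family g by move=> i; have [] := gP i.
have [psi solpsi psiE] : exists2 psi, solves E mu psi & forall i x, X i x -> psi i x = g i x.
  apply: solution_extends => //.
  apply/(@schrodinger_systemP mu g phi0 (fun=> 0)) => //; first by rewrite big1.
  by move=> i x Xx; rewrite addr0; have [_ ->] := gP i.
exists (Potential (pot _ solpsi)); split=> //.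
rewrite AE; apply/eqP/pi_eqP; exists (fun=> 0); split; first by rewrite big1.
by move=> i x Xx; rewrite addr0 /= psiE//; have [_ ->] := gP i.
Qed.

Lemma Ck_norm_le q (K : set 'rV[R]_d) (f : 'rV[R]_d -> R) (C : R) : Cb q C f ->
  (Ck_norm q K f <= C%:E)%E.
Proof.
move=> Cf; apply: (@le_trans _ _ (ereal_sup
    [set y | exists2 a : multi_index 1 d q, (order a <= q)%N &
             exists x, y = `|mpartial a f x|%:E])).
  by apply: ereal_inf_lbound; exists f => //; split=> //; exact: Cb_Ck Cf.
apply: ge_ereal_sup => _ [a oa [x ->]]; rewrite lee_fin; exact: partial_bound Cf oa x.
Qed.

Lemma Ctilde_normB_le (phi psi : potential k.+1 X) (kappa : I -> R) (C : R) :
  \sum_i kappa i = 0 ->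
  (forall i, Cb k.+1 C (fun x => phi i x - psi i x + kappa i)) ->
  (Ctilde_norm ((\pi_(Ctilde k.+1 X) phi : Ctilde k.+1 X) - \pi_(Ctilde k.+1 X) psi)%R <= (n.+1%:R * C)%:E)%E.
Proof.
move=> k0 HC.
have pot : (fun i x => phi i x - psi i x + kappa i) \in @is_potential R n.+1 d k.+1 X.
  by apply/asboolP => i; eexists; split; [exact: Cb_Ck (HC i)|].
apply: (@le_trans _ _ (\sum_i Ck_norm k.+1 (X i) (Potential pot i))%E).
  apply: ereal_inf_lbound; exists (Potential pot) => //.
  rewrite -[_ - _]/(Ctilde_add _ (Ctilde_opp _)) Ctilde_oppE Ctilde_addE.
  by apply/eqP/pi_eqP; exists kappa.
apply: (@le_trans _ _ (\sum_(i < n.+1) C%:E)%E).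
  by apply: lee_sum => i _; exact: (Ck_norm_le (X i) (HC i)).
by rewrite sumEFin lee_fin sumr_const card_ord mulr_natl.
Qed.

Lemma schrodinger_map_lipschitz : exists2 C : R, 0 < C &
    forall mu nu, carried X mu -> carried X nu ->
      (Ctilde_norm (schrodinger_map X k.+1 c mu - schrodinger_map X k.+1 c nu)%R
       <= C%:E * Hmp_distN X p.+1 mu nu)%E.
Proof.
have [C0 C00 HC0] := solutions_lipschitz EC Ec El.
have [C1 HC1] := choice (fun i => (exists2P _ _).1 (Hmp_dist_test p.+1 (@cX i))).
have C10 i : 0 < C1 i by have [] := HC1 i.
pose Cs := \sum_i C1 i.
have Cs0 : 0 <= Cs by apply: sumr_ge0 => i _; exact: ltW.
pose C := n.+1%:R * C0 * Cs + 1.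
have C_gt0 : 0 < C by rewrite ltr_wpDl// !mulr_ge0.
exists C => // mu nu muX nuX.
have H0 i : (0 <= Hmp_dist p.+1 (X i) (mu i) (nu i))%E by exact: Hmp_dist_ge0.
have [->|fin] := eqVneq (Hmp_distN X p.+1 mu nu) +oo%E; first by rewrite gt0_muley ?leey.
pose D i := fine (Hmp_dist p.+1 (X i) (mu i) (nu i)).
have DE i : Hmp_dist p.+1 (X i) (mu i) (nu i) = (D i)%:E.
  rewrite fineK// ge0_fin_numE//; apply: le_lt_trans (_ : (Hmp_distN X p.+1 mu nu < +oo)%E).
    by rewrite /Hmp_distN (bigD1 i)//= leeDl// sume_ge0.
  by rewrite ltey.
have D0 i : 0 <= D i by rewrite fine_ge0.
have [phi [-> sphi]] := schrodinger_map_solves muX.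
have [psi [-> spsi]] := schrodinger_map_solves nuX.
have [|j|kappa [k0 Hk]] := HC0 mu nu phi psi (fun i => C1 i * D i) sphi spsi.
- move=> j G M' CG; have [_ H] := HC1 j.
  by rewrite mulrCA mulrA; exact: H (muX j) (nuX j) (DE j) G M' CG.
- by rewrite mulr_ge0// ltW.
apply: le_trans (Ctilde_normB_le k0 Hk) _.
rewrite /Hmp_distN (eq_bigr (fun i => (D i)%:E)) => [|i _]; last exact: DE.
rewrite sumEFin -EFinM lee_fin.
have DS : \sum_i C1 i * D i <= Cs * \sum_i D i.
  rewrite mulr_sumr; apply: ler_sum => i _; rewrite ler_wpM2r//.
  by rewrite /Cs (bigD1 i)//= lerDl sumr_ge0// => j _; exact: ltW.
rewrite mulrA; apply: le_trans (ler_wpM2l _ DS) _; first by rewrite mulr_ge0.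
by rewrite mulrA ler_wpM2r ?sumr_ge0// lerDl.
Qed.

End quotient_solutions.

Theorem proposition2p5 (R : realType) (N d k p : nat)
    (X : 'I_N -> set 'rV[R]_d) (c : 'M[R]_(N, d) -> R) :
  (2 <= N)%N ->
  (forall i, compact (X i)) ->
  (forall i, convex_set (X i)) ->
  (0 < k)%N ->
  (0 < p)%N ->
  d%:R / 2 < p%:R :> R ->
  Ck_on (k + p) (prodX X) c ->
  exists2 C : R, 0 < C &
    forall mu nu : 'I_N -> probability (borelRd R d) R,
      carried X mu -> carried X nu ->
      (Ctilde_norm (schrodinger_map X k c mu - schrodinger_map X k c nu)%R
       <= C%:E * Hmp_distN X p mu nu)%E.
Proof.
case: N X c => // n X c _ cX _; case: k => // k _; case: p => // p _ _ Cc.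
have [r Xr] := choice (fun i => compact_cube (cX i)).
have [|M [c' [Cc' c'E]]] := @Ck_on_Cb R n.+1 d _ _ (\sum_i `|r i|) c _ Cc.
  move=> x Xx i j; have := Xr i _ (Xx i) j; rewrite mxE => /le_trans; apply.
  by apply: le_trans (ler_norm _) _; rewrite (bigD1 i)//= lerDl sumr_ge0.
have [ME HE] := @Cb_expR R n.+1 d (k.+1 + p.+1) M.
have EC := HE _ (CbN Cc').
have c'M x : - M <= - c' x <= M.
  by have := Cb_bound Cc' x; rewrite -normrN ler_norml.
(* The bound [M] on the derivatives of the extended cost also bounds the cost. *)
apply: (@schrodinger_map_lipschitz R n d X k p c c' M ME cX EC) => //.
- split=> // [|x]; first exact: Cb_continuous EC.
  by rewrite ger0_norm ?expR_ge0// ler_expR; have /andP[] := c'M x.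
- by move=> x; rewrite ler_expR; have /andP[] := c'M x.
Qed.
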